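(* Let $(\xi^*,\zeta^* )\in\mathcal A^\circ_0(\mathbb F^1)\times\mathcal A^\circ_0(\mathbb F^2)$ be an optimal pair. Assume that the processes $$t\mapsto{}^o\Big(\int_{[0,\cdot)}g_s\,d\zeta^*_s\Big)^{\mathbb F^1}_{t\wedge\tau_*(z)}\quad\text{and}\quad t\mapsto{}^o\Big(\int_{[0,\cdot)}f_s\,d\xi^*_s\Big)^{\mathbb F^2}_{t\wedge\sigma_*(z)}$$ are of bounded variation and continuous for $z\in[0,1]$. Then, for $z\in[0,1)$, the processes $t\mapsto\hat V^{*,1}_{t\wedge\tau_*(z)}$ and $t\mapsto\hat V^{*,2}_{t\wedge\sigma_*(z)}$ are càdlàg with semimartingale decompositions $$\hat V^{*,1}_{t\wedge\tau_*(z)}=\hat V^{*,1}_0+A^1_t+B^1_t\quad\text{and}\quad\hat V^{*,2}_{t\wedge\sigma_*(z)}=\hat V^{*,2}_0+A^2_t+B^2_t,$$ where $A^i$ is the previsible bounded variation part and $B^i$ the martingale part, with $$A^1_t=-{}^o\Big(\int_{[0,\cdot)}g_s\,d\zeta^*_s\Big)^{\mathbb F^1}_{t\wedge\tau_*(z)},\quad B^1_t=M^0_{t\wedge\tau_*(z)}-M^0_0,$$ $$A^2_t=-{}^o\Big(\int_{[0,\cdot)}f_s\,d\xi^*_s\Big)^{\mathbb F^2}_{t\wedge\sigma_*(z)},\quad B^2_t=N^0_{t\wedge\sigma_*(z)}-N^0_0.$$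
   Context: Let $T\in(0,\infty)$ and let $(\Omega,\mathcal F,\mathsf P)$ be a complete probability space with a right-continuous filtration $\mathbb F=(\mathcal F_t)_{t\in[0,T]}$ completed with $\mathsf P$-null sets, $\mathcal F_T\subsetneq\mathcal F$. Right-continuous filtrations $\mathbb F^i=(\mathcal F^i_t)_{t\in[0,T]}$, $i=1,2$, completed with null sets, satisfy $\mathcal F^1_t\vee\mathcal F^2_t\subseteq\mathcal F_t$. $\mathcal L_b(\mathsf P)$ is the space of càdlàg $\mathcal B([0,T])\times\mathcal F$-measurable $X$ with $\mathsf E[\sup_{0\le t\le T}|X_t|]<\infty$. The payoff processes $f,g,h\in\mathcal L_b(\mathsf P)$ are $\mathbb F$-adapted with $f_t\ge h_t\ge g_t$ for all $t\in[0,T]$ a.s. For a filtration $\mathbb G\subseteq\mathbb F$ and a $\mathbb G$-stopping time $\theta\in[0,T]$: $\mathcal T_\theta(\mathbb G)$ is the set of $\mathbb G$-stopping times with values in $[\theta,T]$; $\mathcal A^\circ_\theta(\mathbb G)$ is the set of $\mathbb G$-adapted càdlàg non-decreasing $\rho$ with $\rho_{\theta-}=0$, $\rho_T=1$ (for $\theta=0$, $\rho_{0-}:=0$, so $d\rho$ may charge $\{0\}$); $\Delta\rho_t=\rho_t-\rho_{t-}$. The $\mathbb G$-randomised stopping time generated by $\rho\in\mathcal A^\circ_\theta(\mathbb G)$ is $\eta=\inf\{t\in[0,T]:\rho_t>Z\}$ with $Z\sim U([0,1])$ independent of $\mathcal F_T$; the class of these is $\mathcal T^R_\theta(\mathbb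 G)$. The randomisation devices $Z$ of the two players are independent. Game: $\mathcal P(\tau,\sigma)=f_\tau\mathbf 1_{\{\tau<\sigma\}}+h_\tau\mathbf 1_{\{\tau=\sigma\}}+g_\sigma\mathbf 1_{\{\sigma<\tau\}}$; Player 1 picks $\tau\in\mathcal T^R_0(\mathbb F^1)$ to minimise, Player 2 picks $\sigma\in\mathcal T^R_0(\mathbb F^2)$ to maximise $\mathsf E[\mathcal P(\tau,\sigma)]$. A pair $(\xi^*,\zeta^* )\in\mathcal A^\circ_0(\mathbb F^1)\times\mathcal A^\circ_0(\mathbb F^2)$ is optimal if it generates a saddle point $(\tau_*,\sigma_* )$: $\mathsf E[\mathcal P(\tau_*,\sigma)]\le\mathsf E[\mathcal P(\tau_*,\sigma_* )]\le\mathsf E[\mathcal P(\tau,\sigma_* )]$ for all $(\tau,\sigma)\in\mathcal T^R_0(\mathbb F^1)\times\mathcal T^R_0(\mathbb F^2)$. For $z\in[0,1)$, $\tau_*(z)=\inf\{t\in[0,T]:\xi^*_t>z\}$, $\sigma_*(z)=\inf\{t\in[0,T]:\zeta^*_t>z\}$; $\tau_*(1)=\inf\{t\in[0,T]:\xi^*_t=1\}$, $\sigma_*(1)=\inf\{t\in[0,T]:\zeta^*_t=1\}$. $(\hat V^{*,1}_t)$ and $(\hat V^{*,2}_t)$ are the (unique up to indistinguishability) $\mathbb F^1$-optional, respectively $\mathbb F^2$-optional, semi-martingales (not necessarily càdlàg) such that for all $\theta\in\mathcal T_0(\mathbb F^1)$, $\gamma\in\mathcal T_0(\mathbb F^2)$,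 a.s., $$\hat V^{*,1}_\theta=\operatorname*{ess\,inf}_{\tau\in\mathcal T_\theta(\mathbb F^1)}\mathsf E\Big[f_\tau(1-\zeta^*_\tau)+\int_{[\theta,\tau)}g_u\,d\zeta^*_u+h_\tau\Delta\zeta^*_\tau\Big|\mathcal F^1_\theta\Big],$$ $$\hat V^{*,2}_\gamma=\operatorname*{ess\,sup}_{\sigma\in\mathcal T_\gamma(\mathbb F^2)}\mathsf E\Big[g_\sigma(1-\xi^*_\sigma)+\int_{[\gamma,\sigma)}f_u\,d\xi^*_u+h_\sigma\Delta\xi^*_\sigma\Big|\mathcal F^2_\gamma\Big]$$ (their existence is a known fact here). ${}^o(X)^{\mathbb G}$ denotes the $\mathbb G$-optional projection of a measurable process $X$ under $\mathsf P$: the unique $\mathbb G$-optional process with ${}^o(X)^{\mathbb G}_\tau=\mathsf E[X_\tau|\mathcal G_\tau]$ a.s. for all $\tau\in\mathcal T_0(\mathbb G)$. $(M^0_t)$ and $(N^0_t)$ are the (unique up to indistinguishability) càdlàg $\mathbb F^1$-submartingale and càdlàg $\mathbb F^2$-supermartingale with, a.s., $M^0_\theta=\mathsf E[\int_{[0,\theta)}g_t\,d\zeta^*_t|\mathcal F^1_\theta]+\hat V^{*,1}_\theta$ for all $\theta\in\mathcal T_0(\mathbb F^1)$ and $N^0_\gamma=\mathsf E[\int_{[0,\gamma)}f_t\,d\xi^*_t|\mathcal F^2_\gamma]+\hat V^{*,2}_\gamma$ for all $\gamma\in\mathcal T_0(\mathbb F^2)$ (their existence is a known fact here). *)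

(* Defs.v *)
From HB Require Import structures.
From mathcomp Require Import all_boot all_order all_algebra.
From mathcomp Require Import all_classical all_reals all_analysis.

Set Implicit Arguments.
Unset Strict Implicit.
Unset Printing Implicit Defensive.

Import Order.TTheory GRing.Theory Num.Theory.
Import numFieldNormedType.Exports.

Local Open Scope classical_set_scope.
Local Open Scope ring_scope.

(* Time is the interval [0, T] of R: paths are functions on R, and processes
   functions of time and chance, whose values outside [0, T] are irrelevant. *)

Section Paths.
Context {R : realType}.
Implicit Types (T : R) (x : R -> R).

Definition cadlag T x : Prop :=
  (forall t, 0 <= t < T -> x @ t^'+ --> x t) /\
  (forall t, 0 < t <= T -> cvg (x @ t^'-)).

Definition left_continuous T x : Prop :=
  forall t, 0 < t <= T -> x @ t^'- --> x t.

(* The measure with distribution function x.  The default mzero is only used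
   when x is not a distribution function (nondecreasing, right-continuous). *)
Definition stieltjes x : {measure set (measurableTypeR R) -> \bar R} :=
  match pselect (nondecreasing x /\ right_continuous x) with
  | left H => lebesgue_stieltjes_measure
      (HB.pack_for (cumulative R R) x (isCumulative.Build R _ R x H.1 H.2))
  | right _ => mzero
  end.

Lemma stieltjesE (x : cumulative R R) :
  stieltjes x = lebesgue_stieltjes_measure x :> (set _ -> \bar R).
Proof.
rewrite /stieltjes; case: pselect => [[a b]|[]]; last first.
  by split; [exact: cumulative_is_nondecreasing|
             exact: cumulative_is_right_continuous].
case: x a b => x [[c e]] /= a b.
have -> : a = c by apply: Prop_irrelevance.
by have -> : b = e by apply: Prop_irrelevance.
Qed.

End Paths.

Section Processes.
Context {R : realType} {d : measure_display} {Omega : measurableType d}.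
Implicit Types (P : probability Omega R) (T : R) (G H : set (set Omega))
  (F : R -> set (set Omega)) (X Y : R -> Omega -> R) (U V Z : Omega -> R)
  (rho : R -> Omega -> R) (theta tau sigma : Omega -> R).

(* sigma(X restricted to D) is contained in the set system G *)
Definition measurable_wrt (S : Type) (D : set S) (G : set (set S)) (X : S -> R)
  : Prop := preimage_set_system D X measurable `<=` G.

Definition complete_right_continuous_filtration P T F : Prop :=
  [/\ forall t, 0 <= t <= T -> sigma_algebra setT (F t) /\ F t `<=` measurable,
      forall s t, 0 <= s -> s <= t -> t <= T -> F s `<=` F t,
      forall t, 0 <= t < T -> \bigcap_(s in `]t, T]) F s `<=` F t &
      forall t, 0 <= t <= T -> P.-negligible `<=` F t].

Definition adapted T F X : Prop :=
  forall t, 0 <= t <= T -> measurable_wrt setT (F t) (X t).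

(* stopping_time T F theta is the set of F-stopping times with values
   in [theta, T] *)
Definition stopping_time T F theta : set (Omega -> R) :=
  [set tau | (forall w, theta w <= tau w <= T) /\
             (forall t, 0 <= t <= T -> F t [set w | tau w <= t])].

Definition stopped_sigma_algebra T F tau : set (set Omega) :=
  [set A | F T A /\
           forall t, 0 <= t <= T -> F t (A `&` [set w | tau w <= t])].

Definition at_time X tau : Omega -> R := fun w => X (tau w) w.

Definition stopped X tau : R -> Omega -> R :=
  fun t w => X (Num.min t (tau w)) w.

Definition is_condexp P G U V : Prop :=
  [/\ P.-integrable setT (EFin \o U), measurable_wrt setT G V,
      P.-integrable setT (EFin \o V) &
      forall A, G A -> (\int[P]_(w in A) V w = \int[P]_(w in A) U w)%R].

(* a version of E[U | G] chosen once and for all; the default 0 is only used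
   when there is none, that is, when U is not integrable *)
Definition condexp P G U : Omega -> R := xget (cst 0) (is_condexp P G U).

(* of a family of random variables: the greatest a.s. lower (least a.s. upper)
   bound, unlike the library's ess_inf (ess_sup) of a single function *)
Definition is_essinf P (C : set (Omega -> R)) V : Prop :=
  [/\ measurable_fun setT V,
      forall U, C U -> {ae P, forall w, V w <= U w} &
      forall V', measurable_fun setT V' ->
        (forall U, C U -> {ae P, forall w, V' w <= U w}) ->
        {ae P, forall w, V' w <= V w}].

Definition is_esssup P (C : set (Omega -> R)) V : Prop :=
  [/\ measurable_fun setT V,
      forall U, C U -> {ae P, forall w, U w <= V w} &
      forall V', measurable_fun setT V' ->
        (forall U, C U -> {ae P, forall w, U w <= V' w}) ->
        {ae P, forall w, V w <= V' w}].

Definition time_chance T : set (R * Omega) := `[0, T] `*` setT.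

(* The sigma-algebra on [0, T] x Omega generated by the F-adapted processes
   all of whose paths satisfy C. *)
Definition generated_by_processes T F (C : (R -> R) -> Prop)
  : set (set (R * Omega)) :=
  <<s time_chance T, \bigcup_(Y in [set Y | adapted T F Y /\
                                            forall w, C (Y ^~ w)])
      preimage_set_system (time_chance T) (fun p => Y p.1 p.2) measurable >>.

Definition optional T F X : Prop :=
  measurable_wrt (time_chance T) (generated_by_processes T F (cadlag T))
    (fun p => X p.1 p.2).

Definition previsible T F X : Prop :=
  measurable_wrt (time_chance T)
    (generated_by_processes T F (left_continuous T)) (fun p => X p.1 p.2).

Definition is_optional_projection P T F X Y : Prop :=
  optional T F Y /\
  forall tau, stopping_time T F (cst 0) tau ->
    {ae P, forall w, at_time Y tau w =
      condexp P (stopped_sigma_algebra T F tau) (at_time X tau) w}.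

Definition cadlag_adapted_integrable P T F X : Prop :=
  [/\ adapted T F X, {ae P, forall w, cadlag T (X ^~ w)} &
      forall t, 0 <= t <= T -> P.-integrable setT (EFin \o X t)].

Definition submartingale P T F X : Prop :=
  cadlag_adapted_integrable P T F X /\
  forall s t, 0 <= s -> s <= t -> t <= T ->
    {ae P, forall w, X s w <= condexp P (F s) (X t) w}.

Definition supermartingale P T F X : Prop :=
  cadlag_adapted_integrable P T F X /\
  forall s t, 0 <= s -> s <= t -> t <= T ->
    {ae P, forall w, condexp P (F s) (X t) w <= X s w}.

Definition martingale P T F X : Prop :=
  cadlag_adapted_integrable P T F X /\
  forall s t, 0 <= s -> s <= t -> t <= T ->
    {ae P, forall w, X s w = condexp P (F s) (X t) w}.

Definition local_martingale P T F X : Prop :=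
  [/\ adapted T F X, {ae P, forall w, cadlag T (X ^~ w)} &
      exists tau : nat -> Omega -> R,
      [/\ forall n, stopping_time T F (cst 0) (tau n),
          forall n w, tau n w <= tau n.+1 w,
          {ae P, forall w, exists n, tau n w = T} &
          forall n, martingale P T F
            (fun t w => stopped X (tau n) t w - X 0 w)]].

(* Optional semimartingale under the usual conditions: the paths of the finite
   variation part, hence of X, need not be right- or left-continuous. *)
Definition optional_semimartingale P T F X : Prop :=
  optional T F X /\
  exists M A : R -> Omega -> R,
  [/\ local_martingale P T F M, optional T F A,
      {ae P, forall w, bounded_variation 0 T (A ^~ w)} &
      {ae P, forall w t, 0 <= t <= T -> X t w = M t w + A t w}].

(* X = X_0 + A + B with A the previsible bounded variation part and B the
   martingale part, both null at time 0 *)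
Definition semimartingale_decomposition P T F X A B : Prop :=
  [/\ previsible T F A,
      {ae P, forall w, [/\ cadlag T (A ^~ w), bounded_variation 0 T (A ^~ w)
                         & A 0 w = 0]},
      martingale P T F B,
      {ae P, forall w, B 0 w = 0} &
      {ae P, forall w t, 0 <= t <= T -> X t w = X 0 w + A t w + B t w}].

Definition Lb P T X : Prop :=
  [/\ forall w, cadlag T (X ^~ w),
      measurable_fun (time_chance T) (fun p => X p.1 p.2) &
      (\int[P]_w ereal_sup [set `|X t w|%:E | t in `[0%R, T]] < +oo)%E].

(* rho_{0-} = 0 and monotonicity leave the condition 0 <= rho_0 *)
Definition generating_process T F rho : Prop :=
  [/\ adapted T F rho,
      forall w, cadlag T (rho ^~ w),
      forall w s t, 0 <= s -> s <= t -> t <= T -> rho s w <= rho t w,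
      forall w, 0 <= rho 0 w &
      forall w, rho T w = 1].

(* rho extended to R by rho_{0-} = 0 before time 0 and by rho_T after T *)
Definition extended_path T rho w : R -> R :=
  fun t => if t < 0 then 0 else rho (Num.min t T) w.

Definition jump T rho t w : R := rho t w - lim (extended_path T rho w @ t^'-).

(* the integral of b over [s, t) with respect to d rho; by the choice of the
   extension, an initial jump rho_0 is an atom at time 0 *)
Definition stieltjes_integral T (b rho : R -> Omega -> R) (s t : R) w : R :=
  (\int[stieltjes (extended_path T rho w)]_(u in `[s, t[) b u w)%R.

(* inf {t | rho_t > Z}; for rho a generating process the set is empty only
   if Z >= 1, a null event for uniform Z, on which mathcomp's inf is 0 *)
Definition randomised_time T rho Z : Omega -> R :=
  fun w => inf [set t | 0 <= t <= T /\ Z w < rho t w].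

Definition level_time T rho (z : R) : Omega -> R :=
  if z < 1 then randomised_time T rho (cst z)
  else fun w => inf [set t | 0 <= t <= T /\ rho t w = 1].

(* Z1 and Z2 are uniform on [0, 1], and Z1, Z2 and G are independent *)
Definition randomisation_devices P G (Z1 Z2 : Omega -> R) : Prop :=
  [/\ measurable_fun setT Z1, measurable_fun setT Z2,
      forall B, measurable B -> P (Z1 @^-1` B) = uniform_prob (@ltr01 R) B,
      forall B, measurable B -> P (Z2 @^-1` B) = uniform_prob (@ltr01 R) B &
      forall A B1 B2, G A -> measurable B1 -> measurable B2 ->
        P (A `&` Z1 @^-1` B1 `&` Z2 @^-1` B2)
        = (P A * P (Z1 @^-1` B1) * P (Z2 @^-1` B2))%E].

Definition game_payoff (f g h : R -> Omega -> R) tau sigma : Omega -> R :=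
  fun w => if tau w < sigma w then f (tau w) w
           else if tau w == sigma w then h (tau w) w
           else g (sigma w) w.

(* F1 and F2 are the filtrations of the (minimising) first and the
   (maximising) second player, G is the sigma-algebra of which the
   randomisation devices are independent. *)
Definition optimal_pair P T G F1 F2 (f g h xi zeta : R -> Omega -> R) : Prop :=
  [/\ generating_process T F1 xi, generating_process T F2 zeta &
   exists Z1 Z2 : Omega -> R,
   let tau := randomised_time T xi Z1 in
   let sigma := randomised_time T zeta Z2 in
   [/\ randomisation_devices P G Z1 Z2,
       forall zeta' Z, generating_process T F2 zeta' ->
         randomisation_devices P G Z1 Z ->
         ('E_P[game_payoff f g h tau (randomised_time T zeta' Z)]
          <= 'E_P[game_payoff f g h tau sigma])%E &
       forall xi' Z, generating_process T F1 xi' ->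
         randomisation_devices P G Z Z2 ->
         ('E_P[game_payoff f g h tau sigma]
          <= 'E_P[game_payoff f g h (randomised_time T xi' Z) sigma])%E]].

(* a_tau (1 - rho_tau) + int_[theta, tau) b d rho + h_tau Delta rho_tau *)
Definition stopping_payoff T (a b h rho : R -> Omega -> R) theta tau
  : Omega -> R :=
  fun w => a (tau w) w * (1 - rho (tau w) w)
           + stieltjes_integral T b rho (theta w) (tau w) w
           + h (tau w) w * jump T rho (tau w) w.

Definition conditional_payoffs P T F (a b h rho : R -> Omega -> R) theta
  : set (Omega -> R) :=
  [set condexp P (stopped_sigma_algebra T F theta)
         (stopping_payoff T a b h rho theta tau)
  | tau in stopping_time T F theta].

(* V^{*,1}, for F := F^1, (a, b, rho) := (f, g, zeta) *)
Definition essinf_value_process P T F (a b h rho V : R -> Omega -> R) : Prop :=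
  optional_semimartingale P T F V /\
  forall theta, stopping_time T F (cst 0) theta ->
    is_essinf P (conditional_payoffs P T F a b h rho theta)
      (at_time V theta).

(* V^{*,2}, for F := F^2, (a, b, rho) := (g, f, xi) *)
Definition esssup_value_process P T F (a b h rho V : R -> Omega -> R) : Prop :=
  optional_semimartingale P T F V /\
  forall theta, stopping_time T F (cst 0) theta ->
    is_esssup P (conditional_payoffs P T F a b h rho theta)
      (at_time V theta).

Definition integral_process T (b rho : R -> Omega -> R) : R -> Omega -> R :=
  fun t w => stieltjes_integral T b rho 0 t w.

(* M_theta = E[int_[0, theta) b d rho | F_theta] + V_theta at all stopping
   times *)
Definition value_plus_integral P T F (b rho V M : R -> Omega -> R) : Prop :=
  forall theta, stopping_time T F (cst 0) theta ->
    {ae P, forall w, at_time M theta w =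
      condexp P (stopped_sigma_algebra T F theta)
        (at_time (integral_process T b rho) theta) w + at_time V theta w}.

End Processes.

(* Main.v *)
Require Import Defs.
From HB Require Import structures.
From mathcomp Require Import all_boot all_order all_algebra.
From mathcomp Require Import all_classical all_reals all_analysis.
From mathcomp Require Import measurable_realfun ring.

(* Conditioning on the uniform devices, the value of the game is the mean over
   y of the expected payoff J(y) of Player 1's pure time at level y against the
   opponent, while optimality of the pair bounds J(y) below by that value; hence
   some level y in ]z, 1[ is an optimal pure time tau'.  For a stopping time
   theta <= tau', switching from tau' to another time on an event of F_theta
   shows that tau' attains the essential infimum V_theta, so that M_theta is the
   conditional expectation given F_theta of the payoff of tau'.  Therefore M is a
   martingale up to the time tau <= tau' of level z.

   V + G - M stopped at tau vanishes at all stopping times and has right limits,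
   because V is a semimartingale.  Completeness and the measurable projection
   theorem then show that it is evanescent, which makes V stopped at tau cadlag
   and gives its decomposition; the part -G is previsible because it is
   continuous off a null event.  Player 2 is symmetric. *)

Set Implicit Arguments.
Unset Strict Implicit.
Unset Printing Implicit Defensive.

Import Order.TTheory GRing.Theory Num.Theory.
Import numFieldNormedType.Exports.

Local Open Scope classical_set_scope.
Local Open Scope ring_scope.

(** * Conditional expectation *)

(** The payoff against the opponent contains a Stieltjes integral along a random path.
    [stieltjes_quantile] makes it tractable: the measure of a generating path is the image of the
    uniform law under the generalised inverse of the path. The payoff of a pure time thus becomes an
    integral over the opponent's level, and Fubini yields measurability, integrability and the mean
    over levels alike. As the devices are independent of [F T] only, this takes place on Omega with
    the sigma-algebra [F T].

    The level y lies strictly above z because optimality is known for almost every level only: z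
    itself may be exceptional, whereas z < 1 leaves room above it. Going back from y to z is
    harmless, since one and the same variable is conditioned on F_theta for every theta before level
    y.

    The opponent's process need not be adapted to the player's filtration, so two filtrations are
    carried along: F' of the player inside F. This is also why the past integral enters M only
    through conditional expectations.

    The identities for V hold at each stopping time off a null event depending on that time; passing
    to all times at once is the delicate point, as V is not known to be right-continuous. *)

Lemma measurable_bool_set {d} {S : measurableType d} (b : S -> bool) :
  measurable_fun setT b -> measurable [set x | b x].
Proof.
move=> mb; have := mb measurableT [set true] I; rewrite setTI.
suff -> : b @^-1` [set true] = [set x | b x] by [].
by apply/seteqP; split=> x /=; [move=> ->|].
Qed.

Section SubSigmaAlgebra.
Context {R : realType} {d : measure_display} {Omega : measurableType d}.
Variables (P : probability Omega R) (G : set (set Omega)).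
Hypotheses (sG : sigma_algebra setT G) (Gm : G `<=` measurable).

Lemma sub_measurableE : @measurable _ (g_sigma_algebraType G) = G.
Proof. exact: measurable_g_measurableTypeE. Qed.

Lemma measurable_wrtP (X : Omega -> R) : measurable_wrt setT G X <->
  measurable_fun setT (X : g_sigma_algebraType G -> R).
Proof.
split=> [GX _ Y mY|mX A [Y mY <-]].
  by rewrite sub_measurableE; apply: GX; exists Y.
by rewrite -sub_measurableE; exact: mX.
Qed.

Lemma measurable_subid :
  measurable_fun setT (id : Omega -> g_sigma_algebraType G).
Proof. by move=> _ Y; rewrite sub_measurableE setTI => /Gm. Qed.

Definition subid : {mfun Omega >-> g_sigma_algebraType G} :=
  HB.pack (id : Omega -> g_sigma_algebraType G)
    (isMeasurableFun.Build _ _ _ _ _ measurable_subid).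

(** The restriction of P to G. Written as an image measure under the identity, it inherits the
    change of variables formula. *)
Definition sub_prob : probability (g_sigma_algebraType G) R :=
  distribution P subid.

Lemma measurable_wrt_fun (X : Omega -> R) :
  measurable_wrt setT G X -> measurable_fun setT X.
Proof. by move=> GX _ Y mY; apply: Gm; apply: GX; exists Y. Qed.

Lemma sub_ge0_integral A (f : Omega -> \bar R) : G A ->
  @measurable_fun _ _ (g_sigma_algebraType G) _ A f ->
  (forall w, A w -> 0 <= f w)%E ->
  (\int[sub_prob]_(w in A) f w = \int[P]_(w in A) f w)%E.
Proof.
move=> GA mf f0; rewrite ge0_integral_pushforward ?sub_measurableE//.
by move=> y /set_mem; exact: f0.
Qed.

Lemma sub_integral A (f : Omega -> \bar R) : G A ->
  measurable_fun setT (f : g_sigma_algebraType G -> \bar R) ->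
  (\int[sub_prob]_(w in A) f w = \int[P]_(w in A) f w)%E.
Proof.
move=> GA mf; have mA : measurable (A : set (g_sigma_algebraType G)).
  by rewrite sub_measurableE.
rewrite integralE [RHS]integralE.
by rewrite !sub_ge0_integral//;
   apply: measurable_funTS; [exact: measurable_funeneg|exact: measurable_funepos].
Qed.

Lemma sub_integrable (f : Omega -> \bar R) :
  measurable_fun setT (f : g_sigma_algebraType G -> \bar R) ->
  sub_prob.-integrable setT f <-> P.-integrable setT f.
Proof.
move=> mf; have GT : G setT by rewrite -sub_measurableE.
have mf' : measurable_fun setT (f : Omega -> \bar R).
  by move=> _ Y mY; apply: Gm; rewrite -sub_measurableE; exact: mf.
split=> /integrableP[_ fi]; apply/integrableP; split => //.
  by rewrite -sub_ge0_integral//; exact: measurableT_comp.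
by rewrite sub_ge0_integral//; exact: measurableT_comp.
Qed.

(** Radon-Nikodym: the charge A |-> int_A U, restricted to G, is dominated by the restriction of P.
    Working with charges covers U of any sign. *)
Lemma condexp_exists (U : Omega -> R) : P.-integrable setT (EFin \o U) ->
  exists V, is_condexp P G U V.
Proof.
move=> iU.
pose ch : {charge set Omega -> \bar R} := induced_charge iU.
pose Q (A : set (g_sigma_algebraType G)) := ch A.
have Q0 : Q set0 = 0%E by exact: charge0 ch.
have Qfin A : measurable A -> Q A \is a fin_num.
  by rewrite sub_measurableE => GA; apply: (fin_num_measure ch); exact: Gm.
have Qadd : semi_sigma_additive Q.
  move=> F mF tF mUF; apply: (@charge_semi_sigma_additive _ _ _ ch) => //.
  - by move=> n; have := mF n; rewrite sub_measurableE => /Gm.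
  - by have := mUF; rewrite sub_measurableE => /Gm.
pose Qc : {charge set (g_sigma_algebraType G) -> \bar R} :=
  HB.pack Q (isCharge.Build _ _ _ Q Q0 Qfin Qadd).
have QP : Qc `<< sub_prob.
  apply/null_content_dominatesP => /= A mA A0.
  have GA : G A by rewrite -sub_measurableE.
  apply: null_set_integral; first exact: Gm.
    by apply: measurable_funTS; exact: measurable_int iU.
  exact: A0.
pose V w := fine (Radon_Nikodym Qc sub_prob w).
have VE : Radon_Nikodym Qc sub_prob = EFin \o V.
  by apply/funext => w /=; rewrite fineK//; exact: Radon_Nikodym_fin_num.
have mV : measurable_fun setT (V : g_sigma_algebraType G -> R).
  by apply/measurable_EFinP; rewrite -VE.
exists V; split => //.
- exact/measurable_wrtP.
- rewrite -sub_integrable; last exact/measurable_EFinP.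
  by rewrite -VE; exact: Radon_Nikodym_integrable.
- move=> A GA; rewrite /Rintegral -sub_integral//; last exact/measurable_EFinP.
  have := @Radon_Nikodym_integral _ _ _ Qc sub_prob A QP.
  by rewrite VE sub_measurableE => /(_ GA) <-.
Qed.

Lemma condexpP (U : Omega -> R) : P.-integrable setT (EFin \o U) ->
  is_condexp P G U (condexp P G U).
Proof. by move=> /condexp_exists[V UV]; exact: (xgetPex (cst 0)) (ex_intro _ V UV). Qed.

(** The event V2 < V1 is itself in G. On it the nonnegative difference V1 - V2 has integral at most
    0, so it vanishes almost everywhere there. *)
Lemma sub_le_ae (V1 V2 : Omega -> R) :
  measurable_wrt setT G V1 -> measurable_wrt setT G V2 ->
  P.-integrable setT (EFin \o V1) -> P.-integrable setT (EFin \o V2) ->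
  (forall A, G A -> \int[P]_(w in A) V1 w <= \int[P]_(w in A) V2 w) ->
  {ae P, forall w, V1 w <= V2 w}.
Proof.
move=> GV1 GV2 iV1 iV2 le12.
pose A := [set w | V2 w < V1 w].
have GA : G A.
  rewrite -sub_measurableE; apply: measurable_bool_set.
  by apply: measurable_fun_ltr; exact/measurable_wrtP.
have mA := Gm GA.
have iV1A : P.-integrable A (EFin \o V1) by exact: integrableS iV1.
have iV2A : P.-integrable A (EFin \o V2) by exact: integrableS iV2.
have V120 w : A w -> 0 <= V1 w - V2 w by move=> /ltW; rewrite subr_ge0.
have int0 : (\int[P]_(w in A) `|(V1 w - V2 w)%:E| = 0)%E.
  apply/eqP; rewrite eq_le integral_ge0// andbT.
  rewrite (eq_integral (fun w => (V1 w - V2 w)%:E)); last first.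
    by move=> w /set_mem Aw; rewrite gee0_abs// lee_fin V120.
  rewrite -[leLHS]fineK; last first.
    by apply: integrable_fin_num => //; exact: (integrableB mA iV1A iV2A).
  have := RintegralB mA iV1A iV2A; rewrite /Rintegral => ->.
  by rewrite lee_fin subr_le0; exact: le12.
have mB : measurable_fun A (fun w => (V1 w - V2 w)%:E).
  exact: measurable_int (integrableB mA iV1A iV2A).
have := (ae_eq_integral_abs P mA mB).1 int0.
apply: filterS => w Aw0; rewrite leNgt; apply/negP => Aw.
by have /eqP := Aw0 Aw; rewrite eqe gt_eqF// subr_gt0.
Qed.

Lemma condexp_ae_unique (U V : Omega -> R) :
  is_condexp P G U V -> {ae P, forall w, V w = condexp P G U w}.
Proof.
move=> UV; have [iU GV iV VE] := UV.
have [_ GW iW WE] := condexpP iU.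
have VW : {ae P, forall w, V w <= condexp P G U w}.
  by apply: sub_le_ae => // A GA; rewrite (VE _ GA) (WE _ GA).
have WV : {ae P, forall w, condexp P G U w <= V w}.
  by apply: sub_le_ae => // A GA; rewrite (VE _ GA) (WE _ GA).
by apply: filterS2 VW WV => w h1 h2; apply/eqP; rewrite eq_le h1 h2.
Qed.

Lemma condexp_le (U1 U2 : Omega -> R) :
  P.-integrable setT (EFin \o U1) -> P.-integrable setT (EFin \o U2) ->
  (forall A, G A -> \int[P]_(w in A) U1 w <= \int[P]_(w in A) U2 w) ->
  {ae P, forall w, condexp P G U1 w <= condexp P G U2 w}.
Proof.
move=> /condexpP[_ GV1 iV1 V1E] /condexpP[_ GV2 iV2 V2E] le12.
apply: (sub_le_ae GV1 GV2 iV1 iV2) => A GA.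
by rewrite (V1E _ GA) (V2E _ GA); exact: le12.
Qed.

End SubSigmaAlgebra.

(** * Measurable projection *)

Lemma uniform_threshold (Q : nat -> nat -> Prop) :
  (forall i, exists k0, forall k, (k0 <= k)%N -> Q i k) ->
  forall n, exists k0, forall k i, (k0 <= k)%N -> (i < n)%N -> Q i k.
Proof.
move=> HQ; elim=> [|n [k0 IH]]; first by exists 0%N.
have [k1 Hk1] := HQ n; exists (maxn k0 k1) => k i.
rewrite geq_max => /andP[k0k k1k]; rewrite ltnS leq_eqVlt => /predU1P[->|ilt].
  exact: Hk1.
exact: IH.
Qed.

(** * Capacitable sets, described by games *)

Section ChoquetSchemes.
Context {X : Type}.
Variable K : set (set X).
Hypotheses (K0 : K set0) (KU : setU_closed K) (KI : setI_closed K).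

(* The player's n-th move m shrinks S s to S (rcons s m), with union S s; along
   any infinite play, sets of K squeeze the play into C.  An increasing-
   continuous outer functional therefore loses arbitrarily little in a play,
   so that C is approximated from within by decreasing limits of sets of K. *)
Definition scheme (S : seq nat -> set X) (C : set X) : Prop :=
  [/\ S [::] = C,
      forall s, S s = \bigcup_m S (rcons s m),
      forall s m n, (m <= n)%N -> S (rcons s m) `<=` S (rcons s n) &
      forall nu : nat -> nat, exists L : nat -> set X,
        [/\ forall k, K (L k),
            forall k, exists j, S (mkseq nu j) `<=` L k &
            \bigcap_k L k `<=` C]].

Definition capacitable (C : set X) : Prop := exists S, scheme S C.

Lemma scheme_mkseq_sub S C nu i j : scheme S C -> (i <= j)%N ->
  S (mkseq nu j) `<=` S (mkseq nu i).
Proof.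
move=> [_ SU _ _] /subnK <-; elim: (j - i)%N => // k IH x.
by rewrite addSn mkseqS => Sx; apply: IH; rewrite SU; exists (nu (k + i)%N).
Qed.

(** Finite intersections of the sets L k stay in K and still contain a position of the play, because
    positions shrink along it. *)
Lemma scheme_decreasing S C nu : scheme S C -> exists L : nat -> set X,
  [/\ forall k, K (L k),
      forall k, exists j, S (mkseq nu j) `<=` L k,
      forall i j, (i <= j)%N -> L j `<=` L i &
      \bigcap_k L k `<=` C].
Proof.
move=> sS; have [_ _ _ /(_ nu)[L [KL SL LC]]] := sS.
pose M := fix M k := if k is k'.+1 then M k' `&` L k else L 0%N.
exists M; split.
- by elim=> [|k IH] //=; exact: KI.
- elim=> [|k [j IH]] /=; first exact: SL.
  have [j' IH'] := SL k.+1; exists (maxn j j') => x Sx; split.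
    by apply: IH; apply: (scheme_mkseq_sub sS _ Sx); exact: leq_maxl.
  by apply: IH'; apply: (scheme_mkseq_sub sS _ Sx); exact: leq_maxr.
- move=> i j /subnK <-; elim: (j - i)%N => // k IH x.
  by rewrite addSn /= => -[/IH].
- move=> x Mx; apply: LC => k _; have := Mx k I.
  by case: k => [|k] //= -[].
Qed.

Lemma capacitable_in C : K C -> capacitable C.
Proof.
move=> KC; exists (fun=> C); split=> //.
- by move=> _; apply/seteqP; split=> x; [exists 0%N|case].
- by move=> _ m n _ x.
- by move=> nu; exists (fun=> C); split=> // [k|x /(_ 0%N I)//]; exists 0%N.
Qed.

(** The first move n restricts the union to its first n members; later moves are played in these n
    schemes simultaneously, which monotonicity in the move permits. Along a play, a point outside
    every C i leaves each of the finitely many decreasing sequences for good, hence their union. *)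
Lemma capacitable_bigcup (C : nat -> set X) :
  (forall i, capacitable (C i)) -> capacitable (\bigcup_i C i).
Proof.
move=> /choice[S sS].
exists (fun s => if s is n :: s' then [set x | exists2 i, (i < n)%N & S i s' x]
                 else \bigcup_i C i).
split=> //.
- case=> [|n s].
    apply/seteqP; split=> [x [i _ Cix]|x [n _ /= [i _]]].
      by exists i.+1 => //=; exists i => //; have [-> _ _ _] := sS i.
    by have [-> _ _ _] := sS i; exists i.
  apply/seteqP; split=> [x [i ilt]|x [m _ /= [i ilt Six]]].
    have [_ SU _ _] := sS i; rewrite SU => -[m _ Sx].
    by exists m => //=; exists i.
  by exists i => //; have [_ SU _ _] := sS i; rewrite SU; exists m.
- case=> [|n s] m m' mm' x /= [i ilt Six]; exists i => //.
    exact: leq_trans mm'.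
  by have [_ _ SM _] := sS i; exact: SM mm' _ Six.
(* The move nu 0 is spent on the number of members, so each scheme sees the shifted sequence. *)
- move=> nu; have sL i := scheme_decreasing (nu \o succn) (sS i).
  have [L HL] := choice sL.
  pose M k := \big[setU/set0]_(i < nu 0%N) L i k.
  exists M; split.
  + move=> k; apply: big_ind => // i _; by have [] := HL i.
  + move=> k.
    have [j Hj] := @uniform_threshold
      (fun i j => S i (mkseq (nu \o succn) j) `<=` L i k)
      (fun i => let: And4 _ SL _ _ := HL i in
        let: ex_intro j0 h := SL k in
        ex_intro _ j0 (fun j j0j x Sx => h x (scheme_mkseq_sub (sS i) j0j Sx)))
      (nu 0%N).
    exists j.+1; have -> : mkseq nu j.+1 = nu 0%N :: mkseq (nu \o succn) j.
      by rewrite /mkseq /= -[1%N]/(1 + 0)%N iotaDl -map_comp.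
    move=> x [i ilt /(Hj j i (leqnn j) ilt) Lx]; rewrite /M.
    by rewrite -(bigcup_mkord _ (L^~ k)); exists i.
  + move=> x Mx; apply: contrapT => nCx.
    have nL i : exists k0, forall k, (k0 <= k)%N -> ~ L i k x.
      have [_ _ LM LC] := HL i.
      have : ~ (\bigcap_k L i k) x by move=> /LC Cx; apply: nCx; exists i.
      move=> /existsNP[k0 /not_implyP[_ nLx]]; exists k0 => k k0k.
      by move=> /(LM _ _ k0k).
    have [k Hk] := uniform_threshold nL (nu 0%N).
    have := Mx k I; rewrite /M -(bigcup_mkord _ (L^~ k)) => -[i ilt Lx].
    exact: (Hk k i).
Qed.

(** Scheme i joins the play at move i, which is what [drop i] expresses. At each position only
    finitely many schemes are active, so one move large enough serves all of them. The countably
    many sequences L i are merged into one by [unpickle]. *)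
Lemma capacitable_bigcap (C : nat -> set X) :
  (forall i, capacitable (C i)) -> capacitable (\bigcap_i C i).
Proof.
move=> /choice[S sS].
have S0 i : S i [::] = C i by have [] := sS i.
exists (fun s => \bigcap_i S i (drop i s)); split=> //.
- apply/seteqP; split=> x Sx i _; last by have := Sx i I; rewrite /= S0.
  by have := Sx i I; rewrite S0.
- move=> s; apply/seteqP; split=> [x Sx|x [m _ Sx] i _].
    have Sm i : exists m0, forall m, (m0 <= m)%N ->
        (i <= size s)%N -> S i (rcons (drop i s) m) x.
      have := Sx i I; have [_ SU SM _] := sS i.
      by rewrite SU => -[m _ Sm]; exists m => k mk _; exact: SM mk _ Sm.
    have [m Hm] := uniform_threshold Sm (size s).+1.
    exists m => // i _; have [is_|si] := leqP i (size s).
      by rewrite drop_rcons//; apply: Hm.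
    by have := Sx i I; rewrite !drop_oversize ?size_rcons// ltnW.
  have [is_|si] := leqP i (size s).
    have [_ SU _ _] := sS i; rewrite SU; exists m => //.
    by have := Sx i I; rewrite drop_rcons.
  by have := Sx i I; rewrite !drop_oversize ?size_rcons// ltnW.
- move=> s m n mn x Sx i _; have [is_|si] := leqP i (size s).
    rewrite drop_rcons//; have [_ _ SM _] := sS i; apply: SM mn _ _.
    by have := Sx i I; rewrite drop_rcons.
  by have := Sx i I; rewrite !drop_oversize ?size_rcons.
- move=> nu.
  have sL i : exists L : nat -> set X,
     [/\ forall k, K (L k),
         forall k, exists j, S i (mkseq (fun k => nu (i + k)%N) j) `<=` L k &
         \bigcap_k L k `<=` C i].
    by have [_ _ _] := sS i; exact.
  have [L HL] := choice sL.
  pose M k := let ij := odflt (0%N, 0%N) (unpickle k) in L ij.1 ij.2.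
  exists M; split.
  + by move=> k; rewrite /M; case: (odflt _ _) => i j /=; have [] := HL i.
  + move=> k; rewrite /M; case: (odflt _ _) => i l /=.
    have [_ /(_ l)[j Hj] _] := HL i; exists (i + j)%N => x Sx; apply: Hj.
    have := Sx i I; suff -> : drop i (mkseq nu (i + j)) =
      mkseq (fun k => nu (i + k)%N) j by [].
    rewrite /mkseq -map_drop iotaD drop_cat size_iota ltnn subnn drop0.
    by rewrite add0n -[X in iota X](addn0 i) iotaDl -map_comp.
  + move=> x Mx i _; have [_ _ LC] := HL i; apply: LC => k _.
    by have := Mx (pickle (i, k)) I; rewrite /M pickleK.
Qed.

End ChoquetSchemes.

Lemma ex_natSinv_lt {R : realType} (e : R) : 0 < e ->
  exists n : nat, n.+1%:R^-1 < e.
Proof.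
by move=> e0; have [n _ nP] := near_infty_natSinv_lt (PosNum e0);
   exists n; exact: nP (leqnn n).
Qed.

(** * Projections of measurable sets onto a complete sigma-algebra *)

Section MeasurableProjection.
Context {R : realType} {d : measure_display} {Omega : measurableType d}.
Variables (P : probability Omega R) (G : set (set Omega)) (T : R).
Hypotheses (sG : sigma_algebra setT G) (Gm : G `<=` measurable)
  (GN : P.-negligible `<=` G).

(** The paving of the capacity argument: its sets have compact sections in time and projections in
    G. *)
Inductive rectangle_union : set (R * Omega) -> Prop :=
| rectangle_union0 : rectangle_union set0
| rectangle_union_rect a b A : G A -> rectangle_union (`[a, b] `*` A)
| rectangle_unionU K L :
    rectangle_union K -> rectangle_union L -> rectangle_union (K `|` L).

Let G0 : G set0. Proof. by case: sG. Qed.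
Let GT : G setT. Proof. by have [_ GC _] := sG; rewrite -(setD0 setT); exact: GC. Qed.
Let GU A B : G A -> G B -> G (A `|` B).
Proof. by rewrite -(sub_measurableE sG); exact: measurableU. Qed.
Let GI A B : G A -> G B -> G (A `&` B).
Proof. by rewrite -(sub_measurableE sG); exact: measurableI. Qed.
Let GC A : G A -> G (~` A).
Proof. by rewrite -(sub_measurableE sG); exact: measurableC. Qed.
Let Gcap (A : nat -> set Omega) : (forall n, G (A n)) -> G (\bigcap_n A n).
Proof. by rewrite -(sub_measurableE sG); exact: bigcapT_measurable. Qed.
Let Gcup (A : nat -> set Omega) : (forall n, G (A n)) -> G (\bigcup_n A n).
Proof. by rewrite -(sub_measurableE sG); exact: bigcupT_measurable. Qed.

Lemma rectangle_unionI : setI_closed rectangle_union.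
Proof.
move=> K L KK; elim: KK L => {K}[|a b A GA|K1 K2 _ IH1 _ IH2] L KL.
- by rewrite set0I; exact: rectangle_union0.
- elim: KL => {L}[|a' b' A' GA'|L1 L2 _ IH1 _ IH2].
  + by rewrite setI0; exact: rectangle_union0.
  + rewrite -setXI (_ : `[a, b] `&` `[a', b'] =
      `[Num.max a a', Num.min b b']%classic).
      by apply: rectangle_union_rect; exact: GI.
    apply/seteqP; split=> x /=; rewrite !in_itv /= ge_max le_min.
      by move=> [/andP[-> ->] /andP[-> ->]].
    by move=> /andP[/andP[-> ->] /andP[-> ->]].
  + by rewrite setIUr; exact: rectangle_unionU.
- by rewrite setIUl; apply: rectangle_unionU; [exact: IH1|exact: IH2].
Qed.

Lemma rectangle_union_section K w : rectangle_union K ->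
  compact [set t | K (t, w)].
Proof.
elim=> {K}[|a b A GA|K1 K2 _ IH1 _ IH2].
- by rewrite (_ : [set _ | _] = set0) //; exact: compact0.
- have [Aw|nAw] := pselect (A w).
    rewrite (_ : [set _ | _] = `[a, b]%classic); first exact: segment_compact.
    by apply/seteqP; split=> x /=; [case|].
  rewrite (_ : [set _ | _] = set0); first exact: compact0.
  by apply/seteqP; split=> x // -[].
- rewrite (_ : [set _ | _] = [set t | K1 (t, w)] `|` [set t | K2 (t, w)]) //.
  exact: compactU.
Qed.

Definition projection (C : set (R * Omega)) : set Omega :=
  [set w | exists t, C (t, w)].

Lemma rectangle_union_projection K : rectangle_union K -> G (projection K).
Proof.
elim=> {K}[|a b A GA|K1 K2 _ IH1 _ IH2].
- by rewrite (_ : projection _ = set0) //; apply/seteqP; split=> x // -[].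
- have [ab|ba] := leP a b.
    rewrite (_ : projection _ = A)//; apply/seteqP; split=> x; first by case=> ? [].
    by move=> Ax; exists a; split=> //=; rewrite in_itv /= lexx.
  rewrite (_ : projection _ = set0) //; apply/seteqP; split=> x // -[t [/=]].
  by rewrite in_itv /= => /andP[/le_trans /[apply]]; rewrite leNgt ba.
- rewrite (_ : projection _ = projection K1 `|` projection K2); first exact: GU.
  by apply/seteqP; split=> x; [case=> t [] ?; [left|right]; exists t
     |case=> -[t Kt]; exists t; [left|right]].
Qed.

(** Compactness: the decreasing nonempty sections above w generate a filter, and a cluster point of
    it lies in all of them. *)
Lemma projection_bigcap_decreasing (L : nat -> set (R * Omega)) :
  (forall k, rectangle_union (L k)) ->
  (forall i j, (i <= j)%N -> L j `<=` L i) ->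
  \bigcap_k projection (L k) `<=` projection (\bigcap_k L k).
Proof.
move=> KL Ld w Lw.
pose sec k := [set t | L k (t, w)].
pose F := filter_from setT sec.
have FF : ProperFilter F.
  apply: filter_from_proper; last first.
    by move=> k _; have [t Lt] := Lw k I; exists t.
  apply: filter_from_filter; first by exists 0%N.
  move=> i j _ _; exists (maxn i j) => // t Lt; split.
    exact: Ld (leq_maxl i j) _ Lt.
  exact: Ld (leq_maxr i j) _ Lt.
have /(_ F FF) : compact (sec 0%N) by exact: rectangle_union_section.
case; first by exists 0%N.
move=> t [_ clt]; exists t => k _.
have /closure_id : closed (sec k).
  by apply: compact_closed => //; exact: rectangle_union_section.
have : closure (sec k) t by move: clt; rewrite clusterE => /(_ (sec k)); apply; exists k.
by move=> + clE; rewrite -clE.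
Qed.

(** Expresses that the outer measure of B, computed with covers from G, is at most c. *)
Definition outer_le (B : set Omega) (c : R) : Prop :=
  exists A, [/\ G A, B `<=` A & (P A <= c%:E)%E].

(** Continuity of the outer measure from below. The covers A n need not increase, but the
    intersections of A m over m >= n do; they still cover B n and have measure at most c. *)
Lemma outer_le_bigcup (B : nat -> set Omega) (c : R) :
  (forall m n, (m <= n)%N -> B m `<=` B n) ->
  (forall n, outer_le (B n) c) -> outer_le (\bigcup_n B n) c.
Proof.
move=> Bnd /choice[A HA].
pose D n := \bigcap_m A (n + m)%N.
have GD n : G (D n) by apply: Gcap => m; have [] := HA (n + m)%N.
have Dnd : nondecreasing_seq D.
  move=> m n mn; rewrite subsetEset => w Dw k _.
  by have := Dw (n - m + k)%N I; rewrite addnA subnKC.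
exists (\bigcup_n D n); split.
- exact: Gcup.
- move=> w [n _ Bw]; exists n => // m _; have [_ BA _] := HA (n + m)%N.
  by apply: BA; exact: Bnd (leq_addr _ _) _ Bw.
- have := nondecreasing_cvg_mu (fun n => Gm (GD n)) (Gm (Gcup GD)) Dnd (mu := P).
  move=> /cvg_lim <- //; apply: lime_le.
    apply: ereal_nondecreasing_is_cvgn => m n mn.
    by apply: le_measure; rewrite ?inE; [exact: Gm|exact: Gm|exact/subsetPset/Dnd].
  apply: nearW => n; have [GA _ le_c] := HA n; apply: le_trans le_c.
  apply: le_measure; rewrite ?inE; [exact: Gm|exact: Gm|].
  by move=> w /(_ 0%N I); rewrite addn0.
Qed.

(* Choquet's capacitability argument *)
Lemma capacitable_inner C c : capacitable rectangle_union C ->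
  ~ outer_le (projection C) c ->
  exists A, [/\ G A, A `<=` projection C & (c%:E <= P A)%E].
Proof.
move=> [S sS] nC.
(* If every move gave a set of outer measure at most c, so would their increasing union S s. Hence
   some move preserves the failure of the bound, and choosing it each time gives a play. *)
have step s : exists m, ~ outer_le (projection (S s)) c ->
    ~ outer_le (projection (S (rcons s m))) c.
  apply: contrapT => /forallNP H.
  have {}H m : ~ outer_le (projection (S s)) c /\
      outer_le (projection (S (rcons s m))) c.
    by have /not_implyP[? /contrapT] := H m.
  have [nS _] := H 0%N; apply: nS.
  have [_ SU SM _] := sS.
  rewrite (_ : projection (S s) = \bigcup_m projection (S (rcons s m))).
    apply: outer_le_bigcup => [m n mn w [t St]|m]; last by have [] := H m.
    by exists t; exact: SM mn _ St.
  apply/seteqP; split=> [w [t]|w [m _ [t St]]].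
    by rewrite SU => -[m _ St]; exists m => //; exists t.
  by exists t; rewrite SU; exists m.
have [f Hf] := choice step.
pose play := fix play k := if k is k'.+1 then rcons (play k') (f (play k')) else [::].
pose nu k := f (play k).
have playE k : mkseq nu k = play k.
  by elim: k => // k IH; rewrite mkseqS IH.
have nplay k : ~ outer_le (projection (S (mkseq nu k))) c.
  rewrite playE; elim: k => [|k IH] /=; last exact: Hf.
  by have [-> _ _ _] := sS.
have [L [KL SL Ld LC]] := scheme_decreasing rectangle_unionI nu sS.
exists (\bigcap_k projection (L k)); split.
- by apply: Gcap => k; exact: rectangle_union_projection.
- move=> w /(projection_bigcap_decreasing KL Ld)[t Lt]; exists t; exact: LC.
- have Gp k := rectangle_union_projection (KL k).
  have nip : nonincreasing_seq (fun k => projection (L k)).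
    by move=> i j ij; rewrite subsetEset => w [t Lt]; exists t; exact: Ld ij _ Lt.
  have Poo : (P (projection (L 0%N)) < +oo)%E.
    by rewrite (le_lt_trans (probability_le1 _ _)) ?ltry//; exact: Gm.
  have := nonincreasing_cvg_mu Poo (fun n => Gm (Gp n)) (Gm (Gcap Gp)) nip.
  move=> /cvg_lim <- //; apply: lime_ge.
    apply: ereal_nonincreasing_is_cvgn => m n mn.
    by apply: le_measure; rewrite ?inE; [exact: Gm|exact: Gm|exact/subsetPset/nip].
  (* Otherwise [projection (L k)] would be a cover, of measure at most c, of the projection of some
     position of the play. *)
  apply: nearW => k; rewrite leNgt; apply/negP => /ltW lec.
  have [j Sj] := SL k; apply: (nplay j); exists (projection (L k)); split=> //.
  by move=> w [t St]; exists t; exact: Sj.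
Qed.

(** The outer measure s of the projection is approached by covers from G and, by
    [capacitable_inner], by subsets from G. So the projection differs from a set of G by a null set,
    which G contains. *)
Lemma capacitable_projection C : capacitable rectangle_union C ->
  G (projection C).
Proof.
move=> capC.
pose E := [set c | 0 <= c /\ outer_le (projection C) c].
have E1 : E 1.
  split=> //; exists setT; split=> //; exact: probability_le1.
have hE : has_inf E by split; [exists 1|exists 0 => c []].
set s := inf E.
have out n : outer_le (projection C) (s + n.+1%:R^-1).
  have e0 : (0 : R) < n.+1%:R^-1 by rewrite invr_gt0.
  have [c [c0 [A [GA CA Ac]]] clt] := inf_adherent e0 hE.
  exists A; split=> //; apply: le_trans Ac _; rewrite lee_fin; exact: ltW.
have inn n : exists A, [/\ G A, A `<=` projection C &
    ((s - n.+1%:R^-1)%:E <= P A)%E].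
  (* [E] has nonnegative elements only, so minimality of s says nothing about a negative bound;
     there the empty set will do. *)
  have [s0|s0] := leP (s - n.+1%:R^-1) 0.
    by exists set0; split=> //; rewrite measure0 lee_fin.
  apply: capacitable_inner => // Cs.
  have : s <= s - n.+1%:R^-1 by apply: ge_inf; [exact: hE.2|split=> //; exact: ltW].
  by rewrite leNgt ltrBlDr ltrDl invr_gt0 ltr0n.
have [B HB] := choice out; have [A HA] := choice inn.
have GA : G (\bigcup_n A n) by apply: Gcup => n; have [] := HA n.
have AC : \bigcup_n A n `<=` projection C.
  by move=> w [n _]; have [_ + _] := HA n; exact.
rewrite -(setDUK AC); apply: GU => //; apply: GN.
exists ((\bigcap_n B n) `\` (\bigcup_n A n)).
have GB : G (\bigcap_n B n) by apply: Gcap => n; have [] := HB n.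
have mBA : measurable ((\bigcap_n B n) `\` (\bigcup_n A n)).
  by apply: measurableD; exact: Gm.
split=> //; last first.
  by move=> w [Cw nAw]; split=> // n _; have [_ + _] := HB n; exact.
apply/eqP; rewrite eq_le measure_ge0 andbT.
apply/lee_addgt0Pr => /= e e0; rewrite add0e.
have [n ne] : exists n : nat, n.+1%:R^-1 + n.+1%:R^-1 <= e.
  have e20 : 0 < e / 2 by rewrite divr_gt0.
  have [n /ltW h] := ex_natSinv_lt e20; exists n.
  by rewrite [leRHS]splitr lerD.
have [GBn CBn PBn] := HB n; have [GAn AnC PAn] := HA n.
apply: (@le_trans _ _ (P (B n `\` A n))).
  apply: le_measure; rewrite ?inE//; first by apply: measurableD; exact: Gm.
  by move=> w [Bw nAw]; split; [exact: Bw|move=> Aw; apply: nAw; exists n].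
rewrite measureD; [|exact: Gm|exact: Gm|]; last first.
  by rewrite (le_lt_trans (probability_le1 _ _)) ?ltry//; exact: Gm.
rewrite setIidr; last by move=> w /AnC /CBn.
have fA : P (A n) \is a fin_num by apply: fin_num_measure; exact: Gm.
rewrite leeBlDr//; apply: le_trans PBn _.
apply: (@le_trans _ _ (e%:E + (s - n.+1%:R^-1)%:E)%E); last exact: leeD2l.
by rewrite -EFinD lee_fin addrCA lerD2l lerBrDr.
Qed.

Let strip : set (R * Omega) := `[0, T] `*` setT.

(** Capacitable sets are stable under countable unions and intersections but not evidently under
    complements; asking it of both C and its complement gives a sigma-algebra. *)
Let bimeasurable (C : set (R * Omega)) : Prop :=
  capacitable rectangle_union (C `&` strip) /\
  capacitable rectangle_union (~` C `&` strip).

Let cap_rect a b A : G A ->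
  capacitable rectangle_union (`[a, b] `*` A : set (R * Omega)).
Proof. by move=> GA; apply: capacitable_in; exact: rectangle_union_rect. Qed.

Let cap0 : capacitable rectangle_union set0.
Proof. exact: capacitable_in rectangle_union0. Qed.

Let cap_bigcup := capacitable_bigcup rectangle_union0 rectangle_unionU
  rectangle_unionI.

Lemma bimeasurable_sigma_algebra : sigma_algebra setT bimeasurable.
Proof.
split.
- by split; [rewrite set0I|rewrite setC0 setTI; exact: cap_rect].
- by move=> C [C1 C2]; rewrite setTD; split=> //; rewrite setCK.
- move=> C HC; have C1 i := (HC i).1; have C2 i := (HC i).2; split.
    by rewrite setI_bigcupl; exact: cap_bigcup.
  rewrite setC_bigcup (_ : _ `&` _ = \bigcap_i (~` C i `&` strip)).
    exact: capacitable_bigcap.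
  apply/seteqP; split=> p; first by move=> [Cp ?] i _; split=> //; exact: Cp.
  by move=> Cp; split=> [i _|]; [have [] := Cp i I|have [] := Cp 0%N I].
Qed.

(** Only generators have to be checked. Within the strip, a half-line [[x, +oo[] is a compact
    interval, and its complement is a countable union of compact intervals ending at x - 1/(n+1). *)
Lemma bimeasurable_measurable (C : set (R * Omega)) :
  @measurable _ (R * g_sigma_algebraType G)%type C -> bimeasurable C.
Proof.
have [B0 BC BU] := bimeasurable_sigma_algebra.
move: C; apply: (smallest_sub bimeasurable_sigma_algebra).
move=> _ [[B mB <-]|[A mA <-]]; rewrite setTI; last first.
  move: mA; rewrite sub_measurableE// => GA; split.
    rewrite (_ : _ `&` _ = `[0, T] `*` A); first exact: cap_rect.
    by apply/seteqP; split=> -[t w] /=; [case=> ? []|case].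
  rewrite (_ : _ `&` _ = `[0, T] `*` ~` A); first by apply: cap_rect; exact: GC.
  by apply/seteqP; split=> -[t w] /=; [case=> ? []|case].
move: B mB; rewrite -[X in forall B, X B -> _]/((@ocitv R).-sigma.-measurable).
rewrite RGenCInfty.measurableE.
apply: smallest_sub.
  split; first by rewrite preimage_set0.
  - by move=> B /BC; rewrite !setTD.
  - by move=> B /BU; rewrite preimage_bigcup.
move=> _ [x ->]; split.
  rewrite (_ : _ `&` _ = `[Num.max 0 x, T] `*` setT); first exact: cap_rect.
  apply/seteqP; split=> -[t w]; rewrite /strip /= !in_itv /= ge_max andbT.
    by move=> [-> [/andP[-> ->]]].
  by move=> [/andP[/andP[-> ->] ->]].
rewrite (_ : _ `&` _ = \bigcup_n (`[0, Num.min T (x - n.+1%:R^-1)] `*` setT)).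
  by apply: cap_bigcup => n; exact: cap_rect.
apply/seteqP; split=> -[t w]; rewrite /strip /= !in_itv /= andbT.
  move=> [/negP]; rewrite -ltNge => tx [/andP[t0 tT] _].
  have xt0 : 0 < x - t by rewrite subr_gt0.
  have [n nx] := ex_natSinv_lt xt0.
  exists n => //; split=> //=; rewrite in_itv /= t0 le_min tT /=.
  by rewrite lerBrDr -lerBrDl ltW.
move=> [n _ [/=]]; rewrite in_itv /= le_min => /andP[t0 /andP[tT tx]] _.
split; last by rewrite t0 tT.
by apply/negP; rewrite -ltNge (le_lt_trans tx)// ltrBlDr ltrDl invr_gt0 ltr0n.
Qed.

Theorem measurable_projection (C : set (R * Omega)) :
  @measurable _ (R * g_sigma_algebraType G)%type C ->
  G [set w | exists t : R, 0 <= t <= T /\ C (t, w)].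
Proof.
move=> /bimeasurable_measurable[/capacitable_projection GC' _].
rewrite (_ : [set _ | _] = projection (C `&` strip))//.
apply/seteqP; split=> w [t].
  by move=> [tT Ct]; exists t; split=> //; split=> //=; rewrite in_itv.
by move=> [Ct []]; rewrite /= in_itv /=; exists t.
Qed.

End MeasurableProjection.

(** * Paths and progressive processes *)

Lemma near_rightP {R : realType} (t : R) (Q : R -> Prop) :
  (\forall s \near t^'+, Q s) <->
  exists2 e, 0 < e & forall s, t < s < t + e -> Q s.
Proof.
rewrite /at_right near_withinE; split.
  move=> /nbhs_ballP[e /= e0 He]; exists e => // s /andP[ts se].
  by apply: He => //; rewrite /ball /= ltr0_norm ?subr_lt0// opprB ltrBlDl.
move=> [e e0 He]; apply/nbhs_ballP; exists e => //= s.
rewrite /ball /= => st ts; apply: He; rewrite ts /= -ltrBlDl.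
by move: st; rewrite ltr0_norm ?subr_lt0// opprB.
Qed.

Lemma cvg_right_eq {R : realType} (x y : R -> R) (t l : R) :
  (exists2 e, 0 < e & forall s, t < s < t + e -> x s = y s) ->
  x @ t^'+ --> l -> y @ t^'+ --> l.
Proof.
move=> xy; apply: cvg_trans; apply: near_eq_cvg.
by apply/near_rightP; case: xy => e e0 H; exists e => // s /H ->.
Qed.

Lemma is_cvg_right_eq {R : realType} (x y : R -> R) (t : R) :
  (exists2 e, 0 < e & forall s, t < s < t + e -> x s = y s) ->
  cvg (x @ t^'+) -> cvg (y @ t^'+).
Proof. by move=> xy /(cvg_right_eq xy) ?; apply/cvg_ex; eexists; eassumption. Qed.

Lemma right_cvg_seq {R : realType} (x : R -> R) (t l : R) (s : nat -> R) :
  x @ t^'+ --> l -> (forall n, t < s n) -> s @ \oo --> t -> x \o s @ \oo --> l.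
Proof.
move=> xl ts st; apply: cvg_trans xl => A /near_rightP[e e0 He].
move/cvgrPdist_lt : st => /(_ _ e0); apply: filterS => n.
rewrite ltr0_norm ?subr_lt0// opprB ltrBlDl => sne; apply: He.
by rewrite ts.
Qed.

Lemma right_limit_min {R : realType} (x : R -> R) (T c : R) :
  (forall t, 0 <= t < T -> cvg (x @ t^'+)) ->
  forall t, 0 <= t < T -> cvg ((fun s => x (Num.min s c)) @ t^'+).
Proof.
move=> xT t tT; have [tc|ct] := ltP t c.
  apply: is_cvg_right_eq (xT t tT); exists (c - t); first by rewrite subr_gt0.
  by move=> s /andP[_]; rewrite addrC subrK => sc; rewrite min_l// ltW.
apply: (@is_cvg_right_eq _ (cst (x c))); last exact: is_cvg_cst.
by exists 1 => // s /andP[ts _]; rewrite min_r// (le_trans ct)// ltW.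
Qed.

Lemma cadlag_min {R : realType} (x : R -> R) (T c : R) : 0 <= c ->
  cadlag T x -> cadlag T (fun s => x (Num.min s c)).
Proof.
move=> c0 [xr xl]; split=> t tT.
  have [tc|ct] := ltP t c.
    apply: cvg_right_eq (xr t tT).
    exists (c - t); first by rewrite subr_gt0.
    by move=> s /andP[_]; rewrite addrC subrK => sc; rewrite min_l// ltW.
  apply: (@cvg_right_eq _ (cst (x c))); last exact: cvg_cst.
  by exists 1 => // s /andP[ts _]; rewrite min_r// (le_trans ct)// ltW.
have [tc|ct] := leP t c.
  have := xl t tT => /cvg_ex[l xl']; apply/cvg_ex; exists l.
  apply: cvg_trans xl'; apply: near_eq_cvg; near=> s.
  by rewrite min_l// ltW// (lt_le_trans _ tc).
apply/cvg_ex; exists (x c); apply: (cvg_trans _ (@cvg_cst _ (x c) _ (t^'-) _)).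
apply: near_eq_cvg; near=> s; rewrite min_r//=.
by near: s; apply: nbhs_left_ge.
Unshelve. all: by end_near. Qed.

Lemma cadlagB {R : realType} (T : R) (x y : R -> R) :
  cadlag T x -> cadlag T y -> cadlag T (x \- y).
Proof.
move=> [xr xl] [yr yl]; split=> t tT; first by apply: cvgB; [exact: xr|exact: yr].
by apply: is_cvgB; [exact: xl|exact: yl].
Qed.

Lemma continuous_cadlag {R : realType} (T : R) (x : R -> R) : 0 < T ->
  {within `[0, T], continuous x} -> cadlag T x /\ left_continuous T x.
Proof.
move=> T0 /(continuous_within_itvP _ T0)[xc x0 xT].
have xl t : 0 < t <= T -> x @ t^'- --> x t.
  move=> /andP[t0]; rewrite le_eqVlt => /predU1P[->//|tT].
  by apply: cvg_at_left_filter; apply: xc; rewrite in_itv /= t0.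
split=> //; split=> t; last by move=> /xl ?; apply/cvg_ex; exists (x t).
move=> /andP[]; rewrite le_eqVlt => /predU1P[<-//|t0 tT].
by apply: cvg_at_right_filter; apply: xc; rewrite in_itv /= t0.
Qed.

(** Jordan decomposition: x is a difference of two nondecreasing functions, and these have right
    limits. *)
Lemma bounded_variation_right_limit {R : realType} (T : R) (x : R -> R) :
  bounded_variation 0 T x -> forall t, 0 <= t < T -> cvg (x @ t^'+).
Proof.
move=> bvx t /andP[t0 tT].
have mono (y : R -> R) : {in `[0, T] &, nondecreasing_fun y} -> cvg (y @ t^'+).
  move=> ndy; apply/cvg_ex; exists (inf (y @` `]t, T[)).
  apply: nondecreasing_at_right_cvgr; first by rewrite bnd_simp.
    move=> u v; rewrite !in_itv /= => /andP[tu uT] /andP[tv vT] uv.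
    by apply: ndy => //; rewrite in_itv /= ltW ?(le_lt_trans t0)//= ltW.
  exists (y t) => _ [s + <-]; rewrite /= in_itv /= => /andP[ts sT].
  by apply: ndy; rewrite ?in_itv /= ?t0 ?ltW// (le_lt_trans t0).
apply: (@is_cvg_right_eq _ ((fine \o pos_tv 0 x) \- (fine \o neg_tv 0 x))).
  exists (T - t); first by rewrite subr_gt0.
  move=> s /andP[ts]; rewrite addrC subrK => sT.
  by rewrite (bounded_variation_pos_neg_tvE bvx)// in_itv /= !ltW// (le_lt_trans t0).
apply: is_cvgB; apply: mono; last exact: fine_neg_tv_nondecreasing.
by apply: fine_neg_tv_nondecreasing; exact: bounded_variationN.
Qed.

Definition clamp {R : realType} (t s : R) : R := Num.max 0 (Num.min s t).

Lemma clamp_itv {R : realType} (t s : R) : 0 <= t -> 0 <= clamp t s <= t.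
Proof. by move=> t0; rewrite /clamp le_max lexx /= ge_max t0 ge_min lexx orbT. Qed.

Lemma clamp_id {R : realType} (t s : R) : 0 <= s <= t -> clamp t s = s.
Proof. by move=> /andP[s0 st]; rewrite /clamp (min_l st) (max_r s0). Qed.

Lemma measurable_clamp {R : realType} (t : R) : measurable_fun setT (clamp t).
Proof.
apply: measurable_maxr; first exact: measurable_cst.
by apply: measurable_minr; [exact: measurable_id|exact: measurable_cst].
Qed.

Lemma measurable_nat_cases {d1 d2} {S1 : measurableType d1}
  {S2 : measurableType d2} (k : S1 -> nat) (X : nat -> S1 -> S2) :
  (forall n, measurable [set p | k p = n]) ->
  (forall n, measurable_fun setT (X n)) ->
  measurable_fun setT (fun p => X (k p) p).
Proof.
move=> mk mX _ Y mY; rewrite setTI.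
rewrite (_ : _ @^-1` _ = \bigcup_n ([set p | k p = n] `&` X n @^-1` Y)).
  apply: bigcupT_measurable => n; apply: measurableI => //.
  by rewrite -[X in measurable X]setTI; exact: mX.
apply/seteqP; split=> p /=; first by move=> XY; exists (k p).
by move=> [n _ [/= -> ]].
Qed.

Section Progressive.
Context {R : realType} {d : measure_display} {Omega : measurableType d}.
Implicit Types (T : R) (F : R -> set (set Omega)) (X : R -> Omega -> R).

(** Neither completeness nor inclusion in the measurable sets is asked for, so that the notion also
    covers the filtration of all subsets, which serves in [stopped_previsible]. *)
Definition filtration T F : Prop :=
  (forall t, 0 <= t <= T -> sigma_algebra setT (F t)) /\
  (forall s t, 0 <= s -> s <= t -> t <= T -> F s `<=` F t).

(* Joint measurability on [0, t] x Omega, encoded by clamping time to [0, t]. *)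
Definition progressive T F X : Prop := forall t, 0 <= t <= T ->
  measurable_fun setT
    (fun p : R * g_sigma_algebraType (F t) => X (clamp t p.1) p.2).

Lemma adaptedP T F X : filtration T F ->
  adapted T F X <-> forall t, 0 <= t <= T ->
    measurable_fun setT (X t : g_sigma_algebraType (F t) -> R).
Proof.
move=> [sF _]; split=> aX t tT.
  by apply/(measurable_wrtP (sF t tT)); exact: aX.
by apply/(measurable_wrtP (sF t tT)); exact: aX.
Qed.

Lemma adapted_later T F X s t : filtration T F -> adapted T F X ->
  0 <= s -> s <= t -> t <= T ->
  measurable_fun setT (X s : g_sigma_algebraType (F t) -> R).
Proof.
move=> [sF mF] aX s0 st tT.
have tT' : 0 <= t <= T by rewrite (le_trans s0).
apply/(measurable_wrtP (sF t tT')) => A XA; apply: (mF s t) => //.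
by apply: aX XA; rewrite s0 (le_trans st).
Qed.

(** At a time s <= t the process is replaced by its value at the next point (k+1)/(n+1) of a grid,
    cut at t. These step processes are measurable for F t and converge by right-continuity. *)
Lemma right_continuous_progressive T F X : filtration T F -> adapted T F X ->
  (forall w t, 0 <= t < T -> X ^~ w @ t^'+ --> X t w) -> progressive T F X.
Proof.
move=> fF aX rX t /andP[t0 tT].
pose k n (s : R) := Num.truncn (clamp t s * n.+1%:R).
pose q n j : R := Num.min t (j.+1%:R / n.+1%:R).
have n0 n : (0 : R) < n.+1%:R by rewrite ltr0n.
have mk n j : measurable [set p : R * g_sigma_algebraType (F t) | k n p.1 = j].
  rewrite (_ : [set _ | _] = [set p : R * g_sigma_algebraType (F t) |
    (j%:R <= clamp t p.1 * n.+1%:R) && (clamp t p.1 * n.+1%:R < j.+1%:R)]).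
    apply: measurable_bool_set; apply: measurable_and.
      apply: measurable_fun_ler; first exact: measurable_cst.
      apply: measurable_funM; last exact: measurable_cst.
      by apply: measurableT_comp; [exact: measurable_clamp|exact: measurable_fst].
    apply: measurable_fun_ltr; last exact: measurable_cst.
    apply: measurable_funM; last exact: measurable_cst.
    by apply: measurableT_comp; [exact: measurable_clamp|exact: measurable_fst].
  apply/seteqP; split=> p /=; last exact: truncn_def.
  move=> <-; apply: truncn_itv; apply: mulr_ge0; last exact/ltW.
  by have /andP[] := clamp_itv p.1 t0.
apply: (@measurable_fun_cvg _ _ _ _
  (fun n (p : R * g_sigma_algebraType (F t)) => X (q n (k n p.1)) p.2)).
  move=> n; apply: (@measurable_nat_cases _ _ _ _ (fun p => k n p.1)
    (fun j (p : R * g_sigma_algebraType (F t)) => X (q n j) p.2)) => // j.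
  apply: measurableT_comp; last exact: measurable_snd.
  apply: (adapted_later fF aX) => //; rewrite /q ?ge_min ?lexx// le_min t0 /=.
  by rewrite divr_ge0.
move=> [s w] _ /=; have /andP[s0 st] := clamp_itv s t0.
have kitv n := truncn_itv (mulr_ge0 s0 (ltW (n0 n))).
move: s0 st; rewrite le_eqVlt; set s' := clamp t s => _.
have s0 : 0 <= s' by have /andP[] := clamp_itv s t0.
have klt n : s' < (k n s).+1%:R / n.+1%:R.
  by rewrite ltr_pdivlMr//; have /andP[] := kitv n.
(* At s' = t the cut makes the approximation exact, so values after t never matter. *)
rewrite le_eqVlt => /predU1P[st|st].
  rewrite st; apply: cvg_near_cst; apply: nearW => n.
  by rewrite /q min_l// -st ltW.
apply: (right_cvg_seq (rX w s' _)); first by rewrite s0 (lt_le_trans st).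
  by move=> n; rewrite /q lt_min st klt.
apply/cvgrPdist_le => e e0.
have [m me] := ex_natSinv_lt e0.
exists m => // n /= mn.
have sq : s' <= q n (k n s) by rewrite le_min (ltW st) (ltW (klt n)).
rewrite ler0_norm ?subr_le0// opprB lerBlDr (le_trans _ (_ : n.+1%:R^-1 + s' <= _))//.
  rewrite /q ge_min; apply/orP; right.
  rewrite -[(k n s).+1%:R]natr1 mulrDl mul1r addrC lerD2l ler_pdivrMr//.
  by have /andP[] := kitv n.
rewrite lerD2r (le_trans _ (ltW me))// lef_pV2 ?posrE//.
by rewrite ler_nat.
Qed.

Lemma cadlag_progressive T F X : filtration T F -> adapted T F X ->
  (forall w, cadlag T (X ^~ w)) -> progressive T F X.
Proof.
by move=> fF aX cX; apply: right_continuous_progressive => // w; case: (cX w).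
Qed.

(** The sets whose preimage under clamping is measurable form a sigma-algebra containing the
    generators of the optional one, since adapted càdlàg processes are progressive. The larger
    filtration F' is allowed with a view to the filtration of all subsets. *)
Lemma optional_progressive T F F' X : filtration T F' ->
  (forall t, 0 <= t <= T -> F t `<=` F' t) -> optional T F X ->
  progressive T F' X.
Proof.
move=> fF' FF' oX t tT; have /andP[t0 tleT] := tT.
pose phi (p : R * g_sigma_algebraType (F' t)) : R * Omega := (clamp t p.1, p.2).
pose M := [set C : set (R * Omega) |
  measurable (phi @^-1` C : set (R * g_sigma_algebraType (F' t)))].
have phiT p : time_chance T (phi p).
  rewrite /phi /time_chance /=; split=> //=; rewrite in_itv /=.
  by have /andP[-> /le_trans ->] := clamp_itv p.1 t0.
have sM : sigma_algebra (time_chance T) M.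
  split; first by rewrite /M /= preimage_set0.
  - move=> C; rewrite /M /= => mC.
    rewrite (_ : phi @^-1` _ = ~` (phi @^-1` C)); first exact: measurableC.
    by apply/seteqP; split=> p /=; [case|].
  - by move=> C mC; rewrite /M /= preimage_bigcup; exact: bigcupT_measurable.
move=> _ B mB; rewrite setTI.
suff : M (time_chance T `&` (fun p : R * Omega => X p.1 p.2) @^-1` B).
  rewrite /M /= preimage_setI (_ : phi @^-1` time_chance T = setT) ?setTI//.
  by apply/seteqP; split=> p //= _; exact: phiT.
have : generated_by_processes T F (cadlag T)
    (time_chance T `&` (fun p : R * Omega => X p.1 p.2) @^-1` B).
  by apply: oX; exists B.
apply: smallest_sub => //.
move=> _ [Y [aY cY]] [D mD <-]; rewrite /M /= preimage_setI.
rewrite (_ : phi @^-1` time_chance T = setT); last first.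
  by apply/seteqP; split=> p //= _; exact: phiT.
rewrite setTI.
have aY' : adapted T F' Y by move=> s sT A YA; apply: FF' => //; exact: aY YA.
have := cadlag_progressive fF' aY' cY tT measurableT mD.
by rewrite setTI.
Qed.

Lemma progressive_at T F X t d' (S : measurableType d') (u : S -> R)
  (v : S -> g_sigma_algebraType (F t)) :
  progressive T F X -> 0 <= t <= T -> (forall x, 0 <= u x <= t) ->
  measurable_fun setT u -> measurable_fun setT v ->
  measurable_fun setT (fun x => X (u x) (v x)).
Proof.
move=> pX tT u0 mu mv.
have -> : (fun x => X (u x) (v x)) =
    (fun p : R * g_sigma_algebraType (F t) => X (clamp t p.1) p.2) \o
    (fun x => (u x, v x)).
  by apply/funext => x /=; rewrite clamp_id.
by apply: measurableT_comp; [exact: pX|exact: measurable_fun_pair].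
Qed.

Lemma progressive_adapted T F X : filtration T F -> progressive T F X ->
  adapted T F X.
Proof.
move=> fF pX; apply/adaptedP => // t tT; have /andP[t0 _] := tT.
apply: (progressive_at (u := cst t) (v := id) pX tT) => //.
by move=> w /=; rewrite t0 lexx.
Qed.

Lemma progressiveB T F X Y : progressive T F X -> progressive T F Y ->
  progressive T F (fun t w => X t w - Y t w).
Proof. by move=> pX pY t tT; apply: measurable_funB; [exact: pX|exact: pY]. Qed.

Lemma stopping_time_min_measurable T F tau t : filtration T F ->
  stopping_time T F (cst 0) tau -> 0 <= t <= T ->
  measurable_fun setT (fun w : g_sigma_algebraType (F t) => Num.min t (tau w)).
Proof.
move=> [sF mF] [tau0 Ftau] tT; have /andP[t0 tleT] := tT.
move=> mT; apply: (measurability _ (RGenOInfty.measurableE R)) => //.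
move=> _ [_ [x ->]] <-; rewrite setTI.
rewrite (_ : _ @^-1` _ = [set w | x < t] `&` ~` [set w | tau w <= x]); last first.
  apply/seteqP; split=> w /=; rewrite in_itv /= andbT lt_min.
    by move=> /andP[-> xt]; split=> //; apply/negP; rewrite -ltNge.
  by move=> [-> /negP]; rewrite -ltNge.
have [xt|tx] := ltP x t; last first.
  by rewrite (_ : [set _ | false] = set0) ?set0I//; apply/seteqP; split.
rewrite (_ : [set _ | true] = setT) ?setTI; last by apply/seteqP; split.
apply: measurableC; have [x0|x0] := ltP x 0.
  rewrite (_ : [set _ | _] = set0)//; apply/seteqP; split=> w //=.
  have /andP[tauw _] := tau0 w.
  by move=> taux; have := lt_le_trans x0 tauw; rewrite ltNge taux.
rewrite sub_measurableE; last exact: sF.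
by apply: (mF x t) => //; [exact: ltW|apply: Ftau; rewrite x0 (le_trans (ltW xt))].
Qed.

(** Up to time t the stopped process only sees [Num.min t (tau w)], which is measurable for F t,
    whereas tau need not be. *)
Lemma progressive_stopped T F X tau : filtration T F -> progressive T F X ->
  stopping_time T F (cst 0) tau -> progressive T F (stopped X tau).
Proof.
move=> fF pX stau t tT; have /andP[t0 tleT] := tT.
have [tau0 _] := stau.
rewrite /stopped (_ : (fun p : R * g_sigma_algebraType (F t) => _) =
    (fun p : R * g_sigma_algebraType (F t) =>
       X (Num.min (clamp t p.1) (Num.min t (tau p.2))) p.2)); last first.
  apply/funext => p; congr (X _ _); have /andP[_ ct] := clamp_itv p.1 t0.
  by rewrite minA (min_l ct).
apply: (progressive_at (u := fun p : R * g_sigma_algebraType (F t) =>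
  Num.min (clamp t p.1) (Num.min t (tau p.2))) (v := snd) pX tT).
- move=> p; have /andP[c0 ct] := clamp_itv p.1 t0.
  have /andP[tau0w _] := tau0 p.2.
  by rewrite !le_min c0 t0 tau0w /= ge_min ct.
- apply: measurable_minr.
    by apply: measurableT_comp; [exact: measurable_clamp|exact: measurable_fst].
  apply: (@measurableT_comp _ _ _ _ _ _
    (fun w : g_sigma_algebraType (F t) => Num.min t (tau w)) setT snd).
    exact: (stopping_time_min_measurable fF stau tT).
  exact: measurable_snd.
- exact: measurable_snd.
Qed.

Lemma stopping_time_cst T F t : filtration T F -> 0 <= t <= T ->
  stopping_time T F (cst 0) (cst t).
Proof.
move=> [sF _] tT; split=> // s sT /=; rewrite -(sub_measurableE (sF s sT)).
have [ts|st] := boolP (t <= s).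
  by rewrite (_ : [set _ | _] = setT)//; apply/seteqP; split.
by rewrite (_ : [set _ | _] = set0)//; apply/seteqP; split.
Qed.

Lemma stopping_time_min T F tau sigma : filtration T F ->
  stopping_time T F (cst 0) tau -> stopping_time T F (cst 0) sigma ->
  stopping_time T F (cst 0) (fun w => Num.min (tau w) (sigma w)).
Proof.
move=> [sF _] [tau0 Ftau] [sigma0 Fsigma]; split.
  move=> w; have /andP[/= t0 tT] := tau0 w; have /andP[/= s0 sT] := sigma0 w.
  by rewrite /= le_min t0 s0 ge_min tT.
move=> t tT; rewrite (_ : [set _ | _] =
  [set w | tau w <= t] `|` [set w | sigma w <= t]).
  rewrite -(sub_measurableE (sF t tT)); apply: measurableU;
    rewrite sub_measurableE; [exact: Ftau|exact: sF|exact: Fsigma|exact: sF].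
apply/seteqP; split=> w /=; first by rewrite ge_min => /orP.
by rewrite ge_min => /orP.
Qed.

End Progressive.

(** * From stopping times to all times *)

Section Evanescence.
Context {R : realType} {d : measure_display} {Omega : measurableType d}.
Variables (P : probability Omega R) (T : R) (F : R -> set (set Omega)).
Hypotheses (T0 : 0 < T) (cF : complete_right_continuous_filtration P T F).
Implicit Types X D : R -> Omega -> R.

Lemma complete_filtration : filtration T F.
Proof. by have [sF mF _ _] := cF; split=> // t /sF[]. Qed.

Lemma filtration_sub_measurable t : 0 <= t <= T -> F t `<=` measurable.
Proof. by have [sF _ _ _] := cF; move=> /sF[]. Qed.

Lemma negligible_filtration t : 0 <= t <= T -> P.-negligible `<=` F t.
Proof. by have [_ _ _] := cF; exact. Qed.

Definition kill (N : set Omega) X : R -> Omega -> R :=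
  fun t w => if `[< N w >] then 0 else X t w.

Lemma adapted_kill N X : P.-negligible N -> adapted T F X ->
  adapted T F (kill N X).
Proof.
move=> N0 aX; apply/(adaptedP _ complete_filtration) => t tT.
have sF := complete_filtration.1 t tT.
apply: measurable_fun_ifT; last 2 first.
- exact: measurable_cst.
- exact: ((adaptedP X complete_filtration).1 aX t tT).
apply: (measurable_fun_bool true) => //; rewrite setTI sub_measurableE//.
rewrite (_ : _ @^-1` _ = N); first exact: negligible_filtration.
by apply/seteqP; split=> w /=; [move=> /asboolP|move=> Nw; apply/asboolP].
Qed.

(** Paths are càdlàg only almost surely, while progressive measurability was derived from path
    properties valid everywhere. Completeness keeps the process adapted when it is set to 0 on the
    exceptional event. *)
Lemma cadlag_modification X : adapted T F X ->
  {ae P, forall w, cadlag T (X ^~ w)} ->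
  exists2 X', progressive T F X' & {ae P, forall w t, X' t w = X t w}.
Proof.
move=> aX cX; exists (kill (~` [set w | cadlag T (X ^~ w)]) X).
  apply: cadlag_progressive; first exact: complete_filtration.
    exact: adapted_kill.
  move=> w; rewrite /kill; case: asboolP => /= [_|/contrapT//].
  by split=> t _; [exact: cvg_cst|exact: is_cvg_cst].
apply: filterS cX => w cw t; rewrite /kill; by case: asboolP => //.
Qed.

(** Rational times are written as clamped rationals, so that each q : rat gives a time in [0, T]. *)
Lemma rational_clamps_dense (t : R) (Q : R -> Prop) : 0 <= t < T ->
  (\forall s \near t^'+, Q s) -> exists q : rat, t < clamp T (ratr q) /\ Q (clamp T (ratr q)).
Proof.
move=> /andP[t0 tT] /near_rightP[e e0 He].
have tm : t < Num.min (t + e) T by rewrite lt_min tT ltrDl e0.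
have [q] := rat_in_itvoo tm; rewrite in_itv /= lt_min => /andP[tq /andP[qe qT]].
exists q; rewrite clamp_id ?(ltW qT) ?(ltW (le_lt_trans t0 tq))//; split=> //.
by apply: He; rewrite tq.
Qed.

(* Replaces the optional section theorem: since D has right limits and vanishes
   at rational times, {|D| > e} has no accumulation point from the right, so
   its debut is attained; by measurable projection it is a stopping time. *)
Lemma progressive_evanescent D : progressive T F D ->
  (forall tau, stopping_time T F (cst 0) tau ->
     {ae P, forall w, D (tau w) w = 0}) ->
  {ae P, forall w t, 0 <= t < T -> cvg (D ^~ w @ t^'+)} ->
  {ae P, forall w t, 0 <= t <= T -> D t w = 0}.
Proof.
move=> pD D0 rD; have fF := complete_filtration.
have Tge0 := ltW T0.
have clampT (q : rat) : 0 <= clamp T (ratr q : R) <= T by exact: clamp_itv.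
have Dq : {ae P, forall w, forall n : nat,
    if unpickle n is Some q then D (clamp T (ratr q)) w = 0 else True}.
  apply: ae_foralln => n; case: (unpickle n) => [q|]; last exact: aeW.
  exact: (D0 (cst (clamp T (ratr q))) (stopping_time_cst fF (clampT q))).
pose good w := (forall t, 0 <= t < T -> D ^~ w @ t^'+ --> 0).
have agood : {ae P, forall w, good w}.
  apply: filterS2 rD Dq => w rw Dqw t tT; have /cvg_ex[/= l Dl] := rw t tT.
  suff -> : (0 : R) = l by [].
  apply: contrapT => l0.
  have l0' : 0 < `|l| by rewrite normr_gt0; apply/eqP => l0'; apply: l0.
  move/cvgrPdist_lt : Dl => /(_ _ l0') /(rational_clamps_dense tT)[q [_]].
  have := Dqw (pickle q); rewrite pickleK => ->.
  by rewrite subr0 ltxx.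
have key (n : nat) : {ae P, forall w t, 0 <= t <= T -> `|D t w| <= n.+1%:R^-1}.
  set e : R := n.+1%:R^-1.
  have e0 : 0 < e by rewrite invr_gt0.
  pose S w := [set t | 0 <= t <= T /\ e < `|D t w|].
  have hlb w : has_lbound (S w) by exists 0 => t [/andP[]].
  (* An infimum that is not attained would be approached from the right by times where |D| > e,
     against the right limit 0. *)
  have Sinf w : good w -> S w !=set0 -> S w (inf (S w)).
    move=> gw Sw; apply: contrapT => nS.
    have m0 : 0 <= inf (S w) by apply: lb_le_inf => // t [/andP[]].
    have mT : inf (S w) < T.
      have [t St] := Sw; have [/andP[_ tT] _] := St.
      apply: lt_le_trans tT; rewrite lt_neqAle (ge_inf (hlb w) St) andbT.
      by apply/eqP => mt; apply: nS; rewrite mt.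
    have := gw (inf (S w)); rewrite m0 mT => /(_ isT) /cvgrPdist_lt /(_ _ e0).
    move=> /near_rightP[a a0 Ha].
    have [t St ta] := inf_adherent a0 (conj Sw (hlb w)).
    have := St; rewrite /S /= => -[_]; rewrite ltNge => /negP; apply; apply/ltW.
    have := Ha t; rewrite ta sub0r normrN andbT; apply.
    rewrite lt_neqAle (ge_inf (hlb w) St) andbT.
    by apply/eqP => mt; apply: nS; rewrite mt.
  pose sigma w := if `[< good w /\ S w !=set0 >] then inf (S w) else T.
  have sigma0 w : 0 <= sigma w <= T.
    rewrite /sigma; case: asboolP => [[gw Sw]|_]; last by rewrite Tge0 lexx.
    by have [] := Sinf w gw Sw.
  have ssigma : stopping_time T F (cst 0) sigma.
    split=> // t tT; have /andP[t0 tleT] := tT.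
    have [sF mF] := fF.
    (* For t = T the event is everything; for t < T the default value T of [sigma] keeps bad paths
       and empty sets out of it. *)
    move: (tleT); rewrite le_eqVlt => /predU1P[->|tltT].
      rewrite (_ : [set _ | _] = setT).
        by rewrite -(sub_measurableE (sF T _))// Tge0 lexx.
      by apply/seteqP; split=> // w _ /=; have /andP[] := sigma0 w.
    (* The projection runs over all of [0, T], and clamping confines the search to [0, t], where D
       is jointly measurable with respect to F t. *)
    pose Pi := [set w | exists s : R, 0 <= s <= T /\ e < `|D (clamp t s) w|].
    rewrite (_ : [set _ | _] = Pi `&` [set w | good w]).
      have FPi : F t Pi.
        apply: (measurable_projection (P := P) T (sF t tT)
          (filtration_sub_measurable tT) (negligible_filtration tT)
          (C := [set p | e < `|D (clamp t p.1) p.2|])).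
        apply: measurable_bool_set; apply: measurable_fun_ltr.
          exact: measurable_cst.
        by apply: measurableT_comp => //; exact: pD.
      have Fg : F t [set w | good w].
        rewrite -[X in F t X]setCK -(sub_measurableE (sF t tT)).
        apply: measurableC; rewrite sub_measurableE; last exact: sF.
        exact: negligible_filtration.
      move: FPi Fg; rewrite -(sub_measurableE (sF t tT)).
      exact: measurableI.
    apply/seteqP; split=> w /=; rewrite /sigma.
      case: asboolP => [[gw Sw] st|_]; last by rewrite leNgt tltT.
      have [/andP[s0 sT] sD] := Sinf w gw Sw.
      split=> //; exists (inf (S w)); split; first by rewrite s0.
      by rewrite clamp_id// s0.
    move=> [[s [_ sD]] gw].
    have /andP[c0 ct] := clamp_itv s t0.
    have Sc : S w (clamp t s) by split=> //; rewrite c0 (le_trans ct).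
    case: asboolP => [_|[]]; last by split=> //; exists (clamp t s).
    by apply: le_trans ct; exact: ge_inf.
  apply: filterS2 (D0 _ ssigma) agood => w Dw gw t tT.
  rewrite leNgt; apply/negP => tD.
  have Sw : S w !=set0 by exists t.
  have [_] := Sinf w gw Sw; move: Dw; rewrite /sigma asboolT// => ->.
  by rewrite normr0 ltNge ltW.
apply: filterS (ae_foralln key) => w Hw t tT.
apply/eqP; rewrite -normr_le0 leNgt; apply/negP => D1.
have [n nD] := ex_natSinv_lt D1.
by have := Hw n t tT; rewrite leNgt nD.
Qed.

End Evanescence.

(** * Randomised stopping times *)

Section Quantile.
Context {R : realType}.
Variables (T : R).
Hypothesis T0 : 0 < T.
Implicit Types x : R -> R.

(* randomised_time T rho Z w is convertible to quantile T (rho ^~ w) (Z w). *)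
Definition quantile x (z : R) : R := inf [set t | 0 <= t <= T /\ z < x t].

Definition distribution_path x : Prop :=
  [/\ cadlag T x, forall s t, 0 <= s -> s <= t -> t <= T -> x s <= x t,
      0 <= x 0 & x T = 1].

Lemma quantile_itv x z : 0 <= quantile x z <= T.
Proof.
rewrite /quantile; set S := [set t | _].
have [->|/set0P[t St]] := eqVneq S set0; first by rewrite inf0 lexx ltW.
have hlb : has_lbound S by exists 0 => u [/andP[]].
apply/andP; split; first by apply: lb_le_inf; [exists t|move=> u [/andP[]]].
by have [/andP[_ tT] _] := St; apply: le_trans tT; exact: ge_inf.
Qed.

Lemma quantile_large x z : distribution_path x -> 1 <= z -> quantile x z = 0.
Proof.
move=> [_ ndx _ xT] z1; rewrite /quantile (_ : [set _ | _] = set0) ?inf0//.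
apply/seteqP; split=> t //= [/andP[t0 tT]].
rewrite ltNge => /negP; apply; apply: le_trans z1.
by rewrite -xT; exact: ndx.
Qed.

Lemma rational_clamp_between (s t : R) : 0 <= s /\ s <= T -> s < t ->
  exists q : rat, s <= clamp T (ratr q) < t.
Proof.
move=> [s0]; rewrite le_eqVlt => /predU1P[-> Tt|sT st].
  (* For s = T any rational above T will do, since it is clamped to T. *)
  have T1 : T < T + 1 by rewrite ltrDl.
  have [q] := rat_in_itvoo T1; rewrite in_itv /= => /andP[Tq _]; exists q.
  by rewrite /clamp (min_r (ltW Tq)) (max_r (ltW T0)) lexx.
have sm : s < Num.min t T by rewrite lt_min st.
have [q] := rat_in_itvoo sm; rewrite in_itv /= lt_min => /andP[sq /andP[qt qT]].
by exists q; rewrite clamp_id ?(ltW sq) ?qt// (ltW qT) (le_trans s0 (ltW sq)).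
Qed.

(** Monotonicity: a path above z at s is above z at a rational time of [[s, t[]. This countable
    description yields the measurability of quantiles and the stopping property of level times. *)
Lemma quantile_ltP x z t : distribution_path x -> z < 1 ->
  quantile x z < t <-> exists q : rat,
    clamp T (ratr q) < t /\ z < x (clamp T (ratr q)).
Proof.
move=> [cx ndx x0 xT] z1; have Tge0 := ltW T0.
have hi : has_inf [set t | 0 <= t <= T /\ z < x t].
  by split; [exists T; rewrite /= Tge0 lexx xT|exists 0 => u [/andP[]]].
split=> [qt|[q [qt zq]]]; last first.
  apply: le_lt_trans qt; apply: ge_inf; first exact: hi.2.
  by split=> //; exact: clamp_itv.
move: qt; rewrite -subr_gt0 => qt.
have [s [/andP[s0 sT] zs]] := inf_adherent qt hi.
rewrite addrC subrK => st.
have [q /andP[sq qt']] := rational_clamp_between (conj s0 sT) st.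
exists q; split=> //; apply: lt_le_trans zs _; apply: ndx => //.
by have /andP[] := clamp_itv (ratr q : R) Tge0.
Qed.

(* extended_path T rho w is convertible to extend T (rho ^~ w). *)
Definition extend x (t : R) : R := if t < 0 then 0 else x (Num.min t T).

Lemma extend_itv x t : distribution_path x -> 0 <= extend x t <= 1.
Proof.
move=> [_ ndx x0 xT]; have Tge0 := ltW T0; rewrite /extend.
have [t0|t0] := ltP t 0; first by rewrite lexx ler01.
have m0 : 0 <= Num.min t T by rewrite le_min t0.
have mT : Num.min t T <= T by rewrite ge_min lexx orbT.
by rewrite (le_trans x0) ?ndx//= -xT ndx.
Qed.

Lemma extend_nondecreasing x : distribution_path x ->
  nondecreasing (extend x : R -> R).
Proof.
move=> dx s t st; have [_ ndx x0 xT] := dx; have Tge0 := ltW T0.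
have /andP[et0 _] := extend_itv t dx.
rewrite /extend; have [s0|s0] := ltP s 0; first exact: et0.
rewrite ltNge (le_trans s0 st) /=; apply: ndx.
- by rewrite le_min s0.
- by rewrite le_min !ge_min st lexx orbT.
- by rewrite ge_min lexx orbT.
Qed.

Lemma extend_right_continuous x : distribution_path x ->
  right_continuous (extend x : R -> R).
Proof.
move=> [[rx _] ndx x0 xT] t; rewrite {2}/extend.
have [t0|t0] := ltP t 0.
  apply: (@cvg_right_eq _ (cst 0)); last exact: cvg_cst.
  exists (- t); first by rewrite oppr_gt0.
  by move=> s /andP[_]; rewrite subrr /extend => ->.
have [tT|Tt] := ltP t T.
  apply: (@cvg_right_eq _ x); last by apply: rx; rewrite t0.
  exists (T - t); first by rewrite subr_gt0.
  move=> s /andP[ts]; rewrite addrC subrK => sT.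
  by rewrite /extend ltNge (le_trans t0 (ltW ts)) /= min_l// ltW.
apply: (@cvg_right_eq _ (cst (x T))); last exact: cvg_cst.
exists 1 => // s /andP[ts _].
by rewrite /extend ltNge (le_trans t0 (ltW ts)) /= min_r// (le_trans Tt (ltW ts)).
Qed.

(** Together with [quantile_leW] this sandwiches, within [0, 1[, the levels with quantile at most t
    between z < x t and z <= x t. The gap is one point, null for the uniform law. *)
Lemma quantile_le x z t : distribution_path x -> 0 <= z ->
  z < extend x t -> quantile x z <= t.
Proof.
move=> [_ ndx x0 xT] z0; have Tge0 := ltW T0; rewrite /extend.
have [t0|t0 zx] := ltP t 0; first by rewrite ltNge z0.
apply: (@le_trans _ _ (Num.min t T)); last by rewrite ge_min lexx.
apply: ge_inf; first by exists 0 => u [/andP[]].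
by split=> //; rewrite le_min t0 Tge0 ge_min lexx orbT.
Qed.

(** Right-continuity: if x t < z, the path stays below z for a while after t, so z is not exceeded
    before some t + e. *)
Lemma quantile_leW x z t : distribution_path x -> z < 1 ->
  quantile x z <= t -> z <= extend x t.
Proof.
move=> dx z1 qt; have [[rx _] ndx x0 xT] := dx; have Tge0 := ltW T0.
have t0 : 0 <= t by apply: le_trans qt; have /andP[] := quantile_itv x z.
rewrite /extend ltNge t0 /=; have [tT|_] := ltP t T; last by rewrite xT ltW.
rewrite leNgt; apply/negP => xz.
have tT' : 0 <= t < T by rewrite t0.
have xz' : 0 < z - x t by rewrite subr_gt0.
move/cvgrPdist_lt : (rx t tT') => /(_ _ xz') /near_rightP[e e0 He].
have qte : quantile x z < t + e by rewrite (le_lt_trans qt)// ltrDl.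
move/(quantile_ltP _ dx z1) : qte => [q [cq zq]].
have /andP[c0 cT] := clamp_itv (ratr q : R) Tge0.
have [ct|tc] := leP (clamp T (ratr q)) t.
  by have := ndx _ _ c0 ct (ltW tT); rewrite leNgt (lt_trans xz).
have := He (clamp T (ratr q)); rewrite tc cq => /(_ isT).
rewrite ltr_norml opprB => /andP[+ _]; rewrite ltrD2l ltrN2.
by rewrite ltNge (ltW zq).
Qed.

Lemma measurable_quantile d (S : measurableType d) (x : S -> R -> R)
  (z : S -> R) : (forall s, distribution_path (x s)) ->
  (forall t, 0 <= t <= T -> measurable_fun setT (x ^~ t)) ->
  measurable_fun setT z -> measurable_fun setT (fun s => quantile (x s) (z s)).
Proof.
move=> dx mx mz; apply: (measurability _ (RGenInftyO.measurableE R)) => //.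
move=> _ [_ [t ->]] <-; rewrite setTI.
have Tge0 := ltW T0.
have [t0|t0] := leP t 0.
  rewrite (_ : _ @^-1` _ = set0)//; apply/seteqP; split=> s //=.
  by rewrite in_itv /= ltNge (le_trans t0)//; have /andP[] := quantile_itv (x s) (z s).
pose A (q : rat) := [set s | (clamp T (ratr q) < t) && (z s < x s (clamp T (ratr q)))].
(* At levels z >= 1 the quantile is the infimum 0 of the empty set, which is below t > 0. *)
rewrite (_ : _ @^-1` _ = [set s | 1 <= z s] `|` \bigcup_q A q).
  apply: measurableU.
    by apply: measurable_bool_set; apply: measurable_fun_ler.
  apply: bigcupT_measurable_rat => q; apply: measurable_bool_set.
  apply: measurable_and; first exact: measurable_cst.
  by apply: measurable_fun_ltr => //; apply: mx; exact: clamp_itv.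
apply/seteqP; split=> s /=; rewrite in_itv /=.
  have [z1|z1] := leP 1 (z s); first by left.
  by move/(quantile_ltP _ (dx s) z1) => [q [ct zt]]; right; exists q => //; rewrite /A /= ct zt.
have [z1|z1] := leP 1 (z s); first by rewrite quantile_large.
move=> [//|[q _ /andP[ct zt]]]; apply/(quantile_ltP _ (dx s) z1).
by exists q.
Qed.

Lemma measurable_idR : measurable_fun setT (id : measurableTypeR R -> R).
Proof. by move=> _ Y mY; rewrite setTI. Qed.

Definition idR : {mfun measurableTypeR R >-> R} :=
  HB.pack (id : measurableTypeR R -> R)
    (isMeasurableFun.Build _ _ _ _ _ measurable_idR).

(** The identity only changes the measurable type, from [measurableTypeR R] to R. *)
Definition unif : probability R R :=
  distribution (uniform_prob (@ltr01 R)) idR.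

Lemma unifE (A : set R) : measurable A -> unif A = lebesgue_measure (A `&` `[0, 1]).
Proof.
move=> mA; rewrite /unif /distribution /pushforward /= preimage_id /uniform_prob.
rewrite integral_uniform_pdf (eq_integral (cst 1%E)).
  by rewrite integral_cst ?mul1e//; exact: measurableI.
move=> z; rewrite inE /= in_itv /= => -[_ z01]; rewrite /uniform_pdf z01.
by rewrite subr0 invr1.
Qed.

Lemma measurable_quantile_path x : distribution_path x ->
  measurable_fun setT (quantile x).
Proof.
by move=> dx; apply: (@measurable_quantile _ R (fun=> x) id) => //;
  move=> t _; exact: measurable_cst.
Qed.

Lemma unif_quantile x a b : distribution_path x -> a < b ->
  unif (quantile x @^-1` `]a, b]) = (extend x b - extend x a)%:E.
Proof.
move=> dx ab.
have mq := measurable_quantile_path dx.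
have mS : measurable (quantile x @^-1` `]a, b]).
  by rewrite -[X in measurable X]setTI; exact: mq.
rewrite unifE//; set S := _ `&` _.
have mS' : measurable S by exact: measurableI.
have /andP[a0 a1] := extend_itv a dx; have /andP[b0 b1] := extend_itv b dx.
have eab := extend_nondecreasing dx (ltW ab).
apply/eqP; rewrite eq_le; apply/andP; split.
  (* The quantile at level 1 is the default 0, which may lie in []a, b]]; this accounts for the
     additional null point 1. *)
  apply: (@le_trans _ _ (lebesgue_measure (`[extend x a, extend x b] `|` `[1, 1] : set R))).
    apply: le_measure; rewrite ?inE//; first exact: measurableU.
    move=> z [/=]; rewrite !in_itv /= => /andP[aq qb] /andP[z0].
    rewrite le_eqVlt => /predU1P[->|z1]; [right|left].
      by rewrite lexx eqxx.
    rewrite (quantile_leW dx z1 qb) andbT leNgt; apply/negP => za.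
    by move: aq; rewrite ltNge (quantile_le dx z0 za).
  apply: le_trans (measureU2 _ _ _) _ => //.
  have mab : (lebesgue_measure (`[extend x a, extend x b] : set R) <=
      (extend x b - extend x a)%:E)%E.
    by rewrite lebesgue_measure_itv /=; case: ifPn => // _; rewrite lee_fin subr_ge0.
  have m1 : (lebesgue_measure (`[1%R, 1%R]%classic : set R) <= 0)%E.
    by rewrite lebesgue_measure_itv /= lte_fin ltxx.
  by rewrite -[leRHS]adde0; apply: leeD; [exact: mab|exact: m1].
apply: (@le_trans _ _ (lebesgue_measure (`]extend x a, extend x b[%classic : set R))).
  rewrite lebesgue_measure_itv /= lte_fin; case: ifPn => [_|]; first by rewrite -EFinB.
  by rewrite -leNgt => eba; rewrite lee_fin subr_le0.
apply: le_measure; rewrite ?inE//.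
move=> z; rewrite /= in_itv /= => /andP[az zb].
have z0 : 0 <= z by apply: le_trans (ltW az).
have z1 : z < 1 by apply: lt_le_trans b1.
split; rewrite /= in_itv /= ?z0 ?(ltW z1)// (quantile_le dx z0 zb) andbT.
by rewrite ltNge; apply/negP => /(quantile_leW dx z1); rewrite leNgt az.
Qed.

(** Inverse transform sampling: both measures agree on half-open intervals by [unif_quantile], and
    these determine a Lebesgue-Stieltjes measure. *)
Lemma stieltjes_quantile x A : distribution_path x -> measurable A ->
  stieltjes (extend x) A = unif (quantile x @^-1` A).
Proof.
move=> dx mA.
pose c : cumulative R R := HB.pack_for (cumulative R R) (extend x) (isCumulative.Build R _ R (extend x)
  (extend_nondecreasing dx) (extend_right_continuous dx)).
have -> : stieltjes (extend x) = lebesgue_stieltjes_measure c :> (set _ -> _).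
  exact: (stieltjesE c).
have mq := measurable_quantile_path dx.
pose Q : {mfun R >-> measurableTypeR R} := HB.pack
  (quantile x : R -> measurableTypeR R)
  (isMeasurableFun.Build _ _ _ _ _ (mq : measurable_fun setT (quantile x : R -> measurableTypeR R))).
have := @lebesgue_stieltjes_measure_unique _ c (distribution unif Q).
apply => //.
move=> X /ocitvP[->|[[a b] /= ab ->]]; first by rewrite !measure0.
rewrite /distribution /pushforward /= unif_quantile//.
rewrite /lebesgue_stieltjes_measure /measure_extension measurable_mu_extE//=.
  by rewrite wlength_itv_bnd ?ltW.
by exists (a, b).
Qed.

End Quantile.

Section Bounds.
Context {R : realType} {d : measure_display} {Omega : measurableType d}.
Variables (P : probability Omega R) (T : R) (F : R -> set (set Omega)).
Hypotheses (T0 : 0 < T) (cF : complete_right_continuous_filtration P T F).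

Definition running_sup (X : R -> Omega -> R) (w : Omega) : \bar R :=
  ereal_sup [set `|X t w|%:E | t in `[0, T]].

Lemma le_running_sup X t w : 0 <= t <= T -> (`|X t w|%:E <= running_sup X w)%E.
Proof.
by move=> tT; apply: ereal_sup_ubound; exists t => //=; rewrite in_itv.
Qed.

Lemma running_sup_ge0 X w : (0 <= running_sup X w)%E.
Proof.
apply: le_trans (@le_running_sup X 0 w _); first by rewrite lee_fin.
by rewrite lexx ltW.
Qed.

Definition rational_sample (X : R -> Omega -> R) (w : Omega) (n : nat) : \bar R :=
  if unpickle n is Some q then `|X (clamp T (ratr q)) w|%:E else 0%E.

(** Makes the supremum countable, hence measurable. Right-continuity handles t < T; T itself is a
    clamped rational. *)
Lemma running_sup_rational X w : cadlag T (X ^~ w) ->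
  running_sup X w = esups (rational_sample X w) 0%N.
Proof.
move=> [rX _]; apply/eqP; rewrite eq_le; apply/andP; split.
  apply: ge_ereal_sup => _ [t + <-]; rewrite /= in_itv /= => /andP[t0 tT].
  have sup_q (q : rat) : (`|X (clamp T (ratr q)) w|%:E <= esups (rational_sample X w) 0%N)%E.
    by apply: ereal_sup_ubound; exists (pickle q) => //=; rewrite /rational_sample pickleK.
  move: tT; rewrite le_eqVlt => /predU1P[->|tT].
    have T1 : 0 <= T /\ T <= T by rewrite lexx ltW.
    have [q /andP[Tq _]] := rational_clamp_between T0 T1 (ltr_pwDr ltr01 (lexx T)).
    suff <- : clamp T (ratr q) = T by [].
    by apply/eqP; rewrite eq_le Tq andbT; have /andP[] := clamp_itv (ratr q : R) (ltW T0).
  rewrite leNgt; apply/negP => sX.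
  have tT' : 0 <= t < T by rewrite t0.
  move: sX; set s := esups _ _ => sX.
  have s0 : (0 <= s)%E by apply: le_trans (sup_q 0); rewrite lee_fin.
  have fs : s \is a fin_num by rewrite ge0_fin_numE// (lt_trans sX) ?ltry.
  have e0 : 0 < `|X t w| - fine s by rewrite subr_gt0 -lte_fin fineK.
  move/cvgrPdist_lt : (rX t tT') => /(_ _ e0) /(rational_clamps_dense tT')[q [_]].
  apply/negP; rewrite -leNgt; apply: le_trans (ler_dist_dist _ _).
  apply: le_trans (ler_norm _); rewrite lerD2l lerN2 -lee_fin fineK//.
apply: ge_ereal_sup => _ [n _ <-]; rewrite /rational_sample; case: (unpickle n) => [q|]; last exact: running_sup_ge0.
by apply: le_running_sup; exact: clamp_itv (ltW T0).
Qed.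

Lemma measurable_running_sup X : adapted T F X -> (forall w, cadlag T (X ^~ w)) ->
  measurable_fun setT (running_sup X : g_sigma_algebraType (F T) -> \bar R).
Proof.
move=> aX cX; have fF := complete_filtration cF.
rewrite (_ : running_sup X = fun w => esups (rational_sample X w) 0%N); last first.
  by apply/funext => w; exact: running_sup_rational.
apply: (@measurable_fun_esups _ (g_sigma_algebraType (F T)) _ _ 
    (fun n w => rational_sample X w n)) => n; rewrite /rational_sample.
case: (unpickle n) => [q|]; last exact: measurable_cst.
apply/measurable_EFinP; apply: measurableT_comp => //.
have /andP[c0 cT] := clamp_itv (ratr q : R) (ltW T0).
exact: adapted_later fF aX c0 cT (lexx T).
Qed.

Lemma integrable_running_sup X : adapted T F X -> Lb P T X ->
  P.-integrable setT (running_sup X).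
Proof.
move=> aX [cX _ X_oo]; apply/integrableP; split.
  move=> _ Y mY; have TT : 0 <= T <= T by rewrite lexx ltW.
  apply: (filtration_sub_measurable cF TT).
  rewrite -(sub_measurableE ((complete_filtration cF).1 T TT)).
  exact: (measurable_running_sup aX cX).
rewrite (eq_integral (running_sup X))// => w _.
by rewrite gee0_abs//; exact: running_sup_ge0.
Qed.

End Bounds.

Section LevelTimes.
Context {R : realType} {d : measure_display} {Omega : measurableType d}.
Variables (P : probability Omega R) (T : R) (F : R -> set (set Omega)).
Hypotheses (T0 : 0 < T) (cF : complete_right_continuous_filtration P T F).

Lemma generating_distribution_path rho w : generating_process T F rho ->
  distribution_path T (rho ^~ w).
Proof. by move=> [_ crho ndrho rho0 rhoT]; split=> // s t; exact: ndrho. Qed.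

(** The path may exceed z immediately after t without exceeding it at t, so the event is first found
    in F s for all s > t; right-continuity of the filtration then brings it into F t. *)
Lemma level_time_stopping rho z : generating_process T F rho -> 0 <= z < 1 ->
  stopping_time T F (cst 0) (level_time T rho z).
Proof.
move=> grho /andP[z0 z1]; rewrite /level_time z1.
have fF := complete_filtration cF; have [sF mF] := fF.
have [arho _ _ _ _] := grho.
have dp w := generating_distribution_path w grho.
split; first by move=> w; exact: (quantile_itv T0 (rho ^~ w) z).
move=> t /andP[t0]; rewrite le_eqVlt => /predU1P[->|tT].
  have TT : 0 <= T <= T by rewrite lexx ltW.
  rewrite (_ : [set _ | _] = setT); first by rewrite -(sub_measurableE (sF T TT)).
  apply/seteqP; split=> // w _ /=.
  by have /andP[] := quantile_itv T0 (rho ^~ w) z.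
have [_ _ rcF _] := cF; apply: (rcF t); first by rewrite t0.
move=> s; rewrite /= in_itv /= => /andP[ts sT].
have s0 : 0 <= s by rewrite (le_trans t0) ?ltW.
have sT' : 0 <= s <= T by rewrite s0.
pose A (n : nat) (q : rat) := [set w | (clamp T (ratr q) < Num.min s (t + n.+1%:R^-1))
  && (z < rho (clamp T (ratr q)) w)].
rewrite (_ : [set _ | _] = \bigcap_n \bigcup_q A n q).
  rewrite -(sub_measurableE (sF s sT')).
  apply: bigcapT_measurable => n; apply: bigcupT_measurable_rat => q.
  have [c0 cT] := andP (clamp_itv (ratr q : R) (ltW T0)).
  have [cs|sc] := ltP (clamp T (ratr q)) (Num.min s (t + n.+1%:R^-1)).
    apply: measurable_bool_set; rewrite /= cs /=; apply: measurable_fun_ltr.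
      exact: measurable_cst.
    apply: adapted_later fF arho c0 _ sT.
    by move: cs; rewrite lt_min => /andP[/ltW].
  rewrite (_ : A n q = set0)//; apply/seteqP; split=> w //.
  by rewrite /A /= ltNge sc.
apply/seteqP; split=> w /=.
  move=> qt n _; have : quantile T (rho ^~ w) z < Num.min s (t + n.+1%:R^-1).
    by rewrite (le_lt_trans qt)// lt_min ts ltrDl invr_gt0 ltr0n.
  move/(quantile_ltP T0 _ (dp w) z1) => [q [cq zq]].
  by exists q => //; rewrite /A /= cq zq.
move=> Aw; rewrite leNgt; apply/negP => tq.
have tq' : 0 < quantile T (rho ^~ w) z - t by rewrite subr_gt0.
have [n nq] := ex_natSinv_lt tq'.
have [q _ /andP[cq zq]] := Aw n I.
have : quantile T (rho ^~ w) z < Num.min s (t + n.+1%:R^-1).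
  by apply/(quantile_ltP T0 _ (dp w) z1); exists q.
rewrite lt_min => /andP[_]; rewrite ltNge => /negP; apply; apply/ltW.
by move: nq; rewrite ltrBrDl.
Qed.

End LevelTimes.

(** * Stieltjes payoffs as means over the opponent's level *)

Section PathPayoff.
Context {R : realType}.
Variables (T : R) (T0 : 0 < T) (x : R -> R).
Hypothesis dx : distribution_path T x.
Let q := quantile T x.

Lemma bounded_unif_integrable (f : R -> R) (M : R) : measurable_fun setT f ->
  (forall z, `|f z| <= M) -> (@unif R).-integrable setT (EFin \o f).
Proof.
move=> mf fM; apply: measurable_bounded_integrable => //.
  by apply: (le_lt_trans (probability_le1 _ measurableT)); rewrite ltry.
exists M; split; first exact: num_real.
by move=> M' MM' z _; apply: le_trans (fM z) (ltW MM').
Qed.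

Let Q : {mfun R >-> measurableTypeR R} := HB.pack
  (q : R -> measurableTypeR R)
  (isMeasurableFun.Build _ _ _ _ _ (measurable_quantile_path T0 dx :
     measurable_fun setT (q : R -> measurableTypeR R))).

Lemma stieltjes_Rintegral (f : R -> R) (D : set R) (M : R) :
  measurable D -> measurable_fun setT f -> (forall z, `|f z| <= M) ->
  \int[stieltjes (extend T x)]_(u in D) f u =
  \int[@unif R]_z (f (q z) * \1_D (q z)).
Proof.
move=> mD mf fM; rewrite /Rintegral; congr fine.
rewrite (@eq_measure_integral _ _ _ _ (distribution (@unif R) Q)); last first.
  by move=> A mA _; rewrite stieltjes_quantile.
have mfD : measurable_fun setT (fun u => f u * \1_D u).
  by apply: measurable_funM => //; exact: measurable_indic.
rewrite integral_mkcond.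
transitivity (\int[distribution (@unif R) Q]_u (f u * \1_D u)%:E)%E.
  apply: eq_integral => u _; rewrite patchE indicE.
  by case: ifPn => _; rewrite ?mulr1 ?mulr0.
rewrite integral_pushforward//.
- by apply/measurable_EFinP.
- apply: (@bounded_unif_integrable (fun z => f (q z) * \1_D (q z)) M).
    by apply: (measurableT_comp mfD); exact: measurable_quantile_path.
  move=> z; rewrite normrM indicE; case: (_ \in _); rewrite ?normr1 ?mulr1//.
  by rewrite normr0 mulr0 (le_trans _ (fM z)).
Qed.

(** T + 1 stands for any bound above T: all quantiles are below it, and the interval is
    nondegenerate even for t = T. *)
Lemma unif_quantile_gt t : 0 <= t <= T ->
  fine (unif (q @^-1` `]t, T + 1])) = 1 - x t.
Proof.
move=> /andP[t0 tT]; have [_ _ _ xT] := dx.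
have tT1 : t < T + 1 by rewrite (le_lt_trans tT)// ltrDl.
rewrite unif_quantile// /extend ltNge (le_trans (ltW T0)) ?lerDl//=.
by rewrite min_r ?lerDl// xT ltNge t0 /= (min_l tT).
Qed.

(** The atom at t is the limit of the masses of []t - 1/(n+1), t]]. For t = 0 these reach into
    negative times, where [extend] is 0, so the initial jump is counted. *)
Lemma unif_quantile_jump t : 0 <= t <= T ->
  fine (unif (q @^-1` [set t])) = x t - lim (extend T x @ t^'-).
Proof.
move=> /andP[t0 tT].
have ndx := extend_nondecreasing T0 dx.
have cl : cvg (extend T x @ t^'-).
  apply: nondecreasing_at_left_is_cvgr.
    by apply: nearW => s u v _ _; exact: ndx.
  by apply: nearW => s; exists 1 => _ [u _ <-]; have /andP[] := extend_itv T0 u dx.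
pose s (n : nat) : R := t - n.+1%:R^-1.
have st n : s n < t by rewrite ltrBlDr ltrDl invr_gt0 ltr0n.
have s_t : s @ \oo --> t.
  rewrite -[X in _ --> X]subr0; apply: cvgB; first exact: cvg_cst.
  exact: cvg_harmonic.
have sl : extend T x \o s @ \oo --> lim (extend T x @ t^'-).
  by move/cvg_at_leftP : cl; apply; split.
pose A n := q @^-1` `]s n, t].
have mA n : measurable (A n).
  by rewrite /A -[X in measurable X]setTI; exact: (measurable_quantile_path T0 dx).
have AE : \bigcap_n A n = q @^-1` [set t].
  apply/seteqP; split=> z /=; last first.
    by move=> qt n _; rewrite /A /= in_itv /= qt st lexx.
  move=> Az; have := Az 0%N I; rewrite /A /= in_itv /= => /andP[_ qt].
  apply/eqP; rewrite eq_le qt /= leNgt; apply/negP => qt'.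
  have tq : 0 < t - q z by rewrite subr_gt0.
  have [n nq] := ex_natSinv_lt tq.
  have := Az n I; rewrite /A /= in_itv /= => /andP[+ _].
  by rewrite ltNge => /negP; apply; rewrite /s lerBrDr -lerBrDl ltW.
have mcap : measurable (\bigcap_n A n) by exact: bigcapT_measurable.
have := @nonincreasing_cvg_mu _ _ _ (@unif R) A _ mA mcap.
have -> : (unif (A 0%N) < +oo)%E.
  by rewrite (le_lt_trans (probability_le1 _ _)) ?ltry.
have nA : nonincreasing_seq A.
  move=> m n mn; apply/subsetPset => z; rewrite /A /= !in_itv /= => /andP[sq ->].
  rewrite andbT (le_lt_trans _ sq)// lerD2l lerN2 lef_pV2 ?posrE ?ltr0n//.
  by rewrite ler_nat.
move=> /(_ isT nA); rewrite AE => cA.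
have : (fun n => (extend T x t - extend T x (s n))%:E) @ \oo --> unif (q @^-1` [set t]).
  apply: cvg_trans cA; apply: near_eq_cvg; apply: nearW => n /=.
  by rewrite unif_quantile.
have : (fun n => (extend T x t - extend T x (s n))%:E) @ \oo -->
    (extend T x t - lim (extend T x @ t^'-))%:E.
  apply: cvg_EFin; first exact: nearW.
  by apply: cvgB; [exact: cvg_cst|exact: sl].
move=> h1 h2; rewrite (cvg_unique _ h2 h1)//=.
by rewrite {1}/extend ltNge t0 /= (min_l tT).
Qed.

(** The game payoff for own time t and opponent's time u: (a, b) is (f, g) for Player 1 and (g, f)
    for Player 2. *)
Definition switch (a b h : R -> R) (t u : R) : R :=
  if t < u then a t else if t == u then h t else b u.

(** The three terms are the contributions of the levels at which the opponent stops after t, in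
    [[theta, t[], and at t. Levels at which the opponent stops before theta contribute 0. *)
Lemma path_payoff (a b h : R -> R) (M theta t : R) : 0 <= theta -> theta <= t ->
  t <= T -> measurable_fun setT (b \o clamp T) ->
  (forall u, 0 <= u <= T -> `|b u| <= M) ->
  a t * (1 - x t) + \int[stieltjes (extend T x)]_(u in `[theta, t[) b u +
    h t * (x t - lim (extend T x @ t^'-)) =
  \int[@unif R]_z (if q z < theta then 0 else switch a b h t (q z)).
Proof.
move=> theta0 thetat tT mb bM; have t0 := le_trans theta0 thetat.
have tT' : 0 <= t <= T by rewrite t0.
have Tge0 := ltW T0.
have mq : measurable_fun setT q := measurable_quantile_path T0 dx.
have bM' u : `|(b \o clamp T) u| <= M by apply: bM; exact: clamp_itv.
(* Nothing is known of b outside [0, T]; clamping makes it measurable and bounded on all of R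
   without changing the integral. *)
have -> : \int[stieltjes (extend T x)]_(u in `[theta, t[) b u =
    \int[stieltjes (extend T x)]_(u in `[theta, t[) (b \o clamp T) u.
  apply: eq_Rintegral => u /set_mem; rewrite /= in_itv /= => /andP[tu ut].
  by rewrite clamp_id// (le_trans theta0 tu) (ltW (lt_le_trans ut tT)).
rewrite (@stieltjes_Rintegral _ _ M)//.
rewrite -unif_quantile_gt// -unif_quantile_jump//.
have mgt : measurable (q @^-1` `]t, T + 1]).
  by rewrite -[X in measurable X]setTI; exact: mq.
have meq : measurable (q @^-1` [set t]).
  by rewrite -[X in measurable X]setTI; exact: mq.
have Rindic c A : measurable A -> c * fine (unif A) = \int[@unif R]_z (c * \1_A z).
  move=> mA; rewrite RintegralZl//; last exact: integrable_indic.
  by rewrite /Rintegral integral_indic// setIT.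
have iindic c A : measurable A ->
    (@unif R).-integrable setT (EFin \o (fun z => c * \1_A z)).
  move=> mA; apply: (@bounded_unif_integrable _ `|c|).
    by apply: measurable_funM => //; exact: measurable_indic.
  by move=> z; rewrite normrM ler_piMr// indicE; case: (_ \in _); rewrite ?normr1 ?normr0.
rewrite !Rindic//.
have ib : (@unif R).-integrable setT
    (EFin \o (fun z => (b \o clamp T) (q z) * \1_`[theta, t[ (q z))).
  apply: (@bounded_unif_integrable _ M).
    apply: measurable_funM; first exact: measurableT_comp.
    apply: (@measurableT_comp _ _ _ R R R (\1_(`[theta, t[%classic : set R) : R -> R) setT q) => //.
  move=> z; rewrite normrM indicE; case: (_ \in _); rewrite ?normr1 ?mulr1//.
  by rewrite normr0 mulr0 (le_trans _ (bM' (q z))).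
rewrite -RintegralD//; [|exact: iindic].
rewrite -RintegralD//; [|exact: integrableD (iindic _ _ _) ib|exact: iindic].
apply: eq_Rintegral => z _; rewrite /switch !indicE.
have /andP[q0 qT] := quantile_itv T0 x z; rewrite -/q in q0 qT.
have -> : (z \in q @^-1` `]t, T + 1]) = (t < q z).
  by apply/idP/idP => [/set_mem|tq]; rewrite ?inE /= in_itv /= ?tq ?(le_trans qT) ?lerDl// => /andP[].
have -> : (z \in q @^-1` [set t]) = (t == q z).
  by apply/idP/eqP => [/set_mem/= ->//|->]; rewrite inE.
have -> : (q z \in `[theta, t[%classic) = (theta <= q z < t) :> bool.
  by apply/idP/idP; rewrite inE /= in_itv.
rewrite /= clamp_id ?q0//.
have [qtheta|thetaq] := ltP (q z) theta.
  have qt := lt_le_trans qtheta thetat.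
  by rewrite ltNge (ltW qt) eq_sym (lt_eqF qt) /= !mulr0 !addr0.
case: (ltgtP t (q z)) => [tq|qt|->] /=; rewrite ?mulr1 ?mulr0 ?addr0 ?add0r//.
Qed.

End PathPayoff.

(** * Expected payoffs *)

(** Dynkin's pi-lambda argument from rectangles. The event E lets the lemma be applied twice, to
    three independent components. *)
Lemma product_law_extends {R : realType} {d d1 d2} {Omega : measurableType d}
  {T1 : measurableType d1} {T2 : measurableType d2} (P : probability Omega R)
  (P1 : probability T1 R) (P2 : probability T2 R) (Phi : Omega -> T1 * T2)
  (E : set Omega) :
  measurable E -> measurable_fun setT Phi ->
  (forall A B, measurable A -> measurable B ->
    P (E `&` Phi @^-1` (A `*` B)) = P E * (P1 A * P2 B))%E ->
  forall C, measurable C -> P (E `&` Phi @^-1` C) = (P E * (P1 \x P2)%E C)%E.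
Proof.
move=> mE mPhi rect.
have mpre C : measurable C -> measurable (Phi @^-1` C).
  by move=> mC; rewrite -[X in measurable X]setTI; exact: mPhi.
have fE : P E \is a fin_num by exact: fin_num_measure.
have prodE A B : measurable A -> measurable B ->
    (P1 \x P2)%E (A `*` B) = (P1 A * P2 B)%E by exact: product_measure1E.
rewrite measurable_prod_measurableType.
apply: dynkin_induction => /=.
- by rewrite measurable_prod_measurableType.
- move=> _ _ [A1 mA1 [A2 mA2 <-]] [B1 mB1 [B2 mB2 <-]].
  exists (A1 `&` B1); first exact: measurableI.
  by exists (A2 `&` B2); [exact: measurableI|rewrite setXI].
- by rewrite -setXTT rect// prodE.
- by move=> _ [A mA [B mB <-]]; rewrite rect// prodE.
- move=> C mC PC; rewrite preimage_setC -setDE measureD//; last 2 first.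
  + exact: mpre.
  + by apply: (le_lt_trans (probability_le1 _ _)); rewrite ?ltry.
  rewrite [X in (_ - X)%E]PC.
  have -> : ((P1 \x P2)%E (~` C) = 1 - (P1 \x P2)%E C)%E.
    exact: (probability_setC (P1 \x P2)%E).
  have aux (a b : \bar R) : a \is a fin_num -> (a - a * b = a * (1 - b))%E.
    by move=> fa; rewrite (muleBr fa) ?mule1//; case: b.
  exact: aux.
- move=> F mF tF PF; rewrite preimage_bigcup setI_bigcupr.
  have mEF n : measurable (E `&` Phi @^-1` F n).
    by apply: measurableI => //; exact: mpre.
  rewrite measure_bigcup//; last first.
    apply/trivIsetP => i j _ _ ij; rewrite setIACA setIid -preimage_setI.
    by move/trivIsetP : tF => /(_ _ _ I I ij) ->; rewrite preimage_set0 setI0.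
  rewrite (eq_eseriesr (fun n _ => PF n)) -(fineK fE) nneseriesZl; last first.
    by move=> n _; exact: (measure_ge0 (P1 \x P2)%E).
  congr (_ * _)%E; apply/esym.
  exact: (measure_bigcup (P1 \x P2)%E setT F (fun n _ => mF n) tF).
Qed.

Lemma ae_measurable {R : realType} {d} {Omega : measurableType d}
  (P : probability Omega R) (U V : Omega -> R) : measure_is_complete P ->
  measurable_fun setT U -> {ae P, forall w, V w = U w} -> measurable_fun setT V.
Proof.
move=> cP mU VU _ Y mY; rewrite setTI.
set N := ~` [set w | V w = U w].
have N0 : P.-negligible N by exact: VU.
rewrite (_ : V @^-1` Y = (U @^-1` Y `\` N) `|` (V @^-1` Y `&` N)).
  apply: measurableU.
    by apply: measurableD; [rewrite -[X in measurable X]setTI; exact: mU|exact: cP].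
  by apply: cP; apply: negligibleS N0; exact: subIsetr.
apply/seteqP; split=> w /=.
  have [VUw|VUw] := pselect (V w = U w); last by right.
  by rewrite VUw; left; split=> //; exact.
by move=> [[UY /contrapT VUw]|[]//]; rewrite VUw.
Qed.

Lemma ae_integrable {R : realType} {d} {Omega : measurableType d}
  (P : probability Omega R) (U V : Omega -> R) : measure_is_complete P ->
  P.-integrable setT (EFin \o U) -> {ae P, forall w, V w = U w} ->
  P.-integrable setT (EFin \o V).
Proof.
move=> cP iU VU; have /integrableP[mU Uoo] := iU.
have mV : measurable_fun setT (EFin \o V).
  by apply/measurable_EFinP; apply: ae_measurable VU => //; exact/measurable_EFinP.
apply/integrableP; split=> //.
rewrite (@ae_eq_integral _ _ _ P setT (abse \o (EFin \o U)))//.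
- exact: measurableT_comp.
- exact: measurableT_comp.
- by apply: filterS VU => w /= -> _.
Qed.

Lemma sigma_algebra_setT {T} (G : set (set T)) : sigma_algebra setT G -> G setT.
Proof. by move=> [G0 GC _]; rewrite -(setD0 setT); exact: GC. Qed.

Section FubiniBounded.
Context {R : realType} {d d'} {S : measurableType d} {S' : measurableType d'}.
Variables (m : probability S R) (m' : probability S' R) (k : S * S' -> R) (B : S -> \bar R).
Hypotheses (mk : measurable_fun setT k) (iB : m.-integrable setT B)
  (kB : forall w z, (`|k (w, z)|%:E <= B w)%E).

(** The dominating function depends on the first variable only and m' has mass 1, so Tonelli reduces
    its integral to that of B. *)
Lemma bounded_integrable_product : (m \x m')%E.-integrable setT (EFin \o k).
Proof.
have mB := measurable_int _ iB.
apply: (@le_integrable _ _ _ _ _ measurableT _ (B \o fst)).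
- exact/measurable_EFinP.
- move=> [w z] _ /=; rewrite gee0_abs; last first.
    by apply: le_trans (kB w z); rewrite lee_fin.
  exact: kB.
- apply/integrableP; split; first exact: (measurableT_comp mB measurable_fst).
  rewrite fubini_tonelli1//.
    rewrite /fubini_F /= (eq_integral (fun w => `|B w|)%E); last first.
      move=> w _; rewrite integral_cst//.
      by rewrite [X in (_ * X)%E](probability_setT m') mule1.
    by have /integrableP[] := iB.
  by apply: measurableT_comp => //; exact: (measurableT_comp mB measurable_fst).
Qed.

Let U w := \int[m']_z k (w, z).

Lemma measurable_bounded_section : measurable_fun setT U.
Proof.
rewrite (_ : U = fine \o fubini_F m' (EFin \o k))//.
apply: measurableT_comp; first exact: fine_measurable.
exact: measurable_int (integrable_fubini_F bounded_integrable_product).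
Qed.

Lemma integrable_bounded_section : m.-integrable setT (EFin \o U).
Proof.
apply: (le_integrable measurableT _ _
  (integrable_fubini_F bounded_integrable_product)).
  by apply/measurable_EFinP; exact: measurable_bounded_section.
move=> w _ /=; rewrite /U /Rintegral /fubini_F /=.
by case: (integral _ _ _) => [r| |] //=; rewrite ?normr0 ?leey.
Qed.

(** The real-valued section integral [U] and the extended one differ only where the latter is
    infinite, which is a null event. *)
Lemma integral_bounded_section :
  (\int[m]_w (U w)%:E = \int[m \x m']_p (k p)%:E)%E.
Proof.
rewrite -integral12_prod_meas1; last exact: bounded_integrable_product.
apply: ae_eq_integral => //.
- by apply/measurable_EFinP; exact: measurable_bounded_section.
- exact: measurable_int (integrable_fubini_F bounded_integrable_product).
- have := integrable_ae measurableT (integrable_fubini_F bounded_integrable_product).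
  apply: filterS => w /(_ I) fw _ /=.
  by rewrite /U /Rintegral fineK.
Qed.

End FubiniBounded.

Section Payoffs.
Context {R : realType} {d : measure_display} {Omega : measurableType d}.
Variables (P : probability Omega R) (T : R) (F : R -> set (set Omega)).
Hypotheses (T0 : 0 < T) (cP : measure_is_complete P)
  (cF : complete_right_continuous_filtration P T F).

Let fF := complete_filtration cF.
Let TT : 0 <= T <= T. Proof. by rewrite lexx ltW. Qed.
Let sFT : sigma_algebra setT (F T) := fF.1 T TT.
Let mFT : F T `<=` measurable := filtration_sub_measurable cF TT.

(** Omega carries the final sigma-algebra here: adapted càdlàg processes are jointly measurable for
    it, and it is the one of which the devices are independent. *)
Definition final_space : measurableType _ := g_sigma_algebraType (F T).
Local Notation S := final_space.

Definition final_prob : probability S R := sub_prob P sFT mFT.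

Lemma final_integral (f : Omega -> \bar R) : measurable_fun setT (f : S -> \bar R) ->
  (\int[final_prob]_w f w = \int[P]_w f w)%E.
Proof.
by move=> mf; apply: sub_integral => //; exact: sigma_algebra_setT.
Qed.

Lemma final_integrable (f : Omega -> \bar R) : measurable_fun setT (f : S -> \bar R) ->
  final_prob.-integrable setT f <-> P.-integrable setT f.
Proof. by move=> mf; exact: sub_integrable. Qed.

Lemma final_measurable d' (Y : measurableType d') (f : Omega -> Y) :
  measurable_fun setT (f : S -> Y) -> measurable_fun setT f.
Proof.
move=> mf _ B mB; apply: mFT; rewrite -(sub_measurableE sFT).
exact: mf.
Qed.

Variables (a b h rho : R -> Omega -> R).
Hypotheses (a_Lb : Lb P T a) (b_Lb : Lb P T b) (h_Lb : Lb P T h)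
  (a_adapted : adapted T F a) (b_adapted : adapted T F b)
  (h_adapted : adapted T F h) (grho : generating_process T F rho).

Let pa : progressive T F a.
Proof. by case: a_Lb => ca _ _; exact: cadlag_progressive. Qed.
Let pb : progressive T F b.
Proof. by case: b_Lb => cb _ _; exact: cadlag_progressive. Qed.
Let ph : progressive T F h.
Proof. by case: h_Lb => ch _ _; exact: cadlag_progressive. Qed.
Let b_path_measurable w : measurable_fun setT ((b ^~ w) \o clamp T).
Proof.
apply: (progressive_at (u := clamp T) (v := cst (w : S)) pb TT).
- by move=> u; exact: clamp_itv (ltW T0).
- exact: measurable_clamp.
- exact: measurable_cst.
Qed.
Let drho w : distribution_path T (rho ^~ w).
Proof. exact: generating_distribution_path grho. Qed.

Definition payoff_bound (w : Omega) : \bar R :=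
  (running_sup T a w + running_sup T b w + running_sup T h w)%E.

Lemma measurable_payoff_bound : measurable_fun setT (payoff_bound : S -> \bar R).
Proof.
have [ca _ _] := a_Lb; have [cb _ _] := b_Lb; have [ch _ _] := h_Lb.
by apply: emeasurable_funD; [apply: emeasurable_funD|];
   exact: (measurable_running_sup T0 cF).
Qed.

Lemma integrable_payoff_bound : P.-integrable setT payoff_bound.
Proof.
by apply: integrableD => //; [apply: integrableD => //|];
   exact: (integrable_running_sup T0 cF).
Qed.

Lemma payoff_bound_fin : {ae P, forall w, payoff_bound w \is a fin_num}.
Proof.
by apply: filterS (integrable_ae measurableT integrable_payoff_bound) => w; exact.
Qed.

Definition switched (w : Omega) (t u : R) : R :=
  switch (a ^~ w) (b ^~ w) (h ^~ w) t u.

Lemma switched_bound w t u : 0 <= t <= T -> 0 <= u <= T ->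
  (`|switched w t u|%:E <= payoff_bound w)%E.
Proof.
move=> tT uT; rewrite /switched /switch /payoff_bound.
have a0 := running_sup_ge0 T0 a w; have b0 := running_sup_ge0 T0 b w.
have h0 := running_sup_ge0 T0 h w.
case: ifPn => _; last case: ifPn => _.
- by rewrite -addeA (le_trans (le_running_sup a w tT))// leeDl// adde_ge0.
- by rewrite (le_trans (le_running_sup h w tT))// leeDr// adde_ge0.
- by rewrite addeAC (le_trans (le_running_sup b w uT))// leeDr// adde_ge0.
Qed.

Lemma measurable_switched d' (D : measurableType d') (v : D -> S) (t u : D -> R) :
  measurable_fun setT v -> measurable_fun setT t -> measurable_fun setT u ->
  (forall p, 0 <= t p <= T) -> (forall p, 0 <= u p <= T) ->
  measurable_fun setT (fun p => switched (v p) (t p) (u p)).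
Proof.
move=> mv mt mu tT uT; rewrite /switched /switch.
apply: measurable_fun_ifT; first exact: measurable_fun_ltr.
  exact: (progressive_at pa TT).
apply: measurable_fun_ifT; first exact: measurable_fun_eqr.
  exact: (progressive_at ph TT).
exact: (progressive_at pb TT).
Qed.

Definition rho_quantile (w : Omega) (z : R) : R := quantile T (rho ^~ w) z.

Lemma rho_quantile_itv w z : 0 <= rho_quantile w z <= T.
Proof. exact: quantile_itv. Qed.

Lemma measurable_rho_quantile d' (D : measurableType d') (v : D -> S) (z : D -> R) :
  measurable_fun setT v -> measurable_fun setT z ->
  measurable_fun setT (fun p => rho_quantile (v p) (z p)).
Proof.
move=> mv mz; apply: (measurable_quantile T0 (x := fun p => rho ^~ (v p))) => //.
move=> t /andP[t0 tT]; have [arho _ _ _ _] := grho.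
exact: (measurableT_comp (adapted_later fF arho t0 tT (lexx T)) mv).
Qed.

Definition payoff_kernel (theta tau : Omega -> R) (p : S * R) : R :=
  if rho_quantile p.1 p.2 < theta p.1 then 0
  else switched p.1 (tau p.1) (rho_quantile p.1 p.2).

Section TwoTimes.
Variables theta tau : Omega -> R.
Hypotheses (mtheta : measurable_fun setT (theta : S -> R))
  (mtau : measurable_fun setT (tau : S -> R))
  (theta0 : forall w, 0 <= theta w) (theta_tau : forall w, theta w <= tau w)
  (tauT : forall w, tau w <= T).

Let tau_itv w : 0 <= tau w <= T.
Proof. by rewrite tauT (le_trans (theta0 w)). Qed.

Lemma measurable_payoff_kernel : measurable_fun setT (payoff_kernel theta tau).
Proof.
have mq : measurable_fun setT (fun p : S * R => rho_quantile p.1 p.2).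
  by apply: measurable_rho_quantile; [exact: measurable_fst|exact: measurable_snd].
apply: measurable_fun_ifT.
- by apply: measurable_fun_ltr => //; exact: (measurableT_comp mtheta measurable_fst).
- exact: measurable_cst.
- apply: measurable_switched => //.
  + exact: (measurableT_comp mtau measurable_fst).
  + by move=> p; exact: rho_quantile_itv.
Qed.

Lemma payoff_kernel_bound w z : (`|payoff_kernel theta tau (w, z)|%:E <= payoff_bound w)%E.
Proof.
rewrite /payoff_kernel; case: ifPn => _; last exact/switched_bound/rho_quantile_itv.
by rewrite normr0 !adde_ge0//; exact: running_sup_ge0.
Qed.

Lemma stopping_payoff_kernel w : payoff_bound w \is a fin_num ->
  stopping_payoff T a b h rho theta tau w =
  \int[@unif R]_z payoff_kernel theta tau (w, z).
Proof.
move=> fw; rewrite /stopping_payoff /stieltjes_integral /jump.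
apply: (path_payoff T0 (drho w) (M := fine (payoff_bound w)) (a ^~ w) (h ^~ w)) => //.
move=> u uT; rewrite -lee_fin fineK//.
apply: le_trans (le_running_sup b w uT) _; rewrite /payoff_bound addeAC leeDr//.
by rewrite adde_ge0//; exact: running_sup_ge0.
Qed.

Lemma stopping_payoff_ae : {ae P, forall w,
  stopping_payoff T a b h rho theta tau w =
  \int[@unif R]_z payoff_kernel theta tau (w, z)}.
Proof. by apply: filterS payoff_bound_fin => w; exact: stopping_payoff_kernel. Qed.

Let iB : final_prob.-integrable setT payoff_bound.
Proof.
apply/final_integrable; first exact: measurable_payoff_bound.
exact: integrable_payoff_bound.
Qed.

Lemma integrable_stopping_payoff :
  P.-integrable setT (EFin \o stopping_payoff T a b h rho theta tau).
Proof.
have mk := measurable_payoff_kernel.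
have mU := measurable_bounded_section (@unif R) mk iB payoff_kernel_bound.
have iU : P.-integrable setT (EFin \o (fun w => \int[@unif R]_z payoff_kernel theta tau (w, z))).
  apply/final_integrable; first exact/measurable_EFinP.
  exact: (integrable_bounded_section (@unif R) mk iB payoff_kernel_bound).
exact: (ae_integrable cP iU stopping_payoff_ae).
Qed.

Lemma integral_stopping_payoff :
  (\int[P]_w (stopping_payoff T a b h rho theta tau w)%:E =
   \int[final_prob \x @unif R]_p (payoff_kernel theta tau p)%:E)%E.
Proof.
have mk := measurable_payoff_kernel.
have mU := measurable_bounded_section (@unif R) mk iB payoff_kernel_bound.
rewrite -(integral_bounded_section (@unif R) mk iB payoff_kernel_bound).
rewrite final_integral; last exact/measurable_EFinP.
apply: ae_eq_integral => //.
- exact: measurable_int integrable_stopping_payoff.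
- by apply/measurable_EFinP; exact: final_measurable mU.
- by apply: filterS stopping_payoff_ae => w -> _.
Qed.

End TwoTimes.

(** Once all three terms are means over the opponent's level, the identity holds level by level: a
    stop before theta is counted in the past, any other in the payoff from theta on. *)
Lemma stopping_payoff_split (theta tau : Omega -> R) :
  measurable_fun setT (theta : S -> R) -> measurable_fun setT (tau : S -> R) ->
  (forall w, 0 <= theta w) -> (forall w, theta w <= tau w) ->
  (forall w, tau w <= T) ->
  {ae P, forall w, stopping_payoff T a b h rho (cst 0) tau w =
    at_time (integral_process T b rho) theta w +
    stopping_payoff T a b h rho theta tau w}.
Proof.
move=> mtheta mtau theta0 theta_tau tauT.
apply: filterS payoff_bound_fin => w fw.
have tau0 w' : 0 <= tau w' by rewrite (le_trans (theta0 w')).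
rewrite (stopping_payoff_kernel (theta := cst 0))//.
rewrite (stopping_payoff_kernel (theta := theta))//.
have mb : measurable_fun setT ((b ^~ w) \o clamp T).
  exact: b_path_measurable.
have bM u : 0 <= u <= T -> `|b u w| <= fine (payoff_bound w).
  move=> uT; rewrite -lee_fin fineK//.
  apply: le_trans (le_running_sup b w uT) _; rewrite /payoff_bound addeAC leeDr//.
  by rewrite adde_ge0//; exact: running_sup_ge0.
(* With a = h = 0 and own time theta, the formula represents the past integral over [[0, theta[]. *)
have := path_payoff T0 (drho w) (cst 0) (cst 0) (lexx 0) (theta0 w)
  (le_trans (theta_tau w) (tauT w)) mb bM.
rewrite /= !mul0r add0r addr0 /at_time /integral_process /stieltjes_integral => ->.
have ik (tht : Omega -> R) : measurable_fun setT (tht : S -> R) -> (forall w, 0 <= tht w) ->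
    (forall w, tht w <= tau w) ->
    (@unif R).-integrable setT (EFin \o (fun z => payoff_kernel tht tau (w, z))).
  move=> mtht tht0 tht_tau.
  apply: (@bounded_unif_integrable _ _ (fine (payoff_bound w))).
    exact: (measurableT_comp (measurable_payoff_kernel mtht mtau tht0 tht_tau tauT)
      (pair1_measurable (w : S))).
  by move=> z; rewrite -lee_fin fineK//; exact: payoff_kernel_bound.
apply/eqP; rewrite -subr_eq; apply/eqP.
rewrite -RintegralB//; [|exact: ik|exact: ik].
apply: eq_Rintegral => z _; rewrite /payoff_kernel /= -/(rho_quantile w z).
have /andP[q0 _] := rho_quantile_itv w z; rewrite !ltNge q0 /=.
rewrite /switched /switch.
case: (leP (theta w) (rho_quantile w z)) => /= [tq|qt].
  rewrite subrr; case: ifP => // /negbT; rewrite -leNgt => qt.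
  by rewrite eq_le tq qt.
have qtau : rho_quantile w z < tau w by rewrite (lt_le_trans qt).
rewrite subr0 !ltNge (ltW qtau) (ltW qt) /=.
by rewrite (gt_eqF qtau) (gt_eqF qt).
Qed.

(** The past is the difference of two integrable payoffs of the constant time T, counted from 0 and
    from theta. *)
Lemma integrable_integral_process (theta : Omega -> R) :
  measurable_fun setT (theta : S -> R) -> (forall w, 0 <= theta w <= T) ->
  P.-integrable setT (EFin \o at_time (integral_process T b rho) theta).
Proof.
move=> mtheta thetaT.
have theta0 w : 0 <= theta w by have /andP[] := thetaT w.
have thetaT' w : theta w <= T by have /andP[] := thetaT w.
have i0 := integrable_stopping_payoff (theta := cst 0) (tau := cst T)
  (measurable_cst _) (measurable_cst _) (fun=> lexx 0) (fun=> ltW T0) (fun=> lexx T).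
have i1 := integrable_stopping_payoff (theta := theta) (tau := cst T)
  mtheta (measurable_cst _) theta0 thetaT' (fun=> lexx T).
have := stopping_payoff_split mtheta (measurable_cst T) theta0 thetaT' (fun=> lexx T).
move=> split_ae; apply: (ae_integrable cP (integrableB measurableT i0 i1)).
by apply: filterS split_ae => w ->; rewrite addrK.
Qed.

End Payoffs.

Lemma law_transfer (R : realType) (d d1 d2 : measure_display)
  (X : measurableType d) (T1 : measurableType d1) (T2 : measurableType d2)
  (mu : {measure set X -> \bar R}) (P1 : probability T1 R) (P2 : probability T2 R)
  (phi : X -> T1 * T2) (u : T1 * T2 -> \bar R) (l : T1 -> R) :
  measurable_fun setT phi ->
  (forall C, measurable C -> mu (phi @^-1` C) = (P1 \x P2)%E C) ->
  measurable_fun setT u -> mu.-integrable setT (u \o phi) ->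
  (forall z, fubini_F P2 u z = (l z)%:E) ->
  P1.-integrable setT (EFin \o l) /\
  (\int[P1]_z (l z)%:E = \int[mu]_x u (phi x))%E.
Proof.
move=> mphi lawE mu_ iu lE.
have eI v : (\int[P1 \x P2]_y v y = \int[pushforward mu phi]_y v y)%E.
  by apply: eq_measure_integral => C mC _; symmetry; exact: lawE.
have ipu : (P1 \x P2)%E.-integrable setT u.
  have /integrableP[_ oo] := integrable_pushforward mphi mu_ iu measurableT.
  by apply/integrableP; split=> //; rewrite eI.
split; first by have := integrable_fubini_F ipu; congr integrable; exact/funext.
rewrite -(eq_integral _ _ (fun z _ => lE z)) integral12_prod_meas1//.
by rewrite eI integral_pushforward.
Qed.

Section ExpectedPayoff.
Context {R : realType} {d : measure_display} {Omega : measurableType d}.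
Variables (P : probability Omega R) (T : R) (F : R -> set (set Omega)).
Hypotheses (T0 : 0 < T) (cP : measure_is_complete P)
  (cF : complete_right_continuous_filtration P T F).
Variables (a b h rho rho' : R -> Omega -> R).
Hypotheses (a_Lb : Lb P T a) (b_Lb : Lb P T b) (h_Lb : Lb P T h)
  (a_adapted : adapted T F a) (b_adapted : adapted T F b)
  (h_adapted : adapted T F h) (grho : generating_process T F rho)
  (grho' : generating_process T F rho').

Let fF := complete_filtration cF.
Let TT : 0 <= T <= T. Proof. by rewrite lexx ltW. Qed.
Let sFT : sigma_algebra setT (F T) := fF.1 T TT.
Let mFT : F T `<=` measurable := filtration_sub_measurable cF TT.
Local Notation S := (final_space T F).
Let PT : probability S R := final_prob T0 cF.

Definition level_payoff (z : R) : R :=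
  \int[P]_w stopping_payoff T a b h rho (cst 0) (randomised_time T rho' (cst z)) w.

Variables Z' Z : Omega -> R.
Hypothesis devices : randomisation_devices P (F T) Z' Z.

(** The own level comes first and the pair of chance and opponent's level second, so that the inner
    Fubini integral is the payoff of a pure time. *)
Let K (p : R * (S * R)) : R :=
  switched a b h p.2.1 (quantile T (rho' ^~ p.2.1) p.1) (rho_quantile T rho p.2.1 p.2.2).
Let Phi2 (w : Omega) : S * R := (w, Z w).
Let Phi (w : Omega) : R * (S * R) := (Z' w, Phi2 w).

Let measurable_K : measurable_fun setT K.
Proof.
have msnd1 : measurable_fun setT (fun p : R * (S * R) => p.2.1).
  exact: (measurableT_comp measurable_fst measurable_snd).
apply: (measurable_switched T0 cF a_Lb b_Lb h_Lb) => //.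
- exact: (measurable_rho_quantile T0 cF grho' msnd1 measurable_fst).
- apply: (measurable_rho_quantile T0 cF grho msnd1).
  exact: (measurableT_comp measurable_snd measurable_snd).
- by move=> p; exact: quantile_itv.
- by move=> p; exact: quantile_itv.
Qed.

Let mZ' : measurable_fun setT Z'. Proof. by case: devices. Qed.
Let mZ : measurable_fun setT Z. Proof. by case: devices. Qed.

Let measurable_Phi2 : measurable_fun setT Phi2.
Proof. by apply: measurable_fun_pair => //; exact: (measurable_subid sFT mFT). Qed.

Let measurable_Phi : measurable_fun setT Phi.
Proof. by apply: measurable_fun_pair => //; exact: measurable_Phi2. Qed.

Let law2 A B : measurable A -> measurable B ->
  P (Z' @^-1` A `&` Phi2 @^-1` B) =
  (P (Z' @^-1` A) * (PT \x @unif R) B)%E.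
Proof.
move=> mA mB; have [_ _ _ Zlaw ind] := devices.
apply: product_law_extends => //.
  by rewrite -[X in measurable X]setTI; exact: mZ'.
move=> C D; rewrite /= sub_measurableE// => FC mD.
rewrite (_ : Phi2 @^-1` (C `*` D) = C `&` Z @^-1` D)//.
by rewrite setICA setIA ind// Zlaw// -muleA muleCA.
Qed.

Let law C : measurable C -> P (Phi @^-1` C) = (@unif R \x (PT \x @unif R)%E)%E C.
Proof.
move=> mC; have [_ _ Z'law _ _] := devices.
rewrite -[LHS]/(P (Phi @^-1` C)) -[Phi @^-1` C]setTI.
rewrite (product_law_extends (P1 := @unif R) (P2 := (PT \x @unif R)%E) (Phi := Phi))//.
  by rewrite probability_setT mul1e.
move=> A B mA mB; rewrite probability_setT mul1e setTI.
rewrite (_ : Phi @^-1` (A `*` B) = Z' @^-1` A `&` Phi2 @^-1` B)//.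
by rewrite law2// Z'law.
Qed.

Let integrable_KPhi : P.-integrable setT (EFin \o (K \o Phi)).
Proof.
apply: (le_integrable measurableT _ _
  (integrable_payoff_bound T0 cF a_Lb b_Lb h_Lb a_adapted b_adapted h_adapted)).
  by apply/measurable_EFinP; exact: (measurableT_comp measurable_K measurable_Phi).
move=> w _ /=; rewrite [leRHS]gee0_abs; last first.
  by rewrite !adde_ge0//; exact: running_sup_ge0.
by apply: switched_bound => //; exact: quantile_itv.
Qed.

Let fubini_K z : fubini_F (PT \x @unif R)%E (EFin \o K) z = (level_payoff z)%:E.
Proof.
have mtau : measurable_fun setT (randomised_time T rho' (cst z) : S -> R).
  apply: (measurable_rho_quantile T0 cF grho' (v := id : S -> S) (z := cst z)) => //.
have tau0 w : 0 <= randomised_time T rho' (cst z) w.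
  by have /andP[] := quantile_itv T0 (rho' ^~ w) z.
have tauT w : randomised_time T rho' (cst z) w <= T.
  by have /andP[] := quantile_itv T0 (rho' ^~ w) z.
have th0 (w : Omega) : 0 <= (cst 0 : Omega -> R) w by exact: lexx.
have mth : measurable_fun setT (cst 0 : S -> R) by exact: measurable_cst.
have ip := integrable_stopping_payoff T0 cP cF a_Lb b_Lb h_Lb a_adapted b_adapted
  h_adapted grho mth mtau th0 tau0 tauT.
rewrite /level_payoff /Rintegral fineK; last exact: integrable_fin_num ip.
rewrite (integral_stopping_payoff T0 cP cF a_Lb b_Lb h_Lb a_adapted b_adapted
  h_adapted grho mth mtau th0 tau0 tauT).
rewrite /fubini_F; apply: eq_integral => -[w z2] _ /=.
rewrite /payoff_kernel /= ltNge.
by have /andP[-> _] := rho_quantile_itv T0 rho w z2.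
Qed.

Let transfer_K := law_transfer (P1 := @unif R) (P2 := (PT \x @unif R)%E)
  measurable_Phi law ((measurable_EFinP _ _).2 measurable_K) integrable_KPhi fubini_K.

Lemma integrable_level_payoff : (@unif R).-integrable setT (EFin \o level_payoff).
Proof. exact: transfer_K.1. Qed.

(** A randomised time is a mixture of its level times, and the device is independent of everything
    else in the payoff. *)
Lemma expected_game_payoff :
  'E_P[game_payoff a b h (randomised_time T rho' Z') (randomised_time T rho Z)]%E =
  (\int[@unif R]_z level_payoff z)%:E.
Proof.
rewrite /Rintegral fineK; last exact: integrable_fin_num integrable_level_payoff.
by rewrite transfer_K.2 unlock.
Qed.

End ExpectedPayoff.

(** This symmetry lets one analysis, with payoffs a and b, serve both players. *)
Lemma game_payoffC {R : realType} {d} {Omega : measurableType d} (a b h : R -> Omega -> R)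
  (tau sigma : Omega -> R) :
  game_payoff a b h tau sigma = game_payoff b a h sigma tau.
Proof.
apply/funext => w; rewrite /game_payoff eq_sym.
by case: (ltgtP (tau w) (sigma w)) => [ts|st|->].
Qed.

(** * Optimal pure times among the level times *)

Section OptimalLevel.
Context {R : realType} {d : measure_display} {Omega : measurableType d}.
Variables (P : probability Omega R) (T : R).
Hypothesis T0 : 0 < T.

Lemma randomisation_devicesC (G : set (set Omega)) (Z1 Z2 : Omega -> R) :
  randomisation_devices P G Z1 Z2 -> randomisation_devices P G Z2 Z1.
Proof.
move=> [mZ1 mZ2 law1 law2 ind]; split=> // A B1 B2 GA mB1 mB2.
by rewrite setIAC ind// muleAC.
Qed.

Lemma generating_process_larger (F F' : R -> set (set Omega)) rho :
  (forall t, 0 <= t <= T -> F' t `<=` F t) ->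
  generating_process T F' rho -> generating_process T F rho.
Proof.
move=> FF' [arho crho ndrho rho0 rhoT]; split=> // t tT.
exact: subset_trans (arho t tT) (FF' t tT).
Qed.

Lemma stopping_time_larger (F F' : R -> set (set Omega)) theta tau :
  (forall t, 0 <= t <= T -> F' t `<=` F t) ->
  stopping_time T F' theta tau -> stopping_time T F theta tau.
Proof. by move=> FF' [? Ftau]; split=> // t tT; apply: FF' => //; exact: Ftau. Qed.

(** Optimality is stated against randomised times; a pure time competes through this generating
    process, all of whose levels in [0, 1[ give tau. *)
Definition pure_process (tau : Omega -> R) (t : R) (w : Omega) : R :=
  if tau w <= t then 1 else 0.

Lemma generating_pure_process (F : R -> set (set Omega)) tau : filtration T F ->
  stopping_time T F (cst 0) tau -> generating_process T F (pure_process tau).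
Proof.
move=> fF [tau0 Ftau]; have sF := fF.1; split.
- apply/(adaptedP _ fF) => t tT; apply: measurable_fun_ifT; last 2 first.
  + exact: measurable_cst.
  + exact: measurable_cst.
  apply: (measurable_fun_bool true) => //.
  rewrite setTI sub_measurableE//; last exact: sF.
  exact: Ftau.
- move=> w; split=> t tT.
    apply: cvg_near_cst; rewrite /pure_process; have [taut|ttau] := leP (tau w) t.
      by near=> s; rewrite (le_trans taut)//; near: s; exact: nbhs_right_ge.
    near=> s; rewrite leNgt (_ : s < tau w)//; near: s; exact: nbhs_right_lt.
  have [taut|ttau] := ltP (tau w) t.
    apply/cvg_ex; exists 1; apply: cvg_near_cst; rewrite /pure_process; near=> s.
    by rewrite ltW//; near: s; exact: nbhs_left_gt.
  apply/cvg_ex; exists 0; apply: cvg_near_cst; rewrite /pure_process; near=> s.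
  by rewrite leNgt (lt_le_trans _ ttau)//; near: s; exact: nbhs_left_lt.
- move=> w s t _ st _; rewrite /pure_process.
  by case: (leP (tau w) s) => [taus|_]; [rewrite (le_trans taus)|case: ifP].
- by move=> w; rewrite /pure_process; case: ifP.
- by move=> w; rewrite /pure_process; have /andP[_ ->] := tau0 w.
Unshelve. all: by end_near. Qed.

Lemma randomised_pure_process tau z : (forall w, 0 <= tau w <= T) -> 0 <= z < 1 ->
  randomised_time T (pure_process tau) (cst z) = tau.
Proof.
move=> tau0 /andP[z0 z1]; apply/funext => w; rewrite /randomised_time /pure_process.
have /andP[t0 tT] := tau0 w.
rewrite (_ : [set t | _] = `[tau w, T]%classic); first exact: inf_itv.
apply/seteqP; split=> t /=; rewrite in_itv /=.
  by move=> [/andP[_ ->]]; case: (leP (tau w) t) => //= _; rewrite ltNge z0.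
by move=> /andP[taut ->]; rewrite taut (le_trans t0 taut).
Qed.

Lemma ae_unif : {ae @unif R, forall y, 0 <= y < 1}.
Proof.
exists (~` `[0, 1[%classic); split; first exact: measurableC.
  rewrite unifE; last exact: measurableC.
  rewrite (_ : _ `&` _ = [set 1 : R]) ?lebesgue_measure_set1//.
  apply/seteqP; split=> y /=; rewrite !in_itv /=.
    move=> [/negP + /andP[y0 y1]]; rewrite y0 /= -leNgt => y1'.
    by apply/eqP; rewrite eq_le y1 y1'.
  by move=> ->; rewrite ltxx lexx ler01 andbF; split.
by move=> y; apply: contra_not; rewrite /= in_itv.
Qed.

(* The interval ]z, 1[ is not null for the uniform law. *)
Lemma mean_attained (l : R -> R) (c z : R) : 0 <= z < 1 ->
  (@unif R).-integrable setT (EFin \o l) ->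
  (forall y, 0 <= y < 1 -> c <= l y) -> \int[@unif R]_y l y = c ->
  exists2 y, z < y < 1 & l y = c.
Proof.
move=> /andP[z0 z1] il cl lc.
have ilc : (@unif R).-integrable setT (fun y => (l y - c)%:E).
  rewrite (_ : (fun _ => _) = ((EFin \o l) \- cst c%:E)%E)//.
  apply: integrableB => //.
  exact: finite_measure_integrable_cst.
have mlc := measurable_int _ ilc.
(* The difference l - c is nonnegative at almost every level and has mean 0, so it vanishes off a
   null set B. *)
have int0 : (\int[@unif R]_y `|(l y - c)%:E| = 0)%E.
  rewrite (ae_eq_integral (fun y => (l y - c)%:E))//.
  - rewrite -[LHS]fineK; last exact: integrable_fin_num.
    rewrite -/(Rintegral (@unif R) setT (fun y => l y - c)).
    rewrite (RintegralB (f2 := cst c))//; last exact: finite_measure_integrable_cst.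
    rewrite lc (Rintegral_cst (@unif R) measurableT c); congr (_%:E).
    suff -> : fine (@unif R setT) = 1 by rewrite mulr1 subrr.
    exact: (congr1 fine (probability_setT _)).
  - exact: measurableT_comp.
  - apply: filterS ae_unif => y y01 _; rewrite gee0_abs// lee_fin subr_ge0.
    exact: cl.
have [B [mB B0 lB]] := (ae_eq_integral_abs _ measurableT mlc).1 int0.
apply: contrapT => no.
have : (@unif R `]z, 1%R[%classic <= @unif R B)%E.
  apply: le_measure; rewrite ?inE// => y; rewrite /= in_itv /= => zy.
  apply: lB => /= /(_ I)/eqP; rewrite eqe subr_eq0 => /eqP ly; apply: no.
  by exists y.
rewrite B0 unifE// setIidl; last first.
  apply: subset_itv; rewrite bnd_simp//.
by rewrite lebesgue_measure_itv /= lte_fin z1 -EFinD lee_fin subr_le0 leNgt z1.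
Qed.

Lemma mean_attained_max (l : R -> R) (c z : R) : 0 <= z < 1 ->
  (@unif R).-integrable setT (EFin \o l) ->
  (forall y, 0 <= y < 1 -> l y <= c) -> \int[@unif R]_y l y = c ->
  exists2 y, z < y < 1 & l y = c.
Proof.
move=> z01 il lc lE; have [|y y01||y zy /oppr_inj] := @mean_attained (fun y => - l y) (- c) z z01.
- by have := integrableN il; congr integrable.
- by rewrite lerN2; exact: lc.
- by rewrite -lE /Rintegral (integralN (f := EFin \o l)) ?fineN//; exact: integrable_add_def.
- by exists y.
Qed.

Section OneOpponent.
Variables (F : R -> set (set Omega)).
Hypotheses (cP : measure_is_complete P)
  (cF : complete_right_continuous_filtration P T F).
Variables (a b h rho : R -> Omega -> R).
Hypotheses (a_Lb : Lb P T a) (b_Lb : Lb P T b) (h_Lb : Lb P T h)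
  (a_adapted : adapted T F a) (b_adapted : adapted T F b)
  (h_adapted : adapted T F h) (grho : generating_process T F rho).
Variables (F' : R -> set (set Omega)) (rho' : R -> Omega -> R) (Z' Z : Omega -> R).
Hypotheses (cF' : complete_right_continuous_filtration P T F')
  (F'F : forall t, 0 <= t <= T -> F' t `<=` F t)
  (grho' : generating_process T F' rho')
  (devices : randomisation_devices P (F T) Z' Z).

Definition expected_payoff (tau : Omega -> R) : R :=
  \int[P]_w stopping_payoff T a b h rho (cst 0) tau w.

Definition randomised_payoff (rho'' : R -> Omega -> R) : \bar R :=
  'E_P[game_payoff a b h (randomised_time T rho'' Z') (randomised_time T rho Z)].

Lemma randomised_payoff_pure tau : stopping_time T F' (cst 0) tau ->
  randomised_payoff (pure_process tau) = (expected_payoff tau)%:E.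
Proof.
move=> stau; have fF' := complete_filtration cF'.
have gpure := generating_process_larger F'F (generating_pure_process fF' stau).
rewrite /randomised_payoff (expected_game_payoff T0 cP cF a_Lb b_Lb h_Lb a_adapted
  b_adapted h_adapted grho gpure devices); congr (_%:E).
have il := integrable_level_payoff T0 cP cF a_Lb b_Lb h_Lb a_adapted
  b_adapted h_adapted grho gpure devices.
rewrite /Rintegral (ae_eq_integral (cst (expected_payoff tau)%:E))//.
- have := Rintegral_cst (@unif R) measurableT (expected_payoff tau).
  rewrite /Rintegral => ->; rewrite -[RHS]mulr1; congr (_ * _).
  exact: (congr1 fine (probability_setT _)).
- exact: measurable_int il.
- apply: filterS ae_unif => z z01 _ /=; rewrite /level_payoff.
  by rewrite randomised_pure_process//; case: stau.
Qed.

Let level_payoffE y : 0 <= y < 1 ->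
  level_payoff P T a b h rho rho' y = expected_payoff (level_time T rho' y).
Proof. by move=> /andP[_ y1]; rewrite /level_payoff /level_time y1. Qed.

Let grho'F := generating_process_larger F'F grho'.
Let il := integrable_level_payoff T0 cP cF a_Lb b_Lb h_Lb a_adapted
  b_adapted h_adapted grho grho'F devices.
Let vE : randomised_payoff rho' = _ := expected_game_payoff T0 cP cF a_Lb b_Lb h_Lb
  a_adapted b_adapted h_adapted grho grho'F devices.

Lemma optimal_level_min z :
  (forall rho'', generating_process T F' rho'' ->
    randomised_payoff rho' <= randomised_payoff rho'')%E -> 0 <= z < 1 ->
  exists2 y, z < y < 1 & forall tau, stopping_time T F' (cst 0) tau ->
    expected_payoff (level_time T rho' y) <= expected_payoff tau.
Proof.
move=> opt z01.
have le_pure tau : stopping_time T F' (cst 0) tau ->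
    \int[@unif R]_y level_payoff P T a b h rho rho' y <= expected_payoff tau.
  move=> stau; rewrite -lee_fin -vE -randomised_payoff_pure//; apply: opt.
  exact: generating_pure_process (complete_filtration cF') stau.
have [y y01|y zy1 yE] := @mean_attained _ _ z z01 il _ erefl.
  by rewrite [leRHS]level_payoffE//; apply: le_pure; exact: (level_time_stopping T0 cF' grho').
have y01 : 0 <= y < 1.
  by have [/andP[z0 _] /andP[zy ->]] := (z01, zy1); rewrite (le_trans z0 (ltW zy)).
exists y; [exact: zy1|move=> tau stau].
rewrite -[X in X <= _](level_payoffE y01) yE.
exact: le_pure.
Qed.

Lemma optimal_level_max z :
  (forall rho'', generating_process T F' rho'' ->
    randomised_payoff rho'' <= randomised_payoff rho')%E -> 0 <= z < 1 ->
  exists2 y, z < y < 1 & forall tau, stopping_time T F' (cst 0) tau ->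
    expected_payoff tau <= expected_payoff (level_time T rho' y).
Proof.
move=> opt z01.
have ge_pure tau : stopping_time T F' (cst 0) tau ->
    expected_payoff tau <= \int[@unif R]_y level_payoff P T a b h rho rho' y.
  move=> stau; rewrite -lee_fin -vE -randomised_payoff_pure//; apply: opt.
  exact: generating_pure_process (complete_filtration cF') stau.
have [y y01|y zy1 yE] := @mean_attained_max _ _ z z01 il _ erefl.
  by rewrite [leLHS]level_payoffE//; apply: ge_pure; exact: (level_time_stopping T0 cF' grho').
have y01 : 0 <= y < 1.
  by have [/andP[z0 _] /andP[zy ->]] := (z01, zy1); rewrite (le_trans z0 (ltW zy)).
exists y; [exact: zy1|move=> tau stau].
rewrite -[X in _ <= X](level_payoffE y01) yE.
exact: ge_pure.
Qed.

End OneOpponent.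

End OptimalLevel.

(** * Values at stopping times *)

Section RealIntegrals.
Context {R : realType} {d : measure_display} {Omega : measurableType d}.
Variable P : probability Omega R.
Implicit Types (U V : Omega -> R) (A B : set Omega).

Lemma ae_eq_Rintegral A U V : measurable A ->
  P.-integrable setT (EFin \o U) -> P.-integrable setT (EFin \o V) ->
  {ae P, forall w, U w = V w} -> \int[P]_(w in A) U w = \int[P]_(w in A) V w.
Proof.
move=> mA iU iV UV; congr fine; apply: ae_eq_integral => //.
- exact: measurable_funTS (measurable_int _ iU).
- exact: measurable_funTS (measurable_int _ iV).
- by apply: filterS UV => w ->.
Qed.

Lemma Rintegral_setID A B U : measurable A -> measurable B ->
  P.-integrable setT (EFin \o U) ->
  \int[P]_(w in A) U w = \int[P]_(w in A `&` B) U w + \int[P]_(w in A `\` B) U w.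
Proof.
move=> mA mB iU; rewrite -Rintegral_setU; last 1 first.
- by rewrite disj_set2E; apply/eqP; rewrite setDE setIACA setIid setICr setI0.
- by rewrite setUIDK.
- exact: measurableI.
- exact: measurableD.
- by apply: integrableS iU => //; apply: measurableU; [exact: measurableI|exact: measurableD].
Qed.

Lemma integrable_addR U V : P.-integrable setT (EFin \o U) ->
  P.-integrable setT (EFin \o V) ->
  P.-integrable setT (EFin \o (fun w => U w + V w)).
Proof. by move=> iU iV; have := integrableD measurableT iU iV; congr integrable. Qed.

Lemma integrable_subR U V : P.-integrable setT (EFin \o U) ->
  P.-integrable setT (EFin \o V) ->
  P.-integrable setT (EFin \o (fun w => U w - V w)).
Proof. by move=> iU iV; have := integrableB measurableT iU iV; congr integrable. Qed.

Lemma Rintegral_pasted A U V W : measurable A ->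
  P.-integrable setT (EFin \o V) -> P.-integrable setT (EFin \o W) ->
  (forall w, A w -> W w = U w) -> (forall w, ~ A w -> W w = V w) ->
  \int[P]_w W w - \int[P]_w V w = \int[P]_(w in A) U w - \int[P]_(w in A) V w.
Proof.
move=> mA iV iW WU WV.
rewrite (Rintegral_setID measurableT mA iW) (Rintegral_setID measurableT mA iV).
rewrite !setTI !setTD (@eq_Rintegral _ _ _ _ A U); last first.
  by move=> w; rewrite inE; exact: WU.
rewrite (@eq_Rintegral _ _ _ _ (~` A) V); last by move=> w; rewrite inE; exact: WV.
by rewrite opprD addrACA subrr addr0.
Qed.

Variable G : set (set Omega).
Hypotheses (sG : sigma_algebra setT G) (Gm : G `<=` measurable).

Lemma is_condexpD U U' V V' : is_condexp P G U V -> is_condexp P G U' V' ->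
  is_condexp P G (fun w => U w + U' w) (fun w => V w + V' w).
Proof.
move=> [iU GV iV VE] [iU' GV' iV' VE']; split.
- exact: integrable_addR.
- by apply/(measurable_wrtP sG); apply: measurable_funD; exact/(measurable_wrtP sG).
- exact: integrable_addR.
- move=> A GA; have mA := Gm GA.
  rewrite RintegralD//; [|exact: integrableS iV|exact: integrableS iV'].
  rewrite RintegralD//; [|exact: integrableS iU|exact: integrableS iU'].
  by rewrite VE// VE'.
Qed.

Lemma is_condexp_ae U U' V : P.-integrable setT (EFin \o U') ->
  {ae P, forall w, U' w = U w} -> is_condexp P G U V -> is_condexp P G U' V.
Proof.
move=> iU' UU' [iU GV iV VE]; split=> // A GA.
by rewrite VE//; symmetry; apply: ae_eq_Rintegral => //; exact: Gm.
Qed.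

End RealIntegrals.

Section StoppedSigmaAlgebra.
Context {R : realType} {d : measure_display} {Omega : measurableType d}.
Variables (T : R) (F : R -> set (set Omega)).
Hypotheses (T0 : 0 < T) (fF : filtration T F).
Implicit Types (theta tau : Omega -> R).

Let TT : 0 <= T <= T. Proof. by rewrite lexx ltW. Qed.

Lemma stopped_sigma_algebraP theta : stopping_time T F (cst 0) theta ->
  sigma_algebra setT (stopped_sigma_algebra T F theta).
Proof.
move=> [_ Ftheta]; have [sF _] := fF.
split.
- have F0 t : 0 <= t <= T -> F t set0 by move=> tT; have [] := sF t tT.
  by split=> [|t tT]; rewrite ?set0I; exact: F0.
- move=> A [FTA FA]; split; first by have [_ + _] := sF T TT; apply.
  move=> t tT; have Ft := Ftheta t tT; have FAt := FA t tT.
  rewrite (_ : _ `&` _ = [set w | theta w <= t] `\` (A `&` [set w | theta w <= t])).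
    rewrite -(sub_measurableE (sF t tT)).
    by apply: measurableD; rewrite sub_measurableE//; exact: sF.
  apply/seteqP; split=> w /=; first by move=> [[_ nA] tt]; split=> // -[].
  by move=> [tt nA]; split=> //; split=> // Aw; apply: nA.
- move=> A FA; split.
    by have [_ _] := sF T TT; apply => n; case: (FA n).
  move=> t tT; rewrite setI_bigcupl.
  by have [_ _] := sF t tT; apply => n; case: (FA n) => _; exact.
Qed.

Lemma stopped_sigma_algebra_le theta tau : stopping_time T F (cst 0) tau ->
  (forall w, theta w <= tau w) ->
  stopped_sigma_algebra T F theta `<=` stopped_sigma_algebra T F tau.
Proof.
move=> [_ Ftau] theta_tau A [FTA FA]; split=> // t tT.
rewrite (_ : _ `&` _ = (A `&` [set w | theta w <= t]) `&` [set w | tau w <= t]).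
  have sF := fF.1 t tT; rewrite -(sub_measurableE sF); apply: measurableI;
    rewrite sub_measurableE//; [exact: FA|exact: Ftau].
apply/seteqP; split=> w /=; first by move=> [Aw tt]; split=> //; split=> //; exact: le_trans tt.
by move=> [[Aw _] tt].
Qed.

Lemma stopping_time_ge0 theta tau : (forall w, 0 <= theta w) ->
  stopping_time T F theta tau -> stopping_time T F (cst 0) tau.
Proof.
move=> theta0 [theta_tau Ftau]; split=> // w.
by have /andP[t1 ->] := theta_tau w; rewrite (le_trans (theta0 w)).
Qed.

Lemma stopping_time_measurable tau : stopping_time T F (cst 0) tau ->
  measurable_fun setT (tau : g_sigma_algebraType (F T) -> R).
Proof.
move=> stau; have := stopping_time_min_measurable fF stau TT.
congr measurable_fun; apply/funext => w.
by have [/(_ w)/andP[_ tauT] _] := stau; rewrite min_r.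
Qed.

Definition paste (A : set Omega) tau1 tau2 : Omega -> R :=
  fun w => if `[< A w >] then tau1 w else tau2 w.

(** Both times come after theta, so once either has occurred by time t, so has theta, and whether A
    holds is known at t. *)
Lemma paste_stopping A theta tau1 tau2 : stopping_time T F (cst 0) theta ->
  stopped_sigma_algebra T F theta A ->
  stopping_time T F theta tau1 -> stopping_time T F theta tau2 ->
  stopping_time T F theta (paste A tau1 tau2).
Proof.
move=> stheta FA [tau1T F1] [tau2T F2]; split=> [w|t tT]; rewrite /paste.
  by case: asboolP.
have [_ [_ FD _]] := (stheta, stopped_sigma_algebraP stheta).
have [_ FAt] := FA; have [_ FDt] := FD A FA.
rewrite (_ : [set w | _] =
  ((A `&` [set w | theta w <= t]) `&` [set w | tau1 w <= t]) `|`
  (((setT `\` A) `&` [set w | theta w <= t]) `&` [set w | tau2 w <= t])).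
  have sF := fF.1 t tT; rewrite -(sub_measurableE sF); apply: measurableU;
    apply: measurableI; rewrite sub_measurableE//.
  - exact: FAt.
  - exact: F1.
  - exact: FDt.
  - exact: F2.
apply/seteqP; split=> w /=.
  case: asboolP => Aw tt; [left|right]; split=> //; split=> //.
    by have /andP[+ _] := tau1T w; move/le_trans; exact.
  by have /andP[+ _] := tau2T w; move/le_trans; exact.
by move=> [[[Aw _]]|[[[_ Aw] _]]]; case: asboolP.
Qed.

End StoppedSigmaAlgebra.

Section ValueAtStoppingTimes.
Context {R : realType} {d : measure_display} {Omega : measurableType d}.
Variables (P : probability Omega R) (T : R) (F F' : R -> set (set Omega)).
Hypotheses (T0 : 0 < T) (cP : measure_is_complete P)
  (cF : complete_right_continuous_filtration P T F)
  (cF' : complete_right_continuous_filtration P T F')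
  (F'F : forall t, 0 <= t <= T -> F' t `<=` F t).
Variables (a b h rho : R -> Omega -> R).
Hypotheses (a_Lb : Lb P T a) (b_Lb : Lb P T b) (h_Lb : Lb P T h)
  (a_adapted : adapted T F a) (b_adapted : adapted T F b)
  (h_adapted : adapted T F h) (grho : generating_process T F rho).
Variables theta tau : Omega -> R.
Hypotheses (stheta : stopping_time T F' (cst 0) theta)
  (stau : stopping_time T F' theta tau).

Let fF := complete_filtration cF.
Let fF' := complete_filtration cF'.
Let TT : 0 <= T <= T. Proof. by rewrite lexx ltW. Qed.
Local Notation G := (stopped_sigma_algebra T F' theta).
Local Notation payoff := (stopping_payoff T a b h rho theta).
Local Notation J := (expected_payoff P T a b h rho).

Let sG : sigma_algebra setT G := stopped_sigma_algebraP T0 fF' stheta.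
Let Gm : G `<=` measurable.
Proof. by move=> A [FTA _]; exact: (filtration_sub_measurable cF' TT). Qed.

Let theta0 w : 0 <= theta w. Proof. by have [/(_ w)/andP[]] := stheta. Qed.

Let mtheta : measurable_fun setT (theta : g_sigma_algebraType (F T) -> R).
Proof. exact: (stopping_time_measurable T0 fF (stopping_time_larger F'F stheta)). Qed.

Let later sigma : stopping_time T F' theta sigma ->
  [/\ measurable_fun setT (sigma : g_sigma_algebraType (F T) -> R),
      forall w, theta w <= sigma w & forall w, sigma w <= T].
Proof.
move=> ssigma; split=> [|w|w].
- apply: (stopping_time_measurable T0 fF); apply: (stopping_time_larger F'F).
  exact: stopping_time_ge0 ssigma.
- by have [/(_ w)/andP[]] := ssigma.
- by have [/(_ w)/andP[]] := ssigma.
Qed.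

Lemma integrable_later_payoff sigma : stopping_time T F' theta sigma ->
  P.-integrable setT (EFin \o payoff sigma).
Proof.
by move=> /later[msigma ts sT]; exact: (integrable_stopping_payoff T0 cP cF a_Lb b_Lb
  h_Lb a_adapted b_adapted h_adapted grho mtheta msigma theta0 ts sT).
Qed.

Lemma integrable_payoff0 sigma : stopping_time T F' theta sigma ->
  P.-integrable setT (EFin \o stopping_payoff T a b h rho (cst 0) sigma).
Proof.
move=> /later[msigma ts sT].
apply: (integrable_stopping_payoff T0 cP cF a_Lb b_Lb h_Lb a_adapted b_adapted
  h_adapted grho _ msigma _ _ sT).
- exact: measurable_cst.
- by move=> w /=.
- by move=> w /=; exact: le_trans (ts w).
Qed.

Local Notation I := (at_time (integral_process T b rho) theta).

Lemma integrable_past : P.-integrable setT (EFin \o I).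
Proof.
apply: (integrable_integral_process T0 cP cF a_Lb b_Lb h_Lb a_adapted b_adapted
  h_adapted grho mtheta) => w; rewrite theta0.
by have [/(_ w)/andP[]] := stheta.
Qed.

Let split_payoff sigma : stopping_time T F' theta sigma ->
  {ae P, forall w, stopping_payoff T a b h rho (cst 0) sigma w = I w + payoff sigma w}.
Proof.
by move=> /later[msigma ts sT]; exact: (stopping_payoff_split T0 cF a_Lb b_Lb
  h_Lb a_adapted b_adapted h_adapted grho mtheta msigma theta0 ts sT).
Qed.

Let integrable_sum sigma : stopping_time T F' theta sigma ->
  P.-integrable setT (EFin \o (fun w => I w + payoff sigma w)).
Proof.
move=> ssigma; apply: integrable_addR; first exact: integrable_past.
exact: integrable_later_payoff.
Qed.

Let expected_split sigma : stopping_time T F' theta sigma ->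
  J sigma = \int[P]_w I w + \int[P]_w payoff sigma w.
Proof.
move=> ssigma; rewrite /expected_payoff.
rewrite (ae_eq_Rintegral measurableT (integrable_payoff0 ssigma)
  (integrable_sum ssigma) (split_payoff ssigma)).
by apply: RintegralD => //; [exact: integrable_past|exact: integrable_later_payoff].
Qed.

(* Switching from tau to sigma on an event A known at theta changes the
   expected payoff by the difference of the partial integrals over A. *)
Lemma pasted_difference sigma A : stopping_time T F' theta sigma -> G A ->
  exists2 sigma', stopping_time T F' (cst 0) sigma' &
    J sigma' - J tau =
    \int[P]_(w in A) payoff sigma w - \int[P]_(w in A) payoff tau w.
Proof.
move=> ssigma GA; have mA := Gm GA.
have sp := paste_stopping T0 fF' stheta GA ssigma stau.
exists (paste A sigma tau); first exact: stopping_time_ge0 sp.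
have ip := integrable_later_payoff sp; have it := integrable_later_payoff stau.
rewrite (expected_split sp) (expected_split stau).
have cancel (x y z : R) : x + y - (x + z) = y - z by ring.
rewrite cancel.
apply: (Rintegral_pasted mA it ip) => w Aw; rewrite /stopping_payoff /paste.
  by rewrite asboolT.
by rewrite asboolF.
Qed.

Let measurable_condexp U : P.-integrable setT (EFin \o U) ->
  measurable_fun setT (condexp P G U).
Proof. by move=> /(condexpP sG Gm)[_ /(measurable_wrt_fun Gm)]. Qed.

(** By [pasted_difference], optimality compares the integrals of the two payoffs over every event of
    F_theta, hence their conditional expectations. The conditional payoff of tau is thus a lower
    bound of the family to which it belongs. *)
Lemma essinf_attained v :
  (forall sigma, stopping_time T F' (cst 0) sigma -> J tau <= J sigma) ->
  is_essinf P (conditional_payoffs P T F' a b h rho theta) v ->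
  {ae P, forall w, v w = condexp P G (payoff tau) w}.
Proof.
move=> opt [mv v_le v_ge].
have le_v : {ae P, forall w, condexp P G (payoff tau) w <= v w}.
  apply: v_ge; first exact/measurable_condexp/integrable_later_payoff.
  move=> _ [sigma ssigma <-]; apply: (condexp_le sG Gm).
  - exact: integrable_later_payoff.
  - exact: integrable_later_payoff.
  move=> A GA; have [sigma' ssigma' E] := pasted_difference ssigma GA.
  by rewrite -subr_ge0 -E subr_ge0; exact: opt.
have v_le' : {ae P, forall w, v w <= condexp P G (payoff tau) w}.
  by apply: v_le; exists tau.
by apply: filterS2 le_v v_le' => w h1 h2; apply/eqP; rewrite eq_le h1 h2.
Qed.

Lemma esssup_attained v :
  (forall sigma, stopping_time T F' (cst 0) sigma -> J sigma <= J tau) ->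
  is_esssup P (conditional_payoffs P T F' a b h rho theta) v ->
  {ae P, forall w, v w = condexp P G (payoff tau) w}.
Proof.
move=> opt [mv v_ge v_le].
have le_v : {ae P, forall w, v w <= condexp P G (payoff tau) w}.
  apply: v_le; first exact/measurable_condexp/integrable_later_payoff.
  move=> _ [sigma ssigma <-]; apply: (condexp_le sG Gm).
  - exact: integrable_later_payoff.
  - exact: integrable_later_payoff.
  move=> A GA; have [sigma' ssigma' E] := pasted_difference ssigma GA.
  by rewrite -subr_le0 -E subr_le0; exact: opt.
have v_ge' : {ae P, forall w, condexp P G (payoff tau) w <= v w}.
  by apply: v_ge; exists tau.
by apply: filterS2 le_v v_ge' => w h1 h2; apply/eqP; rewrite eq_le h1 h2.
Qed.

(** The variable conditioned on the right is the payoff counted from 0, which does not depend on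
    theta; this is what ties the values of M at different times together. *)
Lemma condexp_past_payoff :
  {ae P, forall w, condexp P G I w + condexp P G (payoff tau) w =
    condexp P G (stopping_payoff T a b h rho (cst 0) tau) w}.
Proof.
apply: (condexp_ae_unique sG Gm).
apply: (is_condexp_ae Gm (integrable_payoff0 stau) (split_payoff stau)).
apply: (is_condexpD sG Gm); first exact: (condexpP sG Gm integrable_past).
exact: (condexpP sG Gm (integrable_later_payoff stau)).
Qed.

End ValueAtStoppingTimes.

(** * Stopped processes *)

Section StoppedMartingale.
Context {R : realType} {d : measure_display} {Omega : measurableType d}.
Variables (P : probability Omega R) (T : R) (F : R -> set (set Omega)).
Hypotheses (T0 : 0 < T) (cP : measure_is_complete P)
  (cF : complete_right_continuous_filtration P T F).

Let fF := complete_filtration cF.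
Let TT : 0 <= T <= T. Proof. by rewrite lexx ltW. Qed.

Lemma adapted_ae (X Y : R -> Omega -> R) : adapted T F X ->
  {ae P, forall w t, Y t w = X t w} -> adapted T F Y.
Proof.
move=> aX YX t tT _ [B mB <-]; rewrite setTI.
pose N : set Omega := ~` [set w | forall t, Y t w = X t w].
have FN := negligible_filtration cF tT; have sF := fF.1 t tT.
have NYB : F t (N `&` Y t @^-1` B).
  by apply: FN; apply: negligibleS YX => w [].
have NN : F t N by apply: FN; exact: YX.
have XB : F t (X t @^-1` B) by apply: (aX t tT); exists B; rewrite ?setTI.
rewrite (_ : Y t @^-1` B = (X t @^-1` B `\` N) `|` (N `&` Y t @^-1` B)).
  rewrite -(sub_measurableE sF); apply: measurableU; last by rewrite sub_measurableE.
  by apply: measurableD; rewrite sub_measurableE.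
apply/seteqP; split=> w /=.
  have [Nw|Nw] := pselect (N w); first by right.
  by left; split=> //; move/contrapT : Nw => /(_ t) <-.
by move=> [[XB' /contrapT ->]|[]].
Qed.

(** Bridges the gap between F s, with respect to which the martingale property is stated, and the
    smaller sigma-algebra at min(s, tau), where M is known. *)
Lemma stopped_past (tau : Omega -> R) (s : R) (A : set Omega) :
  stopping_time T F (cst 0) tau -> 0 <= s <= T -> F s A ->
  stopped_sigma_algebra T F (fun w => Num.min s (tau w)) (A `&` [set w | s < tau w]).
Proof.
move=> [tau0 Ftau] sT FA; have [s0 sleT] := andP sT; have [sF mF] := fF.
have FAs : F s (A `&` [set w | s < tau w]).
  rewrite (_ : _ `&` _ = A `\` [set w | tau w <= s]).
    rewrite -(sub_measurableE (sF s sT)).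
    by apply: measurableD; rewrite sub_measurableE//; [exact: sF|exact: Ftau|exact: sF].
  apply/seteqP; split=> w /= [Aw]; first by rewrite ltNge => /negP.
  by move=> /negP; rewrite -ltNge.
split; first exact: (mF s T).
move=> t tT; have [t0 tleT] := andP tT; have [st|ts] := leP s t.
  rewrite (_ : _ `&` _ = A `&` [set w | s < tau w]); first exact: (mF s t).
  apply/seteqP; split=> w /=; first by case.
  by move=> [Aw stau]; split=> //; rewrite ge_min st.
rewrite (_ : _ `&` _ = set0); first by have [] := sF t tT.
apply/seteqP; split=> w //= [[Aw stau]].
by rewrite ge_min leNgt ts /= leNgt (lt_trans ts stau).
Qed.

Lemma martingale_stopped (tau U : Omega -> R) (M : R -> Omega -> R) :
  stopping_time T F (cst 0) tau -> cadlag_adapted_integrable P T F M ->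
  P.-integrable setT (EFin \o U) ->
  (forall theta, stopping_time T F (cst 0) theta -> (forall w, theta w <= tau w) ->
    {ae P, forall w, at_time M theta w =
      condexp P (stopped_sigma_algebra T F theta) U w}) ->
  martingale P T F (fun t w => stopped M tau t w - M 0 w).
Proof.
move=> stau [aM cM iM] iU MU.
have [M' pM' M'M] := cadlag_modification cF aM cM.
have T00 : 0 <= (0 : R) <= T by rewrite lexx ltW.
have stmin t : 0 <= t <= T ->
    stopping_time T F (cst 0) (fun w => Num.min t (tau w)).
  by move=> tT; apply: (stopping_time_min fF) stau; exact: stopping_time_cst.
have smt t tT := stopped_sigma_algebraP T0 fF (stmin t tT).
have mst t : stopped_sigma_algebra T F (fun w => Num.min t (tau w)) `<=` measurable.
  by move=> A [FTA _]; exact: (filtration_sub_measurable cF TT).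
have minT t w : Num.min t (tau w) <= tau w by rewrite ge_min lexx orbT.
have MUt t tT := MU _ (stmin t tT) (minT t).
have iMt t : 0 <= t <= T -> P.-integrable setT (EFin \o stopped M tau t).
  move=> tT; have [_ _ iC _] := condexpP (smt t tT) (mst t) iU.
  exact: (ae_integrable cP iC (MUt t tT)).
have aX : adapted T F (fun t w => stopped M tau t w - M 0 w).
  apply: (@adapted_ae (fun t w => stopped M' tau t w - M' 0 w)).
    apply: (progressive_adapted fF); apply: progressiveB.
      exact: progressive_stopped.
    move=> t tT; have [t0 tleT] := andP tT.
    apply: (progressive_at (u := cst 0) (v := snd) pM' tT) => //.
    by move=> p /=; rewrite lexx.
  by apply: filterS M'M => w M'Mw t; rewrite /stopped !M'Mw.
have iX t : 0 <= t <= T ->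
    P.-integrable setT (EFin \o (fun w => stopped M tau t w - M 0 w)).
  by move=> tT; apply: integrable_subR; [exact: iMt|exact: iM].
split; first split=> //.
  apply: filterS cM => w cMw; apply: (@cadlagB _ T (stopped M tau ^~ w) (cst (M 0 w))); last first.
    by split=> t _; [exact: cvg_cst|exact: is_cvg_cst].
  by apply: (cadlag_min (c := tau w) _ cMw); have [/(_ w)/andP[]] := stau.
move=> s t s0 st tT.
have sT' : 0 <= s <= T by rewrite s0 (le_trans st).
have tT' : 0 <= t <= T by rewrite (le_trans s0 st).
apply: (condexp_ae_unique (fF.1 s sT') (filtration_sub_measurable cF sT')).
split; [exact: iX|exact: aX|exact: iX|].
move=> A FA; have mA := filtration_sub_measurable cF sT' FA.
have iA V : P.-integrable setT (EFin \o V) -> P.-integrable A (EFin \o V).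
  by move=> iV; exact: integrableS iV.
have iM0 := iA _ (iM 0 T00).
rewrite (RintegralB mA (iA _ (iMt s sT')) iM0) (RintegralB mA (iA _ (iMt t tT')) iM0).
congr (_ - _).
(* Off B the process has already stopped, so its values at s and t coincide. On B the event A
   belongs to the sigma-algebra at min(s, tau), and both values have the conditional expectation of
   U there. *)
pose B := [set w | s < tau w].
have FAB := stopped_past stau sT' FA.
have mB : measurable B.
  have := stopped_past stau sT' (sigma_algebra_setT (fF.1 s sT')).
  by rewrite setTI => /(mst s).
rewrite (Rintegral_setID mA mB (iMt s sT')) (Rintegral_setID mA mB (iMt t tT')).
congr (_ + _); last first.
  apply: eq_Rintegral => w; rewrite inE /B /= => -[_ /negP]; rewrite -leNgt => taus.
  by rewrite /stopped !min_r// (le_trans taus).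
have mAB := mst s _ FAB.
have [_ _ iCs Cs] := condexpP (smt s sT') (mst s) iU.
have [_ _ iCt Ct] := condexpP (smt t tT') (mst t) iU.
rewrite (ae_eq_Rintegral mAB (iMt s sT') iCs (MUt s sT')).
rewrite (ae_eq_Rintegral mAB (iMt t tT') iCt (MUt t tT')).
rewrite Cs// Ct//.
apply: (stopped_sigma_algebra_le fF (stmin t tT') _ FAB) => w.
by rewrite le_min !ge_min st lexx !orbT.
Qed.

End StoppedMartingale.

(** * Previsibility of almost surely left-continuous processes *)

Section Previsible.
Context {R : realType} {d : measure_display} {Omega : measurableType d}.
Variables (P : probability Omega R) (T : R) (F : R -> set (set Omega)).
Hypotheses (T0 : 0 < T) (cF : complete_right_continuous_filtration P T F).

Let fF := complete_filtration cF.
Let TT : 0 <= T <= T. Proof. by rewrite lexx ltW. Qed.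

(* the previsible sigma-algebra extended from [0, T] x Omega to R x Omega *)
Let prev : set (set (R * Omega)) :=
  [set C | generated_by_processes T F (left_continuous T) (time_chance T `&` C)].

Let prevP : sigma_algebra setT prev.
Proof.
have [g0 gD gU] : sigma_algebra (time_chance T)
    (generated_by_processes T F (left_continuous T)) by exact: smallest_sigma_algebra.
split; rewrite /prev /=.
- by rewrite setI0.
- move=> A /gD; congr generated_by_processes.
  apply/seteqP; split=> p /=; first by move=> [Dp nA]; split=> //; split=> // Ap; apply: nA.
  by move=> [Dp [_ nA]]; split=> // -[].
- by move=> A gA; rewrite setI_bigcupr; exact: gU.
Qed.

Let S := g_sigma_algebraType prev.

Let previsibleE X : previsible T F X <->
  measurable_fun setT ((fun p => X p.1 p.2) : S -> R).
Proof.
rewrite -(measurable_wrtP prevP); split=> pX _ [B mB <-].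
  by rewrite setTI; apply: pX; exists B.
by have := pX _ (ex_intro2 _ _ B mB erefl); rewrite setTI.
Qed.

Let left_continuous_previsible X : adapted T F X ->
  (forall w, left_continuous T (X ^~ w)) ->
  measurable_fun setT ((fun p => X p.1 p.2) : S -> R).
Proof.
move=> aX lX; apply/previsibleE => A XA.
by apply: sub_gen_smallest; exists X.
Qed.

Let constant_previsible (A : set Omega) : (forall t, 0 <= t <= T -> F t A) ->
  measurable ([set p | A p.2] : set S).
Proof.
move=> FA; pose X (t : R) w : R := if `[< A w >] then 1 else 0.
have aX : adapted T F X.
  apply/(adaptedP _ fF) => t tT; apply: measurable_fun_ifT; last 2 first.
  - exact: measurable_cst.
  - exact: measurable_cst.
  apply: (measurable_fun_bool true) => //; rewrite setTI sub_measurableE; last exact: fF.1.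
  rewrite (_ : _ @^-1` _ = A); first exact: FA.
  by apply/seteqP; split=> w /=; [move=> /asboolP|move=> Aw; apply/asboolP].
have mX : measurable_fun setT ((fun p => X p.1 p.2) : S -> R).
  by apply: left_continuous_previsible => // w t _; exact: cvg_cst.
rewrite (_ : [set p | _] = (fun p : S => X p.1 p.2) @^-1` [set 1]).
  by rewrite -[X in measurable X]setTI; exact: mX.
apply/seteqP; split=> p; rewrite /= /X; first by move=> Ap; rewrite asboolT.
by case: asboolP => // _ /eqP; rewrite eq_sym oner_eq0.
Qed.

Let time_previsible : measurable_fun setT ((fun p => p.1) : S -> R).
Proof.
apply: (@left_continuous_previsible (fun t _ => t)).
  by move=> t tT; apply/(measurable_wrtP (fF.1 t tT)); exact: measurable_cst.
by move=> w t _; apply: cvg_at_left_filter; exact: cvg_id.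
Qed.

(* Off a null event the process is left-continuous; on that event every set
   of paths is previsible, by completeness. *)
Lemma stopped_previsible (X : R -> Omega -> R) (tau : Omega -> R) :
  optional T F X -> stopping_time T F (cst 0) tau ->
  {ae P, forall w, left_continuous T (stopped X tau ^~ w)} ->
  previsible T F (stopped X tau).
Proof.
move=> oX stau lX; set Y := stopped X tau.
pose N : set Omega := ~` [set w | left_continuous T (Y ^~ w)].
have FN A t : A `<=` N -> 0 <= t <= T -> F t A.
  by move=> AN tT; apply: (negligible_filtration cF tT); exact: negligibleS lX.
have pY : progressive T F Y.
  apply: progressive_stopped => //.
  exact: (optional_progressive fF (fun t _ => @subset_refl _ (F t)) oX).
have mkill : measurable_fun setT ((fun p => kill N Y p.1 p.2) : S -> R).
  apply: left_continuous_previsible.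
    by apply: (adapted_kill cF) => //; exact: progressive_adapted.
  move=> w; rewrite /kill; case: asboolP => [_ t _|/contrapT//]; exact: cvg_cst.
(* With the filtration of all subsets, Y is jointly measurable for Borel sets in time and arbitrary
   sets in chance. This suffices on N, all of whose subsets are in every F t. *)
pose D (t : R) : set (set Omega) := setT.
have fD : filtration T D by split.
have pYD : progressive T D Y.
  apply: (progressive_stopped fD); last by split=> //; case: stau.
  exact: (optional_progressive (F := F) fD _ oX).
have mN : measurable ([set p | N p.2] : set S).
  by apply: constant_previsible => t; exact: FN.
apply/previsibleE.
have [[w0 Nw0]|N0] := pselect (exists w, N w); last first.
  have <- : kill N Y = Y; last exact: mkill.
  apply/funext => t; apply/funext => w; rewrite /kill; case: asboolP => // Nw.
  by exfalso; apply: N0; exists w.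
(* Points off N are sent to one fixed w0, so the chance component pulls any set back to a subset of
   N, possibly joined with the complement of N; both are previsible. *)
pose phi (p : S) : R * g_sigma_algebraType (D T) :=
  (p.1, if `[< N p.2 >] then p.2 else w0).
have mphi : measurable_fun setT phi.
  apply: measurable_fun_pair; first exact: time_previsible.
  move=> _ A _; rewrite setTI.
  rewrite (_ : _ @^-1` _ = [set p : S | (N `&` A) p.2] `|`
    [set p : S | ~ N p.2 /\ A w0]); last first.
    apply/seteqP; split=> p /=; case: asboolP => Np.
    - by move=> Ap; left.
    - by move=> Ap; right.
    - by move=> [[]|[]].
    - by move=> [[]|[]].
  apply: measurableU.
    by apply: constant_previsible => t; apply: FN => w [].
  have [Aw0|Aw0] := pselect (A w0).
    rewrite (_ : [set p | _] = ~` [set p : S | N p.2]); first exact: measurableC.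
    by apply/seteqP; split=> p /= => [[]|].
  by rewrite (_ : [set p | _] = set0)//; apply/seteqP; split=> p //= [].
have mYphi : measurable_fun setT (fun p : S => Y (clamp T (phi p).1) (phi p).2).
  exact: (measurableT_comp (pYD T TT) mphi).
have mZ : measurable_fun setT (fun p : S =>
    if `[< N p.2 >] then Y (clamp T (phi p).1) (phi p).2 else kill N Y p.1 p.2).
  apply: measurable_fun_ifT => //.
  apply: (measurable_fun_bool true) => //; rewrite setTI.
  rewrite (_ : _ @^-1` _ = [set p : S | N p.2])//.
  by apply/seteqP; split=> p /=; [move=> /asboolP|move=> Np; apply/asboolP].
apply/previsibleE => _ [B mB <-].
have : (prev : set (set (R * Omega))) (setT `&` (fun p : S =>
    if `[< N p.2 >] then Y (clamp T (phi p).1) (phi p).2 else kill N Y p.1 p.2) @^-1` B).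
  by rewrite -(sub_measurableE prevP); exact: mZ.
rewrite /prev /= setTI; congr generated_by_processes.
apply/seteqP; split=> -[t w] [[/= tT _]]; rewrite /= /phi /kill /=;
  have tT' : 0 <= t <= T by move: tT; rewrite in_itv.
- by rewrite clamp_id//; case: asboolP => // Nw Bw; split.
- by rewrite clamp_id//; case: asboolP => // Nw Bw; split.
Qed.

Lemma previsibleN (X : R -> Omega -> R) :
  previsible T F X -> previsible T F (fun t w => - X t w).
Proof.
by move=> /previsibleE mX; apply/previsibleE; exact: measurable_funN.
Qed.

End Previsible.

Lemma cadlag_eq {R : realType} (T : R) (x y : R -> R) :
  (forall t, 0 <= t <= T -> x t = y t) -> cadlag T x -> cadlag T y.
Proof.
move=> xy [xr xl]; split=> t /andP[t0 tT].
  rewrite -xy ?t0 ?ltW//; apply: cvg_right_eq (xr t _); last by rewrite t0.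
  exists (T - t); first by rewrite subr_gt0.
  move=> s /andP[ts]; rewrite addrC subrK => sT; apply: xy.
  by rewrite (le_trans t0 (ltW ts)) ltW.
have /cvg_ex[l xlt] := xl t (introT andP (conj t0 tT)).
apply/cvg_ex; exists l; apply: cvg_trans xlt; apply: near_eq_cvg.
near=> s; apply: xy; apply/andP; split.
  by near: s; exact: nbhs_left_ge.
apply: le_trans tT; apply: ltW.
by near: s; exact: nbhs_left_lt.
Unshelve. all: by end_near. Qed.

Section StoppedDecomposition.
Context {R : realType} {d : measure_display} {Omega : measurableType d}.
Variables (P : probability Omega R) (T : R) (F : R -> set (set Omega)).
Hypotheses (T0 : 0 < T) (cP : measure_is_complete P)
  (cF : complete_right_continuous_filtration P T F).
Variables (V M G b rho : R -> Omega -> R) (tau U : Omega -> R).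
Hypotheses (V_semi : optional_semimartingale P T F V)
  (M_cadlag : cadlag_adapted_integrable P T F M)
  (M_def : value_plus_integral P T F b rho V M)
  (G_def : is_optional_projection P T F (integral_process T b rho) G)
  (stau : stopping_time T F (cst 0) tau)
  (G_cont : {ae P, forall w,
       {within `[0, T], continuous (stopped G tau ^~ w)} /\
       bounded_variation 0 T (stopped G tau ^~ w)})
  (iU : P.-integrable setT (EFin \o U))
  (MU : forall theta, stopping_time T F (cst 0) theta ->
    (forall w, theta w <= tau w) -> {ae P, forall w, at_time M theta w =
      condexp P (stopped_sigma_algebra T F theta) U w}).

Let fF := complete_filtration cF.
Let TT : 0 <= T <= T. Proof. by rewrite lexx ltW. Qed.
Let T00 : 0 <= (0 : R) <= T. Proof. by rewrite lexx ltW. Qed.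
Let tau0 w : 0 <= tau w. Proof. by have [/(_ w)/andP[]] := stau. Qed.

Let value_right_limit :
  {ae P, forall w t, 0 <= t < T -> cvg (V ^~ w @ t^'+)}.
Proof.
have [_ [L [A [[_ cL _] _ bvA VLA]]]] := V_semi.
apply: filterS3 cL bvA VLA => w cLw bvAw Vw t tT; have /andP[t0 tltT] := tT.
apply: (@is_cvg_right_eq _ ((L ^~ w) \+ (A ^~ w))).
  exists (T - t); first by rewrite subr_gt0.
  move=> s /andP[ts]; rewrite addrC subrK => sT; rewrite Vw//.
  by rewrite (le_trans t0 (ltW ts)) ltW.
apply: is_cvgD; last exact: bounded_variation_right_limit bvAw t tT.
by case: cLw => /(_ t tT) Lt _; apply/cvg_ex; exists (L t w).
Qed.

(* V + G - M stopped at tau vanishes at every stopping time and has right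
   limits, hence is evanescent. *)
Lemma stopped_value : {ae P, forall w t, 0 <= t <= T ->
  stopped V tau t w = stopped M tau t w - stopped G tau t w}.
Proof.
have [aM cM _] := M_cadlag; have [oV _] := V_semi; have [oG G_at] := G_def.
have [M' pM' M'M] := cadlag_modification cF aM cM.
pose D t w := stopped V tau t w - (stopped M' tau t w - stopped G tau t w).
have FF t : 0 <= t <= T -> F t `<=` F t by move=> _ A.
have pD : progressive T F D.
  have pV := optional_progressive fF FF oV; have pG := optional_progressive fF FF oG.
  by apply: progressiveB; [|apply: progressiveB]; exact: progressive_stopped.
have D0 : {ae P, forall w t, 0 <= t <= T -> D t w = 0}.
  apply: (progressive_evanescent T0 cF pD) => [theta stheta|].
    have smin := stopping_time_min fF stheta stau.
    apply: filterS3 M'M (M_def smin) (G_at _ smin) => w M'w Mw Gw.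
    rewrite /D /stopped M'w; move: Mw Gw; rewrite /at_time => -> ->.
    by rewrite addrAC subrr add0r subrr.
  apply: filterS3 cM M'M (filterI value_right_limit G_cont) => w cMw M'w [Vw [Gw _]] t tT.
  apply: (@is_cvgB _ _ _ _ _ (stopped V tau ^~ w)
    ((stopped M' tau ^~ w) \- (stopped G tau ^~ w))).
    exact: (right_limit_min (x := V ^~ w) (c := tau w) Vw tT).
  apply: is_cvgB.
    apply: (right_limit_min (x := M' ^~ w) (c := tau w) _ tT) => s sT.
    rewrite (_ : M' ^~ w = M ^~ w); last by apply/funext.
    by case: cMw => /(_ s sT) Ms _; apply/cvg_ex; exists (M s w).
  have [[+ _] _] := continuous_cadlag T0 Gw.
  by move=> /(_ t tT) Gt; apply/cvg_ex; exists (stopped G tau t w).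
apply: filterS2 D0 M'M => w D0w M'w t tT.
have := D0w t tT; rewrite /D {2}/stopped M'w => /eqP; rewrite subr_eq0 => /eqP ->.
by [].
Qed.

(** The interval [[0, 0[] is empty, so even an initial atom of d rho is absent from the integral at
    time 0. *)
Let past0 : {ae P, forall w, G 0 w = 0}.
Proof.
have [_ G_at] := G_def; have s0 := stopping_time_cst fF T00.
have sG := stopped_sigma_algebraP T0 fF s0.
have Gm : stopped_sigma_algebra T F (cst 0) `<=` measurable.
  by move=> A [FTA _]; exact: (filtration_sub_measurable cF TT).
have I0 : at_time (integral_process T b rho) (cst 0) = cst 0.
  apply/funext => w; rewrite /at_time /integral_process /stieltjes_integral /=.
  rewrite (_ : [set` _] = set0) ?Rintegral_set0//.
  by apply/seteqP; split=> u //=; rewrite in_itv /= ltNge andbN.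
have C0 : is_condexp P (stopped_sigma_algebra T F (cst 0)) (cst 0) (cst 0).
  split=> //.
  - exact: finite_measure_integrable_cst.
  - by apply/(measurable_wrtP sG); exact: measurable_cst.
  - exact: finite_measure_integrable_cst.
have := G_at _ s0; rewrite I0 => G0.
by apply: filterS2 G0 (condexp_ae_unique sG Gm C0) => w; rewrite /at_time /= => -> <-.
Qed.

Lemma stopped_value_cadlag : {ae P, forall w, cadlag T (stopped V tau ^~ w)}.
Proof.
have [_ cM _] := M_cadlag.
apply: filterS3 stopped_value cM G_cont => w Vw cMw [Gw _].
apply: (@cadlag_eq _ _ ((stopped M tau ^~ w) \- (stopped G tau ^~ w))).
  by move=> t tT; rewrite Vw.
apply: cadlagB; last by case: (continuous_cadlag T0 Gw).
exact: (cadlag_min (c := tau w) _ cMw).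
Qed.

(** Since G vanishes at time 0, V and M agree there, and V = M - G stopped at tau becomes V_0 - G +
    (M - M_0). *)
Lemma stopped_value_decomposition :
  semimartingale_decomposition P T F (stopped V tau)
    (fun t w => - stopped G tau t w) (fun t w => stopped M tau t w - M 0 w).
Proof.
have [oG _] := G_def.
have st0 X w : stopped X tau 0 w = X 0 w by rewrite /stopped min_l.
split.
- have lG : {ae P, forall w, left_continuous T (stopped G tau ^~ w)}.
    by apply: filterS G_cont => w [Gw _]; case: (continuous_cadlag T0 Gw).
  have pG := stopped_previsible T0 cF oG stau lG.
  exact: previsibleN.
- apply: filterS2 G_cont past0 => w [Gw bvG] G0; split.
  + have [cG _] := continuous_cadlag T0 Gw.
    apply: (@cadlag_eq _ _ (cst 0 \- (stopped G tau ^~ w))).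
      by move=> t _ /=; rewrite sub0r.
    by apply: cadlagB => //; split=> t _; [exact: cvg_cst|exact: is_cvg_cst].
  + exact: bounded_variationN.
  + by rewrite st0 G0 oppr0.
- exact: (martingale_stopped T0 cP cF stau M_cadlag iU MU).
- by apply: aeW => w; rewrite st0 subrr.
- apply: filterS2 stopped_value past0 => w Vw G0 t tT.
  by rewrite (Vw t tT) (Vw 0 T00) !st0 G0; ring.
Qed.

End StoppedDecomposition.

Lemma level_time_le {R : realType} {d} {Omega : measurableType d} (T : R)
  (F : R -> set (set Omega)) (rho : R -> Omega -> R) (z y : R) (w : Omega) :
  0 < T -> generating_process T F rho -> z < y < 1 ->
  level_time T rho z w <= level_time T rho y w.
Proof.
move=> T0 [_ _ _ _ rhoT] /andP[zy y1].
rewrite /level_time y1 (lt_trans zy y1) /randomised_time.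
apply: lb_le_inf; first by exists T; rewrite /= rhoT lexx ltW.
move=> t [tT yt]; apply: ge_inf; first by exists 0 => s [/andP[]].
by split=> //; exact: lt_trans yt.
Qed.

Section StoppedPlayer.
Context {R : realType} {d : measure_display} {Omega : measurableType d}.
Variables (P : probability Omega R) (T : R) (F F' : R -> set (set Omega)).
Hypotheses (T0 : 0 < T) (cP : measure_is_complete P)
  (cF : complete_right_continuous_filtration P T F)
  (cF' : complete_right_continuous_filtration P T F')
  (F'F : forall t, 0 <= t <= T -> F' t `<=` F t).
Variables (a b h rho : R -> Omega -> R).
Hypotheses (a_Lb : Lb P T a) (b_Lb : Lb P T b) (h_Lb : Lb P T h)
  (a_adapted : adapted T F a) (b_adapted : adapted T F b)
  (h_adapted : adapted T F h) (grho : generating_process T F rho).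
Variables (V M G rho' : R -> Omega -> R) (z y : R).
Hypotheses (V_semi : optional_semimartingale P T F' V)
  (M_cadlag : cadlag_adapted_integrable P T F' M)
  (M_def : value_plus_integral P T F' b rho V M)
  (G_def : is_optional_projection P T F' (integral_process T b rho) G)
  (grho' : generating_process T F' rho') (z0 : 0 <= z) (zy : z < y < 1)
  (G_cont : {ae P, forall w,
     {within `[0, T], continuous (stopped G (level_time T rho' z) ^~ w)} /\
     bounded_variation 0 T (stopped G (level_time T rho' z) ^~ w)})
  (V_attained : forall theta, stopping_time T F' (cst 0) theta ->
     stopping_time T F' theta (level_time T rho' y) ->
     {ae P, forall w, at_time V theta w =
       condexp P (stopped_sigma_algebra T F' theta)
         (stopping_payoff T a b h rho theta (level_time T rho' y)) w}).

(** Stopping happens at level z, while [V_attained] concerns the higher level y: every theta before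
    level z is also before level y, so the attained value is available throughout. *)
Lemma stopped_player :
  {ae P, forall w, cadlag T (stopped V (level_time T rho' z) ^~ w)} /\
  semimartingale_decomposition P T F' (stopped V (level_time T rho' z))
    (fun t w => - stopped G (level_time T rho' z) t w)
    (fun t w => stopped M (level_time T rho' z) t w - M 0 w).
Proof.
have [zlty y1] := andP zy.
have fF' := complete_filtration cF'.
have stau : stopping_time T F' (cst 0) (level_time T rho' z).
  by apply: (level_time_stopping T0 cF' grho'); rewrite z0 (lt_trans zlty).
have stau' : stopping_time T F' (cst 0) (level_time T rho' y).
  by apply: (level_time_stopping T0 cF' grho'); rewrite (le_trans z0 (ltW zlty)).
have later theta : (forall w, theta w <= level_time T rho' z w) ->
    stopping_time T F' theta (level_time T rho' y).
  move=> theta_tau; have [tauT Ftau] := stau'; split=> // w.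
  have /andP[_ ->] := tauT w; rewrite andbT (le_trans (theta_tau w))//.
  exact: (level_time_le w T0 grho' zy).
have iU := integrable_payoff0 T0 cP cF F'F a_Lb b_Lb h_Lb a_adapted b_adapted
  h_adapted grho (stopping_time_cst fF' (introT andP (conj (lexx 0) (ltW T0)))) stau'.
have MU theta : stopping_time T F' (cst 0) theta ->
    (forall w, theta w <= level_time T rho' z w) ->
    {ae P, forall w, at_time M theta w = condexp P (stopped_sigma_algebra T F' theta)
      (stopping_payoff T a b h rho (cst 0) (level_time T rho' y)) w}.
  move=> stheta theta_tau; have slater := later _ theta_tau.
  have past := condexp_past_payoff T0 cP cF cF' F'F a_Lb b_Lb h_Lb a_adapted
    b_adapted h_adapted grho stheta slater.
  by apply: filterS3 (M_def stheta) (V_attained stheta slater) past => w -> ->.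
split.
  exact: (stopped_value_cadlag T0 cF' V_semi M_cadlag M_def G_def stau G_cont).
exact: (stopped_value_decomposition T0 cP cF' V_semi M_cadlag M_def G_def stau
  G_cont iU MU).
Qed.

End StoppedPlayer.

Theorem corollary3p19 (R : realType) (d : measure_display)
  (Omega : measurableType d) (P : probability Omega R) (T : R)
  (F F1 F2 : R -> set (set Omega)) (f g h : R -> Omega -> R)
  (xi zeta V1 V2 M0 N0 G1 G2 : R -> Omega -> R)
  (T_gt0 : 0 < T)
  (P_complete : measure_is_complete P)
  (filtF : complete_right_continuous_filtration P T F)
  (FT_proper : F T `<` measurable)
  (filtF1 : complete_right_continuous_filtration P T F1)
  (filtF2 : complete_right_continuous_filtration P T F2)
  (F12_sub : forall t, 0 <= t <= T -> <<s F1 t `|` F2 t >> `<=` F t)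
  (f_Lb : Lb P T f) (g_Lb : Lb P T g) (h_Lb : Lb P T h)
  (f_adapted : adapted T F f) (g_adapted : adapted T F g)
  (h_adapted : adapted T F h)
  (fhg : {ae P, forall w, forall t, 0 <= t <= T ->
                  g t w <= h t w /\ h t w <= f t w})
  (optimal : optimal_pair P T (F T) F1 F2 f g h xi zeta)
  (V1_def : essinf_value_process P T F1 f g h zeta V1)
  (V2_def : esssup_value_process P T F2 g f h xi V2)
  (M0_sub : submartingale P T F1 M0)
  (M0_def : value_plus_integral P T F1 g zeta V1 M0)
  (N0_super : supermartingale P T F2 N0)
  (N0_def : value_plus_integral P T F2 f xi V2 N0)
  (G1_def : is_optional_projection P T F1 (integral_process T g zeta) G1)
  (G2_def : is_optional_projection P T F2 (integral_process T f xi) G2)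
  (G1_cont : forall z, 0 <= z <= 1 ->
     {ae P, forall w,
       {within `[0, T], continuous (stopped G1 (level_time T xi z) ^~ w)} /\
       bounded_variation 0 T (stopped G1 (level_time T xi z) ^~ w)})
  (G2_cont : forall z, 0 <= z <= 1 ->
     {ae P, forall w,
       {within `[0, T], continuous (stopped G2 (level_time T zeta z) ^~ w)} /\
       bounded_variation 0 T (stopped G2 (level_time T zeta z) ^~ w)}) :
  forall z, 0 <= z < 1 ->
    let tau := level_time T xi z in
    let sigma := level_time T zeta z in
    [/\ {ae P, forall w, cadlag T (stopped V1 tau ^~ w)},
        {ae P, forall w, cadlag T (stopped V2 sigma ^~ w)},
        semimartingale_decomposition P T F1 (stopped V1 tau)
          (fun t w => - stopped G1 tau t w)
          (fun t w => stopped M0 tau t w - M0 0 w) &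
        semimartingale_decomposition P T F2 (stopped V2 sigma)
          (fun t w => - stopped G2 sigma t w)
          (fun t w => stopped N0 sigma t w - N0 0 w)].
Proof.
move=> z z01; have [z0 z1] := andP z01; cbv zeta.
have [gxi gzeta [Z1 [Z2 [dev opt2 opt1]]]] := optimal.
have F1F t : 0 <= t <= T -> F1 t `<=` F t.
  by move=> tT; apply: subset_trans (F12_sub t tT) => A FA; apply: sub_gen_smallest; left.
have F2F t : 0 <= t <= T -> F2 t `<=` F t.
  by move=> tT; apply: subset_trans (F12_sub t tT) => A FA; apply: sub_gen_smallest; right.
have gxi' := generating_process_larger F1F gxi.
have gzeta' := generating_process_larger F2F gzeta.
have dev' := randomisation_devicesC dev.
have z01' : 0 <= z <= 1 by rewrite z0 ltW.
have [y1 zy1 J1] : exists2 y, z < y < 1 & forall tau, stopping_time T F1 (cst 0) tau ->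
    expected_payoff P T f g h zeta (level_time T xi y) <= expected_payoff P T f g h zeta tau.
  apply: (optimal_level_min T_gt0 P_complete filtF f_Lb g_Lb h_Lb f_adapted g_adapted
    h_adapted gzeta' filtF1 F1F gxi dev) => // xi' gxi''.
  exact: opt1.
(* For Player 2 the payoffs f and g and the two devices are exchanged, and [game_payoffC] turns the
   saddle point inequality into this form. *)
have [y2 zy2 J2] : exists2 y, z < y < 1 & forall sigma, stopping_time T F2 (cst 0) sigma ->
    expected_payoff P T g f h xi sigma <= expected_payoff P T g f h xi (level_time T zeta y).
  apply: (optimal_level_max T_gt0 P_complete filtF g_Lb f_Lb h_Lb g_adapted f_adapted
    h_adapted gxi' filtF2 F2F gzeta dev') => // zeta' gzeta''.
  by rewrite /randomised_payoff !(game_payoffC g f); exact: opt2.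
have [c1 d1] := stopped_player T_gt0 P_complete filtF filtF1 F1F f_Lb g_Lb h_Lb f_adapted
  g_adapted h_adapted gzeta' V1_def.1 M0_sub.1 M0_def G1_def gxi z0 zy1 (G1_cont z z01')
  (fun theta stheta slater => essinf_attained T_gt0 P_complete filtF filtF1 F1F f_Lb g_Lb
     h_Lb f_adapted g_adapted h_adapted gzeta' stheta slater J1 (V1_def.2 theta stheta)).
have [c2 d2] := stopped_player T_gt0 P_complete filtF filtF2 F2F g_Lb f_Lb h_Lb g_adapted
  f_adapted h_adapted gxi' V2_def.1 N0_super.1 N0_def G2_def gzeta z0 zy2 (G2_cont z z01')
  (fun theta stheta slater => esssup_attained T_gt0 P_complete filtF filtF2 F2F g_Lb f_Lb
     h_Lb g_adapted f_adapted h_adapted gxi' stheta slater J2 (V2_def.2 theta stheta)).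
by split.
Qed.
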